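(* Let $G$ be a Lie group acting properly on a manifold $M$, let $X\in\Gamma(TM)^G$ be a $G$-invariant vector field, let $x_1,x_2\in M$ be two points on the same $G$-orbit with stabilizers $H_1,H_2$, and let $S_1,S_2$ be slices through $x_1,x_2$ respectively. For $i=1,2$ let $X^{S_i}\in\Gamma(TS_i)^{H_i}$ be the component of $X$ tangent to $S_i$ (defined by a choice of $H_i$-equivariant splitting $\mathfrak g=\mathfrak h_i\oplus\mathfrak m_i$). Then, after possibly replacing each $S_i$ by a smaller slice through $x_i$ that is an open subset of $S_i$, there exists an equivariant diffeomorphism $\varphi:S_1\to S_2$ such that the $H_2$-invariant vector fields $\varphi_*(X^{S_1})$ and $X^{S_2}$ on $S_2$ are isomorphic.
   Context: Everything is smooth. $\mathfrak g$ is the Lie algebra of $G$ and $\mathfrak h_i$ that of $H_i$. For $\xi\in\mathfrak g$, $\xi_M(m)=\frac{d}{dt}\big|_{t=0}\exp(t\xi)\cdot m$. Slice: a slice through $x\in M$, with stabilizer $H=G_x$, is an embedded $H$-invariant submanifold $S\subset M$ containing $x$ such that $G\cdot S$ is open in $M$ and $[g,s]\mapsto g\cdot s$ is a $G$-equivariant diffeomorphism from $G\times^H S=(G\times S)/H$ onto $G\cdot S$. Component $X^S$: given an $H$-equivariant (i.e. $\mathrm{Ad}(H)$-invariant) splitting $\mathfrak g=\mathfrak h\oplus\mathfrak m$, for each $y\in S$ one has $T_yM=T_yS\oplus\{\xi_M(y):\xi\in\mathfrak m\}$, and $\xi\mapsto\xi_M(y)$ is injective on $\mathfrak m$. For $X\in\Gamma(TM)^G$,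 $X^S(y)$ is the $T_yS$-component of $X(y)$ in this decomposition; $X^S$ is an $H$-invariant vector field on $S$. (Equivalently, the splitting defines a left-invariant connection on $G\to G\cdot x$, hence one on $G\cdot S\cong G\times^H S\to G\cdot x$, and $X^S$ is the restriction to $S$ of the vertical part of $X$.) Equivariant diffeomorphism $\varphi:S_1\to S_2$ means: for some $g\in G$ with $g\cdot x_1=x_2$ (so $H_2=gH_1g^{-1}$), $\varphi(h\cdot y)=(ghg^{-1})\cdot\varphi(y)$ for all $h\in H_1$, $y\in S_1$. Isomorphic: two $H$-invariant vector fields $Z,Z'$ on a manifold $S$ with an action of a Lie group $H$ with Lie algebra $\mathfrak h$ are isomorphic if $Z=Z'+\psi_S$ for some smooth map $\psi:S\to\mathfrak h$ with $\psi(h\cdot y)=\mathrm{Ad}(h)\psi(y)$, where $\psi_S(y)=\frac{d}{dt}\big|_{t=0}\exp(t\psi(y))\cdot y$. *)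

(* Defs.v *)
From HB Require Import structures.
From mathcomp Require Import all_boot all_order all_algebra.
From mathcomp Require Import boolp classical_sets functions cardinality.
From mathcomp Require Import reals topology normedtype landau derive.

Set Implicit Arguments.
Unset Strict Implicit.
Unset Printing Implicit Defensive.

Import Order.TTheory GRing.Theory Num.Theory.
Import numFieldNormedType.Exports.

Local Open Scope classical_set_scope.
Local Open Scope ring_scope.

(* [U] is meant to be open and [E] finite-dimensional; then directional
   derivatives of class C^k' everywhere amount to a derivative of class C^k'. *)
Fixpoint Ck (R : realType) (E F : normedModType R) (k : nat) (U : set E)
    (f : E -> F) : Prop :=
  if k is k'.+1 then
    (forall x, U x -> differentiable f x) /\
    (forall v : E, Ck k' U (fun x => 'd f x v))
  else forall x, U x -> {for x, continuous f}.

Definition Csmooth (R : realType) (E F : normedModType R) (U : set E)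
    (f : E -> F) : Prop := forall k, Ck k U f.

Section SmoothFacts.
Variable R : realType.
Implicit Types E F : normedModType R.

Lemma diff_near E F (f g : E -> F) (x : E) :
  {near x, f =1 g} -> differentiable f x ->
  differentiable g x /\ 'd g x = 'd f x :> (E -> F).
Proof.
move=> fg df; have fgx := nbhs_singleton fg.
have fg0 : \forall h \near (0 : E), f (h + x) = g (h + x).
  move: fg; rewrite (near_shift 0 x) /=; apply: filterS => h.
  by rewrite subr0.
have H : g \o shift x = cst (g x) + 'd f x +o_ (0 : E) id.
  apply/eqaddoP => e e0.
  have /eqaddoP/(_ e e0) := diff_locally df.
  apply: filter_app; move: fg0; apply: filterS => h fgh.
  by rewrite /= !fctE /= -fgh -fgx.
have cd : continuous ('d f x) by exact: diff_continuous.
have dE := diff_unique cd H.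
split=> //; apply/diff_locallyP; rewrite dE; split => //.
Qed.

Lemma Ck_eq E F k (U : set E) (f g : E -> F) :
  open U -> (forall x, U x -> f x = g x) -> Ck k U f -> Ck k U g.
Proof.
elim: k f g => [|k IH] f g oU fg /=.
  move=> cf x Ux; have nU : nbhs x U by exact: open_nbhs_nbhs.
  rewrite /prop_for /continuous_at -(fg x Ux).
  apply: (cvg_trans _ (cf x Ux)); apply: near_eq_cvg.
  by move: nU; apply: filterS => y Uy; exact: fg.
have nfg x : U x -> {near x, f =1 g}.
  move=> Ux; have : nbhs x U by exact: open_nbhs_nbhs.
  by apply: filterS => y Uy; exact: fg.
move=> [df cf]; split=> [x Ux|v]; first by case: (diff_near (nfg _ Ux) (df _ Ux)).
apply: IH (cf v) => // x Ux.
by case: (diff_near (nfg _ Ux) (df _ Ux)) => _ ->.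
Qed.

Lemma Ck_pair E E' F F' k (U : set E) (V : set E') (f : E -> F) (g : E' -> F') :
  open U -> open V -> Ck k U f -> Ck k V g ->
  Ck k (U `*` V) (fun p : E * E' => (f p.1, g p.2)).
Proof.
move=> oU oV.
elim: k f g => [|k IH] f g /=.
  move=> cf cg [x y] [/= Ux Vy]; apply: cvg_pair => /=.
    by apply: (@cvg_comp _ _ _ fst f _ _ _ cvg_fst); exact: cf.
  by apply: (@cvg_comp _ _ _ snd g _ _ _ cvg_snd); exact: cg.
have oUV : open (U `*` V).
  rewrite openE => -[x y] [/= Ux Vy]; exists (U, V) => //=.
  by split; exact: open_nbhs_nbhs.
have dfst (p : E * E') : is_diff p (fst : E * E' -> E) fst.
  have c : continuous (fst : E * E' -> E) by move=> ?; exact: cvg_fst.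
  apply: DiffDef; first exact: (@linear_differentiable _ _ _ fst).
  exact: (@diff_lin _ _ _ fst).
have dsnd (p : E * E') : is_diff p (snd : E * E' -> E') snd.
  have c : continuous (snd : E * E' -> E') by move=> ?; exact: cvg_snd.
  apply: DiffDef; first exact: (@linear_differentiable _ _ _ snd).
  exact: (@diff_lin _ _ _ snd).
move=> [df cf] [dg cg].
have D p : (U `*` V) p -> is_diff p (fun p : E * E' => (f p.1, g p.2))
    (fun v => ('d f (p.1) (v.1), 'd g (p.2) (v.2))).
  move=> [Up Vp].
  have df1 : is_diff (p.1) f ('d f (p.1)) by apply: DiffDef => //; exact: df.
  have dg2 : is_diff (p.2) g ('d g (p.2)) by apply: DiffDef => //; exact: dg.
  exact: (is_diff_pair (is_diff_comp (dfst p) df1) (is_diff_comp (dsnd p) dg2)).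
split=> [p Up|v]; first by have /@ex_diff := D p Up.
apply: (Ck_eq oUV _ (IH _ _ (cf v.1) (cg v.2))) => p Up.
by have /@diff_val -> := D p Up.
Qed.

Lemma Csmooth_cst E F (U : set E) (a : F) : Csmooth U (fun _ : E => a).
Proof.
move=> k; elim: k a => [|k IH] a /=; first by move=> x _; exact: cst_continuous.
split=> [x _|v]; first exact: differentiable_cst.
rewrite (_ : (fun _ => _) = (fun _ => 0)); first exact: IH.
by apply/funext => x; rewrite (_ : (fun _ => a) = cst a) // diff_cst.
Qed.

Lemma Csmooth_id E (U : set E) : Csmooth U (fun x : E => x).
Proof.
have D (x : E) : is_diff x (fun y : E => y) id by exact: is_diff_id.
case=> [|k] /=; first by move=> x _; exact: cvg_id.
split=> [x _|v]; first by have /@ex_diff := D x.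
rewrite (_ : (fun _ => _) = (fun _ => v)); first exact: Csmooth_cst.
by apply/funext => x; have /@diff_val -> := D x.
Qed.

Lemma open_prod (T T' : topologicalType) (U : set T) (V : set T') :
  open U -> open V -> open (U `*` V).
Proof.
move=> oU oV; rewrite openE => -[x y] [/= Ux Vy]; exists (U, V) => //=.
by split; exact: open_nbhs_nbhs.
Qed.

End SmoothFacts.

(* [cmap] and [cinv] are total functions, only relevant on [cdom] and on
   [cmap @` cdom]. *)
Record chart (R : realType) (E : normedModType R) (T : topologicalType) :=
  Chart {
    cdom : set T;
    cmap : T -> E;
    cinv : E -> T;
    cdom_open : open cdom;
    crange_open : open (cmap @` cdom);
    cmapK : forall p, cdom p -> cinv (cmap p) = p;
    cmap_cts : forall p, cdom p -> {for p, continuous cmap};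
    cinv_cts : forall v, (cmap @` cdom) v -> {for v, continuous cinv}
  }.

Definition transition_smooth (R : realType) (E : normedModType R)
    (T : topologicalType) (c c' : chart E T) : Prop :=
  Csmooth (cmap c @` (cdom c `&` cdom c')) (cmap c' \o cinv c).

Lemma chart_image_open (R : realType) (E : normedModType R)
    (T : topologicalType) (c : chart E T) (U : set T) :
  open U -> open (cmap c @` (cdom c `&` U)).
Proof.
move=> oU.
have -> : cmap c @` (cdom c `&` U) = (cmap c @` cdom c) `&` (cinv c @^-1` U).
  apply/seteqP; split=> [_ [p [cp Up] <-]|_ [[p cp <-] /=]].
    by split; [exists p|rewrite /= cmapK].
  by rewrite cmapK // => Up; exists p.
rewrite openE => v [cv Uv]; apply: filterI.
  by apply: open_nbhs_nbhs; split => //; exact: crange_open.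
by apply: (cinv_cts cv); exact: open_nbhs_nbhs.
Qed.

(* A smooth structure modelled on [E].  [chart_at] records, for each point, a
   preferred chart of the atlas around that point. *)
HB.mixin Record hasSmoothAtlas (R : realType) (E : normedModType R) T
    of Topological T := {
  atlas : set (chart E T);
  chart_at : T -> chart E T;
  chart_at_atlas : forall p, atlas (chart_at p);
  chart_at_dom : forall p, cdom (chart_at p) p;
  atlas_smooth : forall c c', atlas c -> atlas c' -> transition_smooth c c'
}.

#[short(type="smoothSpaceType")]
HB.structure Definition SmoothSpace (R : realType) (E : normedModType R) :=
  {T of Topological T & hasSmoothAtlas R E T}.

HB.mixin Record isSeparatedSecondCountable T of Topological T := {
  mfd_hausdorff : hausdorff_space T;
  mfd_second_countable : @second_countable T
}.

#[short(type="manifoldType")]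
HB.structure Definition Manifold (R : realType) (E : normedModType R) :=
  {T of SmoothSpace R E T & isSeparatedSecondCountable T}.

Section NormedSmoothSpace.
Variables (R : realType) (E : normedModType R).

Let id_crange_open : open ([eta id] @` [set: E]).
Proof. by rewrite image_id; exact: openT. Qed.

Let id_cts (P : set E) (p : E) : P p -> {for p, continuous [eta id]}.
Proof. by move=> _; exact: cvg_id. Qed.

Definition id_chart : chart E E :=
  @Chart R E E setT id id openT id_crange_open
    (fun p _ => erefl) (@id_cts _) (@id_cts _).

Fact id_atlas_smooth (c c' : chart E E) :
  [set id_chart] c -> [set id_chart] c' -> transition_smooth c c'.
Proof. by move=> -> ->; exact: Csmooth_id. Qed.

End NormedSmoothSpace.

HB.instance Definition _ (R : realType) :=
  hasSmoothAtlas.Build R R^o R^o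
    (atlas := [set id_chart R^o]) (chart_at := fun=> id_chart R^o)
    (fun=> erefl) (fun=> I) (@id_atlas_smooth R R^o).

HB.instance Definition _ (R : realType) (m n : nat) :=
  hasSmoothAtlas.Build R 'M[R]_(m, n) 'M[R]_(m, n)
    (atlas := [set id_chart 'M[R]_(m, n)])
    (chart_at := fun=> id_chart 'M[R]_(m, n))
    (fun=> erefl) (fun=> I) (@id_atlas_smooth R 'M[R]_(m, n)).

Section ProductSmoothSpace.
Variables (R : realType) (E F : normedModType R).

Section ProdChart.
Variables (T U : topologicalType) (c : chart E T) (c' : chart F U).

Let pmap (p : T * U) : E * F := (cmap c p.1, cmap c' p.2).
Let pinv (v : E * F) : T * U := (cinv c v.1, cinv c' v.2).
Let pdom := cdom c `*` cdom c'.

Let prangeE : pmap @` pdom = (cmap c @` cdom c) `*` (cmap c' @` cdom c').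
Proof.
apply/seteqP; split=> [_ [[x y] [/= cx cy] <-]|[v w] [/= [x cx xv] [y cy yw]]].
  by split; [exists x|exists y].
by exists (x, y) => //; rewrite /pmap /= xv yw.
Qed.

Let pdom_open : open pdom.
Proof. by apply: open_prod; exact: cdom_open. Qed.

Let prange_open : open (pmap @` pdom).
Proof. by rewrite prangeE; apply: open_prod; exact: crange_open. Qed.

Let pmapK p : pdom p -> pinv (pmap p) = p.
Proof. by case: p => x y [/= cx cy]; rewrite /pinv /pmap /= !cmapK. Qed.

Let pmap_cts p : pdom p -> {for p, continuous pmap}.
Proof.
case: p => x y [/= cx cy]; apply: cvg_pair => /=.
  by apply: (@cvg_comp _ _ _ fst (cmap c) _ _ _ cvg_fst); exact: cmap_cts.
by apply: (@cvg_comp _ _ _ snd (cmap c') _ _ _ cvg_snd); exact: cmap_cts.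
Qed.

Let pinv_cts v : (pmap @` pdom) v -> {for v, continuous pinv}.
Proof.
rewrite prangeE; case: v => v w [/= cv cw]; apply: cvg_pair => /=.
  by apply: (@cvg_comp _ _ _ fst (cinv c) _ _ _ cvg_fst); exact: cinv_cts.
by apply: (@cvg_comp _ _ _ snd (cinv c') _ _ _ cvg_snd); exact: cinv_cts.
Qed.

Definition prod_chart : chart (E * F)%type (T * U)%type :=
  Chart pdom_open prange_open pmapK pmap_cts pinv_cts.

End ProdChart.

Variables (T : smoothSpaceType E) (U : smoothSpaceType F).

Definition prod_atlas : set (chart (E * F)%type (T * U)%type) :=
  [set prod_chart c c' | c in atlas & c' in atlas].

Definition prod_chart_at (p : T * U) := prod_chart (chart_at p.1) (chart_at p.2).

Fact prod_chart_at_atlas p : prod_atlas (prod_chart_at p).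
Proof.
by exists (chart_at p.1); [exact: chart_at_atlas|exists (chart_at p.2);
  [exact: chart_at_atlas|]].
Qed.

Fact prod_chart_at_dom p : cdom (prod_chart_at p) p.
Proof. by split; exact: chart_at_dom. Qed.

Fact prod_atlas_smooth c c' :
  prod_atlas c -> prod_atlas c' -> transition_smooth c c'.
Proof.
move=> [c1 A1 [d1 B1 <-]] [c2 A2 [d2 B2 <-]] k.
have -> : cmap (prod_chart c1 d1) @`
      (cdom (prod_chart c1 d1) `&` cdom (prod_chart c2 d2)) =
    (cmap c1 @` (cdom c1 `&` cdom c2)) `*` (cmap d1 @` (cdom d1 `&` cdom d2)).
  apply/seteqP; split.
    by move=> _ [[x y] [[/= ? ?] [/= ? ?]] <-]; split; [exists x|exists y].
  move=> [v w] [/= [x [? ?] xv] [y [? ?] yw]]; exists (x, y) => //.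
  by rewrite /= xv yw.
apply: (@Ck_pair R E F E F k _ _ (cmap c2 \o cinv c1) (cmap d2 \o cinv d1)).
- by apply: chart_image_open; exact: cdom_open.
- by apply: chart_image_open; exact: cdom_open.
- exact: atlas_smooth.
- exact: atlas_smooth.
Qed.

HB.instance Definition _ := hasSmoothAtlas.Build R (E * F)%type (T * U)%type
  prod_chart_at_atlas prod_chart_at_dom prod_atlas_smooth.

End ProductSmoothSpace.

Section Maps.
Variables (R : realType) (E F : normedModType R).
Variables (M : smoothSpaceType E) (N : smoothSpaceType F).

(* [U] is meant to be open. *)
Definition smooth_open (U : set M) (f : M -> N) : Prop :=
  (forall p, U p -> {for p, continuous f}) /\
  (forall c c', atlas c -> atlas c' ->
     Csmooth (cmap c @` (U `&` cdom c `&` f @^-1` cdom c'))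
             (cmap c' \o f \o cinv c)).

Definition smooth_ext (A : set M) (f : M -> N) (p : M) (f1 : M -> N) : Prop :=
  exists U : set M, [/\ open U, U p, smooth_open U f1 &
                        forall q, (U `&` A) q -> f1 q = f q].

(* Smoothness of a map given on an arbitrary subset [A]: existence of local
   smooth extensions.  This is smoothness in the usual sense when [A] is open
   or is an embedded submanifold. *)
Definition smooth_on (A : set M) (f : M -> N) : Prop :=
  forall p, A p -> exists f1, smooth_ext A f p f1.

(* The tangent space at [p] is the model space, a vector [v] standing for the
   tangent vector of components [v] in [chart_at p]; this is the derivative
   T_p M -> T_(f p) N with this identification. *)
Definition mderiv (f : M -> N) (p : M) : E -> F :=
  'd (cmap (chart_at (f p)) \o f \o cinv (chart_at p)) (cmap (chart_at p) p).

(* Derivative at [p] of a map smooth on [A]; its values on vectors tangent to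
   [A] do not depend on the chosen extension. *)
Definition mderiv_on (A : set M) (f : M -> N) (p : M) : E -> F :=
  mderiv (xget f (smooth_ext A f p)) p.

End Maps.

Definition diffeo_on (R : realType) (E F : normedModType R)
    (M : smoothSpaceType E) (N : smoothSpaceType F)
    (A : set M) (B : set N) (f : M -> N) (f' : N -> M) : Prop :=
  [/\ forall p, A p -> B (f p) /\ f' (f p) = p,
      forall q, B q -> A (f' q) /\ f (f' q) = q,
      smooth_on A f & smooth_on B f'].

Section Submanifolds.
Variable R : realType.

Definition velocity (E : normedModType R) (M : smoothSpaceType E)
    (gamma : R^o -> M) (t : R^o) : E := mderiv gamma t (1 : R^o).

(* [v] is the velocity at [p] of a smooth curve lying in [A]; for an embedded
   submanifold [A] this is T_p A, as a subset of T_p M. *)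
Definition tangent_to (E : normedModType R) (M : smoothSpaceType E)
    (A : set M) (p : M) (v : E) : Prop :=
  exists (e : R) (gamma : R^o -> M),
    let J : set R^o := [set t : R^o | `|t| < e] in
    [/\ 0 < e, smooth_on J gamma, forall t, J t -> A (gamma t),
        gamma 0 = p & velocity gamma 0 = v].

(* Local slice criterion: around each point of [S] there is a chart of the
   smooth structure in which [S] is the locus where the coordinates of index
   at least [k] vanish. *)
Definition embedded_submanifold (n : nat) (M : smoothSpaceType 'rV[R]_n)
    (S : set M) : Prop :=
  exists k : nat, forall p, S p -> exists c : chart 'rV[R]_n M,
    [/\ forall a, atlas a -> transition_smooth c a /\ transition_smooth a c,
        cdom c p &
        forall q, cdom c q ->
          (S q <-> forall i : 'I_n, (k <= i)%N -> cmap c q ord0 i = 0)].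

Definition smooth_field (E : normedModType R) (M : smoothSpaceType E)
    (X : M -> E) : Prop :=
  forall c, atlas c ->
    Csmooth (cmap c @` cdom c)
      (fun v => 'd (cmap c \o cinv (chart_at (cinv c v)))
                   (cmap (chart_at (cinv c v)) (cinv c v)) (X (cinv c v))).

End Submanifolds.

#[short(type="manifoldGroupType")]
HB.structure Definition ManifoldGroup (R : realType) (E : normedModType R) :=
  {G of Manifold R E G & Group G}.

HB.mixin Record isLieGroup (R : realType) (E : normedModType R) G
    of ManifoldGroup R E G := {
  mulg_smooth : smooth_on [set: G * G] (fun gh : G * G => (gh.1 * gh.2)%g);
  invg_smooth : smooth_on [set: G] (fun g : G => (g^-1)%g)
}.

#[short(type="lieGroupType")]
HB.structure Definition LieGroup (R : realType) (E : normedModType R) :=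
  {G of isLieGroup R E G & ManifoldGroup R E G}.

Section LieGroups.
Variables (R : realType) (d : nat) (G : lieGroupType 'rV[R]_d).

(* The Lie algebra of [G] is T_1 G, i.e. ['rV_d] with the components of
   [chart_at 1]. *)

Definition one_parameter_subgroup (xi : 'rV[R]_d) (gamma : R^o -> G) : Prop :=
  [/\ smooth_on [set: R^o] gamma,
      forall s t, gamma (s + t) = (gamma s * gamma t)%g &
      velocity gamma 0 = xi].

(* There is exactly one one-parameter subgroup of velocity [xi] at 0; the
   default value of [xget] is never used. *)
Definition Lie_exp (xi : 'rV[R]_d) : G :=
  xget (fun=> 1%g) (one_parameter_subgroup xi) (1 : R^o).

Definition Ad (g : G) : 'rV[R]_d -> 'rV[R]_d :=
  mderiv (fun a : G => (g * a * g^-1)%g) 1%g.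

(* The Lie algebra of a closed subgroup [H], as a subset of that of [G]. *)
Definition Lie_algebra (H : set G) : set 'rV[R]_d :=
  [set xi | forall t : R, H (Lie_exp (t *: xi))].

Definition equivariant_splitting (H : set G) (m : {vspace 'rV[R]_d}) : Prop :=
  [/\ forall xi, exists eta mu, [/\ Lie_algebra H eta, mu \in m & xi = eta + mu],
      forall xi, Lie_algebra H xi -> xi \in m -> xi = 0 &
      forall h mu, H h -> mu \in m -> Ad h mu \in m].

Section Actions.
Variables (n : nat) (M : manifoldType 'rV[R]_n) (act : G -> M -> M).

Definition smooth_action : Prop :=
  [/\ forall p, act 1%g p = p,
      forall g h p, act (g * h)%g p = act g (act h p) &
      smooth_on [set: G * M] (fun gp : G * M => act gp.1 gp.2)].

Definition proper_action : Prop :=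
  forall K : set (M * M), compact K ->
    compact [set gp : G * M | K (act gp.1 gp.2, gp.2)].

Definition stabilizer (p : M) : set G := [set g | act g p = p].

Definition fundamental_field (xi : 'rV[R]_d) (p : M) : 'rV[R]_n :=
  velocity (fun t : R^o => act (Lie_exp (t *: xi)) p) 0.

Definition invariant_field (X : M -> 'rV[R]_n) : Prop :=
  forall g p, mderiv (act g) p (X p) = X (act g p).

Definition saturation (S : set M) : set M :=
  [set p | exists g s, S s /\ p = act g s].

(* [Q], with projection [pi], is the quotient manifold G x^H S of G x S by the
   action h.(g, s) = (g h^-1, h s): [pi] is a surjective submersion whose
   fibres are the H-orbits. *)
Definition twisted_product (H : set G) (S : set M) (q : nat)
    (Q : manifoldType 'rV[R]_q) (pi : G * M -> Q) : Prop :=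
  let GS : set (G * M) := [set: G] `*` S in
  [/\ smooth_on GS pi,
      forall z, exists2 p, GS p & pi p = z,
      forall p p', GS p -> GS p' ->
        (pi p = pi p' <->
         exists2 h, H h & p' = ((p.1 * h^-1)%g, act h p.2)) &
      forall p, GS p -> forall w, exists2 v,
        tangent_to GS p v & mderiv_on GS pi p v = w].

(* The diffeomorphism [Phi] is induced by (g, s) |-> g s, hence it is
   G-equivariant for the action of G on [Q] by left translations. *)
Definition slice (x : M) (S : set M) : Prop :=
  [/\ embedded_submanifold S, S x,
      forall h s, stabilizer x h -> S s -> S (act h s),
      open (saturation S) &
      exists (q : nat) (Q : manifoldType 'rV[R]_q) (pi : G * M -> Q)
             (Phi : Q -> M) (Phi' : M -> Q),
        [/\ twisted_product (stabilizer x) S pi,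
            forall g s, S s -> Phi (pi (g, s)) = act g s &
            diffeo_on [set: Q] (saturation S) Phi Phi']].

Definition smaller_slice (x : M) (S T : set M) : Prop :=
  slice x T /\ exists2 U : set M, open U & T = S `&` U.

(* [Z] is the S-component of [X] for T_y M = T_y S (+) {xi_M y | xi \in m}; it
   is only relevant at points of [S]. *)
Definition slice_component (X : M -> 'rV[R]_n) (S : set M)
    (m : {vspace 'rV[R]_d}) (Z : M -> 'rV[R]_n) : Prop :=
  forall y, S y -> tangent_to S y (Z y) /\
    exists2 xi, xi \in m & X y = Z y + fundamental_field xi y.

Definition equivariant_map (x1 x2 : M) (S : set M) (phi : M -> M) : Prop :=
  exists2 g : G, act g x1 = x2 &
    forall h y, stabilizer x1 h -> S y ->
      phi (act h y) = act (g * h * g^-1)%g (phi y).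

(* [phi'] is the inverse of [phi], defined on the image of [S]. *)
Definition pushforward (S : set M) (phi phi' : M -> M) (Z : M -> 'rV[R]_n)
    (y : M) : 'rV[R]_n := mderiv_on S phi (phi' y) (Z (phi' y)).

Definition isomorphic_fields (H : set G) (S : set M)
    (Z Z' : M -> 'rV[R]_n) : Prop :=
  exists psi : M -> 'rV[R]_d,
    [/\ smooth_on S psi,
        forall y, S y -> Lie_algebra H (psi y),
        forall h y, H h -> S y -> psi (act h y) = Ad h (psi y) &
        forall y, S y -> Z y = Z' y + fundamental_field (psi y) y].

End Actions.
End LieGroups.

(* Main.v *)
Require Import Defs.
From HB Require Import structures.
From mathcomp Require Import all_boot all_order all_algebra.
From mathcomp Require Import boolp classical_sets functions cardinality.
From mathcomp Require Import reals topology normedtype landau derive sequences.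
From mathcomp Require Import prodnormedzmodule ring lra.

Set Implicit Arguments.
Unset Strict Implicit.
Unset Printing Implicit Defensive.

Import Order.TTheory GRing.Theory Num.Theory.
Import numFieldNormedType.Exports.

Local Open Scope classical_set_scope.
Local Open Scope ring_scope.

(** Near [x2] every [z] can be written as [exp (Xi z) . s] with [Xi z] in the
complement [m2] and [s] in [S2], smoothly and equivariantly in [z].  If
[g0 x1 = x2], then [phi y = exp (- Xi (g0 y)) g0 y] sends [S1] into [S2]; the
same construction at [x1], with the complement [Ad g0^-1 m2], gives its inverse.
Compactness of the stabilizers (properness) makes the neighbourhoods on which
all this holds invariant, and cutting the slices down to them gives [T1], [T2].

Write [phi y = a y . y], [X = X1 + (zeta1)_M] on [S1] and [X = X2 + (zeta2)_M] on
[S2].  As [X] is invariant, [phi_* X1 - X2 = psi_M] along [S2] for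
[psi = (da a^-1) X1 + zeta2 - Ad a zeta1].  Both [phi_* X1] and [X2] are tangent
to [S2], and a fundamental field tangent to a slice comes from the stabilizer, so
[psi] takes its values in the Lie algebra of the stabilizer of [x2].

The exponential map is obtained as the inverse of a logarithm
[log g = lim 2^n (g^(1/2^n) - 1)], which is the Koenigs linearization of the
square root, a germ of derivative 1/2 at the identity. *)

(** * Smooth germs in normed spaces *)

(** The exponential map is specified by a choice among one-parameter subgroups, so that existence
    and uniqueness both have to be proved. Koenigs linearization gives both without integrating a
    vector field: along a one-parameter subgroup the points of parameter t/2^n are successive square
    roots, and the logarithm, a limit along such roots, reads off the velocity. The linearization is
    smooth because the tangent map of a germ of derivative 1/2 is again such a germ, on the doubled
    space. The fields [X1] and [X2] are prescribed along the slices only, whereas psi must be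
    smooth. The zeta_i are therefore rebuilt as smooth germs on [M], by solving a linear system
    whose matrix is the identity at the base point. At [x1] the complement is Ad g0^-1 m2 and not
    [m1], since the decompositions at the two points are then conjugate and their uniqueness makes
    the two maps inverse to each other; [m1] enters through zeta1 alone. Tangent vectors are
    components in preferred charts, which may jump from one point to the next. Smoothness of a field
    or of a derivative is therefore always expressed in one fixed chart. *)

Section ContinuousLinear.
Variable R : realType.
Implicit Types E F : normedModType R.

(** A predicate on plain functions, so that differentials, coordinates and explicit formulas combine
    without building a linear structure for each of them. *)
Definition clin E F (L : E -> F) : Prop := linear L /\ continuous L.

Lemma clin_is_diff E F (L : E -> F) x : clin L -> is_diff x L L.
Proof.
move=> [linL cL].
pose lM := GRing.isLinear.Build _ _ _ _ _ linL.
pose L' : {linear _ -> _} := HB.pack L lM.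
apply: DiffDef; first exact: (@linear_differentiable _ _ _ L').
exact: (@diff_lin _ _ _ L').
Qed.

Lemma clin_comp E F F' (L : E -> F) (L' : F -> F') :
  clin L -> clin L' -> clin (L' \o L).
Proof.
move=> [lL cL] [lL' cL']; split.
  by move=> a x y; rewrite /= lL lL'.
by move=> x; apply: continuous_comp; [exact: cL|exact: cL'].
Qed.

Lemma clin0 E F (L : E -> F) : clin L -> L 0 = 0.
Proof.
by move=> [l _]; have := l (-1) 0 0; rewrite scaler0 addr0 scaleN1r addNr.
Qed.

Lemma clinD E F (L : E -> F) x y : clin L -> L (x + y) = L x + L y.
Proof. by move=> [l _]; have := l 1 x y; rewrite !scale1r. Qed.

Lemma clinZ E F (L : E -> F) a x : clin L -> L (a *: x) = a *: L x.
Proof. by move=> cL; have [l _] := cL; rewrite -[a *: x]addr0 l clin0 // addr0. Qed.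

Lemma clinN E F (L : E -> F) x : clin L -> L (- x) = - L x.
Proof. by move=> cL; rewrite -scaleN1r clinZ // scaleN1r. Qed.

Lemma clinB E F (L : E -> F) x y : clin L -> L (x - y) = L x - L y.
Proof. by move=> cL; rewrite clinD // clinN. Qed.

Lemma clin_sum E F (L : E -> F) n (f : 'I_n -> E) : clin L ->
  L (\sum_i f i) = \sum_i L (f i).
Proof.
by move=> cL; apply: (big_morph L (fun x y => clinD x y cL) (clin0 cL)).
Qed.

Lemma clin_fst E F : clin (fst : E * F -> E).
Proof. by split=> // ?; exact: cvg_fst. Qed.

Lemma clin_snd E F : clin (snd : E * F -> F).
Proof. by split=> // ?; exact: cvg_snd. Qed.

Lemma clin_id E : clin (id : E -> E).
Proof. by split=> // ?; exact: cvg_id. Qed.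

Lemma clin_pair E F F' (L : E -> F) (L' : E -> F') :
  clin L -> clin L' -> clin (fun x => (L x, L' x)).
Proof.
move=> [lL cL] [lL' cL']; split=> [a x y|x]; first by rewrite /= lL lL'.
by apply: cvg_pair; [exact: cL|exact: cL'].
Qed.

Lemma clin_cst0 E F : clin (fun _ : E => 0 : F).
Proof.
by split=> [a x y|x]; [rewrite scaler0 addr0|exact: cst_continuous].
Qed.

Lemma clin_add E F (L L' : E -> F) :
  clin L -> clin L' -> clin (fun x => L x + L' x).
Proof.
move=> [lL cL] [lL' cL']; split=> [a x y|x].
  by rewrite lL lL' scalerDr addrACA.
by apply: continuousD; [exact: cL|exact: cL'].
Qed.

Lemma clin_scalel E (e : E) : clin (fun a : R^o => a *: e).
Proof.
split; last exact: scalel_continuous.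
by move=> a x y; rewrite scalerDl -scalerA.
Qed.

Lemma clin_scaler E (a : R) : clin (fun x : E => a *: x).
Proof.
split; last exact: scaler_continuous.
by move=> b x y; rewrite scalerDr !scalerA mulrC.
Qed.

Lemma clin_diff E F (f : E -> F) x : differentiable f x -> clin ('d f x).
Proof.
by move=> df; split; [move=> a u v; rewrite linearP|exact: diff_continuous].
Qed.

Lemma clin_sumf E F n (L : 'I_n -> E -> F) :
  (forall i, clin (L i)) -> clin (fun x => \sum_i L i x).
Proof.
move=> cL; elim: n L cL => [|n IH] L cL.
  rewrite (_ : (fun _ => _) = (fun _ => 0)); first exact: clin_cst0.
  by apply/funext => x; rewrite big_ord0.
rewrite (_ : (fun _ => _) = (fun x => L ord0 x + \sum_i L (lift ord0 i) x)).
  by apply: clin_add => //; exact: IH.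
by apply/funext => x; rewrite big_ord_recl.
Qed.

End ContinuousLinear.

(* Finite dimension, witnessed by a basis and its continuous coordinates. *)
Class findim (R : realType) (E : normedModType R) := Findim {
  fd_dim : nat;
  fd_b : 'I_fd_dim -> E;
  fd_co : 'I_fd_dim -> E -> R^o;
  fd_co_clin : forall i, clin (fd_co i);
  fd_expand : forall w, w = \sum_i fd_co i w *: fd_b i }.

#[global] Instance findim_R (R : realType) : findim R^o.
Proof.
refine (@Findim R R^o 1 (fun=> 1) (fun=> id) (fun=> @clin_id _ _) _).
by move=> w; rewrite big_ord1; rewrite [RHS]mulr1.
Defined.

#[global] Instance findim_rV (R : realType) n : findim 'rV[R]_n.
Proof.
refine (@Findim R 'rV[R]_n n (fun i => delta_mx 0 i) (fun i v => v 0 i) _ _).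
  move=> i; split; first by move=> a x y; rewrite !mxE.
  exact: coord_continuous.
by move=> w; rewrite [LHS]row_sum_delta.
Defined.

(** Needed for tangent maps, which live on [E * E]: the induction on the order of smoothness of the
    linearization doubles the space at each step. *)
#[global] Instance findim_prod (R : realType) (E F : normedModType R)
  {fE : findim E} {fF : findim F} : findim (E * F)%type.
Proof.
refine (@Findim R (E * F)%type (@fd_dim _ _ fE + @fd_dim _ _ fF)
 (fun i => match fintype.split i with inl j => (fd_b j, 0) | inr j => (0, fd_b j) end)
 (fun i v => match fintype.split i with inl j => fd_co j v.1 | inr j => fd_co j v.2 end)
 _ _).
  move=> i; case: (fintype.split i) => j.
    exact: (clin_comp (@clin_fst _ _ _) (fd_co_clin _)).
  exact: (clin_comp (@clin_snd _ _ _) (fd_co_clin _)).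
move=> [v w]; rewrite big_split_ord /=.
under eq_bigr => i _ do rewrite (unsplitK (inl i)).
under [X in _ + X]eq_bigr => i _ do rewrite (unsplitK (inr i)).
transitivity ((v, 0) + (0, w) : E * F); first by congr pair; rewrite ?addr0 ?add0r.
congr (_ + _).
  rewrite {1}(fd_expand v); elim/big_rec2: _ => // i y x _ <-.
  by congr pair; rewrite /= ?scaler0 ?add0r.
rewrite {1}(fd_expand w); elim/big_rec2: _ => // i y x _ <-.
by congr pair; rewrite /= ?scaler0 ?add0r.
Defined.

(** * Calculus of maps of class C^k *)

Section CkCalculus.
Variable R : realType.
Implicit Types E F : normedModType R.

Lemma lin_clin E F {fE : findim E} (L : E -> F) : linear L -> clin L.
Proof.
move=> lL.
have L0 : L 0 = 0.
  by have := lL (-1) 0 0; rewrite scaler0 addr0 scaleN1r addNr.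
rewrite (_ : L = fun x => \sum_i fd_co i x *: L (fd_b i)).
  apply: clin_sumf => i.
  exact: (clin_comp (fd_co_clin i) (@clin_scalel _ _ (L (fd_b i)))).
apply/funext => x; rewrite {1}(fd_expand x).
have LD : {morph L : x y / x + y}.
  by move=> a b; have := lL 1 a b; rewrite !scale1r.
rewrite (big_morph L LD L0); apply: eq_bigr => i _.
by rewrite -[_ *: _]addr0 lL L0 addr0.
Qed.

Lemma diff_expand E F {fE : findim E} (f : E -> F) x w : differentiable f x ->
  'd f x w = \sum_i fd_co i w *: 'd f x (fd_b i).
Proof.
move=> df; have cd := clin_diff df.
by rewrite {1}(fd_expand w) clin_sum //; apply: eq_bigr => i _; rewrite clinZ.
Qed.

(** At every order [Ck] only quantifies over the points of [U], so it can be checked one point at a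
    time. This is what allows the neighbourhood used in a proof to depend on the order [k]. *)
Lemma Ck_pt E F k (U : set E) (f : E -> F) :
  Ck k U f <-> forall x, U x -> Ck k [set x] f.
Proof.
elim: k f => [|k IH] f /=.
  by split=> [H x Ux y -> //|H x Ux]; [exact: H|exact: (H x Ux x)].
split=> [[df cf] x Ux|H]; first split=> [y ->|v]; first exact: df.
  by apply: (IH _).1 => //; exact: cf.
split=> [x Ux|v]; first by case: (H x Ux) => d _; exact: d.
by apply/IH => x Ux; case: (H x Ux) => _.
Qed.

Lemma Ck_sub E F k (U V : set E) (f : E -> F) : V `<=` U -> Ck k U f -> Ck k V f.
Proof. by move=> VU /Ck_pt H; apply/Ck_pt => x Vx; apply: H; exact: VU. Qed.

Lemma CkW E F k (U : set E) (f : E -> F) : Ck k.+1 U f -> Ck k U f.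
Proof.
elim: k f => [|k IH] f [df cf].
  by move=> x Ux; exact: differentiable_continuous (df x Ux).
by split=> // v; apply: IH; exact: cf.
Qed.

Lemma Ck_clin E F F' k (U : set E) (f : E -> F) (L : F -> F') : open U ->
  clin L -> Ck k U f -> Ck k U (fun x => L (f x)).
Proof.
move=> oU cL; elim: k f => [|k IH] f.
  by move=> cf x Ux; apply: continuous_comp; [exact: cf|apply: cL.2].
move=> [df cf].
have D x : U x -> is_diff x (fun x => L (f x)) (fun v => L ('d f x v)).
  move=> Ux; have df1 : is_diff x f ('d f x) by apply: DiffDef => //; exact: df.
  exact: (is_diff_comp df1 (clin_is_diff _ cL)).
split=> [x Ux|v]; first by have /@ex_diff := D x Ux.
apply: (Ck_eq oU _ (IH _ (cf v))) => x Ux.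
by have /@diff_val -> := D x Ux.
Qed.

Lemma Ck_add E F k (U : set E) (f g : E -> F) : open U ->
  Ck k U f -> Ck k U g -> Ck k U (fun x => f x + g x).
Proof.
move=> oU; elim: k f g => [|k IH] f g.
  by move=> cf cg x Ux; apply: continuousD; [exact: cf|exact: cg].
move=> [df cf] [dg cg].
have D x : U x -> is_diff x (fun x => f x + g x) (fun v => 'd f x v + 'd g x v).
  move=> Ux.
  have df1 : is_diff x f ('d f x) by apply: DiffDef => //; exact: df.
  have dg1 : is_diff x g ('d g x) by apply: DiffDef => //; exact: dg.
  exact: is_diffD.
split=> [x Ux|v]; first by have /@ex_diff := D x Ux.
apply: (Ck_eq oU _ (IH _ _ (cf v) (cg v))) => x Ux.
by have /@diff_val -> := D x Ux.
Qed.

Lemma Ck_sum E F k n (U : set E) (f : 'I_n -> E -> F) : open U ->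
  (forall i, Ck k U (f i)) -> Ck k U (fun x => \sum_i f i x).
Proof.
move=> oU; elim: n f => [|n IH] f cf.
  rewrite (_ : (fun _ => _) = (fun _ => 0)); first exact: Csmooth_cst.
  by apply/funext => x; rewrite big_ord0.
rewrite (_ : (fun _ => _) = (fun x => f ord0 x + \sum_i f (lift ord0 i) x)).
  by apply: Ck_add => //; exact: IH.
by apply/funext => x; rewrite big_ord_recl.
Qed.

Lemma is_diff_scale E F (s ds : E -> R^o) (f df : E -> F) x :
  is_diff x s ds -> is_diff x f df ->
  is_diff x (fun x => s x *: f x) (fun v => s x *: df v + ds v *: f x).
Proof.
move=> Ds Df.
have bil : bilinear_for
    (GRing.Scale.Law.clone _ _ *:%R _) (GRing.Scale.Law.clone _ _ *:%R _)
    (fun (a : R^o) (v : F) => a *: v).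
  by split=> [u'|u] a y z /=;
    rewrite ?scalerDl ?scalerDr !scalerA // mulrC.
pose bM := bilinear_isBilinear.Build R R^o F F _ _ _ bil.
pose B : {bilinear R^o -> F -> F} := HB.pack (fun (a : R^o) (v : F) => a *: v) bM.
have cB : continuous (fun p : R^o * F => B p.1 p.2) by exact: scale_continuous.
have DB : is_diff (s x, f x) (fun p : R^o * F => p.1 *: p.2)
    (fun q => s x *: q.2 + q.1 *: f x).
  apply: DiffDef; first exact: (@differentiable_bilin R R^o F F B (s x, f x) cB).
  exact: (@diff_bilin R R^o F F B (s x, f x) cB).
exact: (is_diff_comp (is_diff_pair Ds Df) DB).
Qed.

Lemma Ck_scale E F k (U : set E) (s : E -> R^o) (f : E -> F) : open U ->
  Ck k U s -> Ck k U f -> Ck k U (fun x => s x *: f x).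
Proof.
move=> oU; elim: k s f => [|k IH] s f.
  by move=> cs cf x Ux; apply: continuousZ; [exact: cs|exact: cf].
move=> Cs Cf; have [ds cs] := Cs; have [df cf] := Cf.
have D x : U x -> is_diff x (fun x => s x *: f x)
    (fun v => s x *: 'd f x v + 'd s x v *: f x).
  by move=> Ux; apply: is_diff_scale; apply: DiffDef; rewrite ?diff_val; auto.
split=> [x Ux|v]; first by have /@ex_diff := D x Ux.
apply: (@Ck_eq _ _ _ _ _ (fun x => s x *: 'd f x v + 'd s x v *: f x) _ oU).
  by move=> x Ux; have /@diff_val -> := D x Ux.
have Cs' := CkW Cs; have Cf' := CkW Cf.
apply: (Ck_add oU).
  exact: (IH s (fun x => 'd f x v) Cs' (cf v)).
exact: (IH (fun x => 'd s x v) f (cs v) Cf').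
Qed.

(** [Ck] speaks of derivatives in fixed directions, but in the chain rule the direction ['d f x v]
    varies with [x]. Expanding it in a basis of [F] leaves the derivatives of [g] along basis
    vectors, with coefficients of class C^k. *)
Lemma Ck_comp E F F' {fF : findim F} k (U : set E) (V : set F)
    (f : E -> F) (g : F -> F') : open U -> open V -> f @` U `<=` V ->
  Ck k U f -> Ck k V g -> Ck k U (fun x => g (f x)).
Proof.
move=> oU oV UV.
have fV x : U x -> V (f x) by move=> Ux; apply: UV; exists x.
elim: k g => [|k IH] g.
  move=> cf cg x Ux; apply: continuous_comp; first exact: cf.
  exact: cg (fV _ Ux).
move=> Cf Cg; have [df cf] := Cf; have [dg cg] := Cg.
have D x : U x -> is_diff x (fun x => g (f x)) (fun v => 'd g (f x) ('d f x v)).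
  move=> Ux.
  have df1 : is_diff x f ('d f x) by apply: DiffDef => //; exact: df.
  have dg1 : is_diff (f x) g ('d g (f x)).
    by apply: DiffDef => //; exact: dg (fV _ Ux).
  exact: is_diff_comp.
split=> [x Ux|v]; first by have /@ex_diff := D x Ux.
apply: (@Ck_eq _ _ _ _ _
    (fun x => \sum_i fd_co i ('d f x v) *: 'd g (f x) (fd_b i)) _ oU).
  move=> x Ux; have /@diff_val -> := D x Ux.
  by rewrite [RHS]diff_expand //; exact: dg (fV _ Ux).
apply: Ck_sum => // i; apply: Ck_scale => //.
  by apply: Ck_clin => //; [exact: fd_co_clin|exact: cf].
by apply: (IH (fun y => 'd g y (fd_b i))); [exact: CkW|exact: cg].
Qed.

(** The derivative of 1/s is - s^-2 ds, in which 1/s occurs at one order less; hence the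
    induction. *)
Lemma Ck_inv E k (U : set E) (s : E -> R^o) : open U ->
  (forall x, U x -> s x != 0) -> Ck k U s -> Ck k U (fun x => (s x)^-1 : R^o).
Proof.
move=> oU s0; elim: k => [|k IH].
  by move=> cs x Ux; apply: continuousV; [exact: s0|exact: cs].
move=> Cs; have [ds cs] := Cs.
have D x : U x -> is_diff x (fun x => (s x)^-1 : R^o)
   (fun v => - ((s x)^-1 *: ((s x)^-1 *: 'd s x v))).
  move=> Ux; apply: DiffDef; first exact: differentiableV (ds _ Ux) (s0 _ Ux).
  rewrite [LHS](diffV (ds _ Ux) (s0 _ Ux)); apply/funext => v /=.
  by rewrite -exprVn scaleNr expr2 -scalerA.
split=> [x Ux|v]; first by have /@ex_diff := D x Ux.
apply: (@Ck_eq _ _ _ _ _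
    (fun x => (-1) *: ((s x)^-1 *: ((s x)^-1 *: 'd s x v))) _ oU).
  by move=> x Ux; have /@diff_val -> := D x Ux; rewrite scaleN1r.
apply: Ck_clin => //; first exact: clin_scaler.
have CI := IH (CkW Cs).
have C1 := Ck_scale oU CI (cs v).
exact: (Ck_scale oU CI C1).
Qed.

End CkCalculus.

(** * Germs of smooth maps *)

Section Germs.
Variable R : realType.
Implicit Types E F : normedModType R.

(** A single neighbourhood serves all orders, so smoothness at a point is an open condition. *)
Definition sm E F (f : E -> F) (x : E) : Prop :=
  exists U : set E, [/\ open U, U x & Csmooth U f].

Lemma sm_open E F (f : E -> F) (U : set E) x :
  open U -> U x -> Csmooth U f -> sm f x.
Proof. by exists U. Qed.

Lemma sm_near E F (f : E -> F) x : sm f x -> \forall y \near x, sm f y.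
Proof.
move=> [U [oU Ux cf]]; have : nbhs x U by exact: open_nbhs_nbhs.
by apply: filterS => y Uy; exists U.
Qed.

Lemma near_open (T : topologicalType) (x : T) (P : T -> Prop) :
  (\forall y \near x, P y) -> exists U : set T, [/\ open U, U x & U `<=` P].
Proof.
move=> nP; have : nbhs x P := nP.
by rewrite nbhsE => -[U [oU Ux] UP]; exists U.
Qed.

Lemma sm_eq E F (f g : E -> F) x : {near x, f =1 g} -> sm f x -> sm g x.
Proof.
move=> /near_open [V [oV Vx fg]] [U [oU Ux cf]]; exists (U `&` V).
split=> //; first exact: openI.
move=> k; apply: (@Ck_eq _ _ _ _ _ f); first exact: openI.
  by move=> y [_ /fg].
by apply: Ck_sub (cf k) => y [].
Qed.

Lemma sm_ext E F (f g : E -> F) x : f =1 g -> sm f x -> sm g x.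
Proof. by move=> /funext ->. Qed.

Lemma sm_Csmooth E F (f : E -> F) (U : set E) :
  (forall x, U x -> sm f x) -> Csmooth U f.
Proof.
move=> sf k; apply/Ck_pt => x /sf [V [_ Vx cf]].
by apply: Ck_sub (cf k) => _ ->.
Qed.

Lemma sm_cts E F (f : E -> F) x : sm f x -> {for x, continuous f}.
Proof. by move=> [U [_ Ux /(_ 0)]]; apply. Qed.

Lemma sm_diff E F (f : E -> F) x : sm f x -> differentiable f x.
Proof. by move=> [U [_ Ux /(_ 1) [d _]]]; exact: d. Qed.

Lemma sm_cst E F (a : F) (x : E) : sm (fun _ => a) x.
Proof. by exists setT; split=> //; [exact: openT|exact: Csmooth_cst]. Qed.

Lemma sm_id E (x : E) : sm (fun x => x) x.
Proof. by exists setT; split=> //; [exact: openT|exact: Csmooth_id]. Qed.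

Lemma sm_clin E F F' (L : F -> F') (f : E -> F) x :
  clin L -> sm f x -> sm (fun x => L (f x)) x.
Proof. by move=> cL [U [oU Ux cf]]; exists U; split=> // k; exact: Ck_clin. Qed.

Lemma sm_lin E F (L : E -> F) x : clin L -> sm L x.
Proof. by move=> cL; exact: (sm_clin cL (sm_id x)). Qed.

Lemma sm_join E F F' (f : E -> F) (g : E -> F') x : sm f x -> sm g x ->
  exists U, [/\ open U, U x, Csmooth U f & Csmooth U g].
Proof.
move=> [U [oU Ux cf]] [V [oV Vx cg]]; exists (U `&` V); split=> //.
- exact: openI.
- by move=> k; apply: Ck_sub (cf k) => y [].
- by move=> k; apply: Ck_sub (cg k) => y [].
Qed.

Lemma sm_add E F (f g : E -> F) x : sm f x -> sm g x -> sm (fun x => f x + g x) x.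
Proof.
move=> sf sg; have [U [oU Ux cf cg]] := sm_join sf sg.
by exists U; split=> // k; exact: Ck_add.
Qed.

Lemma sm_opp E F (f : E -> F) x : sm f x -> sm (fun x => - f x) x.
Proof.
move=> sf; apply: (sm_clin (L := fun y => - y)) => //; split; last exact: opp_continuous.
by move=> a y z; rewrite opprD scalerN.
Qed.

Lemma sm_sub E F (f g : E -> F) x : sm f x -> sm g x -> sm (fun x => f x - g x) x.
Proof. by move=> sf sg; apply: sm_add => //; exact: sm_opp. Qed.

Lemma sm_sum E F n (f : 'I_n -> E -> F) x :
  (forall i, sm (f i) x) -> sm (fun x => \sum_i f i x) x.
Proof.
elim: n f => [|n IH] f cf.
  rewrite (_ : (fun _ => _) = (fun _ => 0)); first exact: sm_cst.
  by apply/funext => y; rewrite big_ord0.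
rewrite (_ : (fun _ => _) = (fun x => f ord0 x + \sum_i f (lift ord0 i) x)).
  by apply: sm_add => //; exact: IH.
by apply/funext => y; rewrite big_ord_recl.
Qed.

Lemma sm_scale E F (s : E -> R^o) (f : E -> F) x :
  sm s x -> sm f x -> sm (fun x => s x *: f x) x.
Proof.
move=> sf sg; have [U [oU Ux cf cg]] := sm_join sf sg.
by exists U; split=> // k; exact: Ck_scale.
Qed.

Lemma sm_inv E (s : E -> R^o) x :
  s x != 0 -> sm s x -> sm (fun x => (s x)^-1 : R^o) x.
Proof.
move=> s0 ss.
have : \forall y \near x, s y != 0 by exact: (@cvgr_neq0 R R^o E (nbhs x) _ s (s x) (sm_cts ss) s0).
move=> /near_open [V [oV Vx sV]].
have [U [oU Ux cs]] := ss; exists (U `&` V); split=> //; first exact: openI.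
move=> k; apply: Ck_inv; first exact: openI.
  by move=> y [_ /sV].
by apply: Ck_sub (cs k) => y [].
Qed.

Lemma sm_comp E F F' {fF : findim F} (f : E -> F) (g : F -> F') x :
  sm f x -> sm g (f x) -> sm (fun x => g (f x)) x.
Proof.
move=> sf [V [oV Vx cg]]; have [U [oU Ux cf]] := sf.
have /near_open [W [oW Wx WV]] : \forall y \near x, V (f y).
  by apply: (sm_cts sf); exact: open_nbhs_nbhs.
exists (U `&` W); split=> //; first exact: openI.
move=> k; apply: (@Ck_comp _ _ _ _ _ _ _ V) => //; first exact: openI.
  by move=> _ [y [_ Wy] <-]; exact: WV.
by apply: Ck_sub (cf k) => y [].
Qed.

Lemma sm_pair E F F' (f : E -> F) (g : E -> F') x :
  sm f x -> sm g x -> sm (fun x => (f x, g x)) x.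
Proof.
move=> sf sg.
have i1 := sm_clin (clin_pair (@clin_id _ F) (@clin_cst0 _ F F')) sf.
have i2 := sm_clin (clin_pair (@clin_cst0 _ F' F) (@clin_id _ F')) sg.
apply: sm_eq (sm_add i1 i2); apply: nearW => y /=.
by congr pair; rewrite ?addr0 ?add0r.
Qed.

Lemma sm_fst E F F' (f : E -> F * F') x : sm f x -> sm (fun x => (f x).1) x.
Proof. exact/sm_clin/clin_fst. Qed.

Lemma sm_snd E F F' (f : E -> F * F') x : sm f x -> sm (fun x => (f x).2) x.
Proof. exact/sm_clin/clin_snd. Qed.

Lemma sm_dir E F (f : E -> F) x v : sm f x -> sm (fun y => 'd f y v) x.
Proof.
by move=> [U [oU Ux cf]]; exists U; split=> // k; have [_] := cf k.+1; apply.
Qed.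

(* The directional derivatives of [f] in a basis make the tangent map of [f]
   jointly smooth. *)
Lemma sm_tangent E F {fE : findim E} (f : E -> F) x w :
  sm f x -> sm (fun p : E * E => 'd f (p.1) (p.2)) (x, w).
Proof.
move=> sf.
have [U [oU Ux cf]] := sf.
have oV : open (U `*` [set: E]) by apply: open_prod => //; exact: openT.
apply: (@sm_eq _ _ (fun p => \sum_i fd_co i p.2 *: 'd f (p.1) (fd_b i))).
  have : nbhs (x, w) (U `*` [set: E]) by exact: open_nbhs_nbhs.
  apply: filterS => -[y v] [/= Uy _]; rewrite [RHS]diff_expand //.
  by have [d _] := cf 1%N; exact: d.
apply: sm_sum => i; apply: sm_scale.
  exact: (sm_clin (fd_co_clin i) (sm_snd (sm_id _))).
apply: (sm_comp (f := fst) (g := fun y => 'd f y (fd_b i))).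
  exact: sm_fst (sm_id _).
exact: sm_dir.
Qed.

Lemma sm_diff_comp E F F' (f : E -> F) (g : F -> F') x v :
  differentiable f x -> differentiable g (f x) ->
  'd (fun x => g (f x)) x v = 'd g (f x) ('d f x v).
Proof.
by move=> df dg; rewrite (_ : (fun x => g (f x)) = g \o f) // diff_comp.
Qed.

Lemma diff_clin E F (L : E -> F) x : clin L -> 'd L x = L :> (E -> F).
Proof. by move=> cL; have /@diff_val := clin_is_diff x cL. Qed.

Lemma diff_clin_comp E F F' (f : E -> F) (L : F -> F') x v :
  differentiable f x -> clin L -> 'd (fun x => L (f x)) x v = L ('d f x v).
Proof.
move=> df cL; have D := clin_is_diff (f x) cL.
by rewrite sm_diff_comp; [rewrite (diff_clin (f x) cL)|exact: df|exact: ex_diff].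
Qed.

Lemma diff_eq E F (f g : E -> F) x v : {near x, f =1 g} -> differentiable f x ->
  'd f x v = 'd g x v.
Proof. by move=> fg df; have [_ ->] := diff_near fg df. Qed.

Lemma diff_addE E F (f g : E -> F) x v : differentiable f x ->
  differentiable g x -> 'd (fun x => f x + g x) x v = 'd f x v + 'd g x v.
Proof.
by move=> df dg; rewrite (_ : (fun x => f x + g x) = f + g) // diffD.
Qed.

Lemma diff_pairE E F F' (f : E -> F) (g : E -> F') x v : differentiable f x ->
  differentiable g x -> 'd (fun x => (f x, g x)) x v = ('d f x v, 'd g x v).
Proof. by move=> df dg; rewrite diff_pair. Qed.

Lemma diff_cstE E F (a : F) (x : E) v : 'd (fun _ => a) x v = 0.
Proof. by rewrite (_ : (fun _ => a) = cst a) // diff_cst. Qed.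

Lemma diff_idE E (x : E) v : 'd (fun x => x) x v = v.
Proof. by rewrite (diff_clin x (@clin_id _ E)). Qed.

Lemma sm_mul E (s t : E -> R^o) x : sm s x -> sm t x -> sm (fun x => s x * t x : R^o) x.
Proof. exact: sm_scale. Qed.

Lemma sm_prod E (I : Type) (r : seq I) (s : I -> E -> R^o) x :
  (forall i, sm (s i) x) -> sm (fun x => \prod_(i <- r) s i x : R^o) x.
Proof.
move=> ss; elim: r => [|i r IH].
  by under eq_fun do rewrite big_nil; exact: sm_cst.
by under eq_fun do rewrite big_cons; exact: sm_mul.
Qed.

Lemma sm_sums E F (I : Type) (r : seq I) (s : I -> E -> F) x :
  (forall i, sm (s i) x) -> sm (fun x => \sum_(i <- r) s i x) x.
Proof.
move=> ss; elim: r => [|i r IH].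
  by under eq_fun do rewrite big_nil; exact: sm_cst.
by under eq_fun do rewrite big_cons; exact: sm_add.
Qed.

Lemma clin_coord m n (i : 'I_m) (j : 'I_n) :
  clin (fun A : 'M[R]_(m, n) => A i j : R^o).
Proof. by split=> [a A B|]; [rewrite !mxE|exact: coord_continuous]. Qed.

Lemma sm_coord E m n (f : E -> 'M[R]_(m, n)) i j x :
  sm f x -> sm (fun x => f x i j : R^o) x.
Proof. by move=> sf; exact: (sm_clin (clin_coord i j) sf). Qed.

Lemma sm_rV E n (f : E -> 'rV[R]_n) x :
  (forall i, sm (fun x => f x 0 i : R^o) x) -> sm f x.
Proof.
move=> sf; apply: (@sm_eq _ _ (fun x => \sum_i (f x 0 i : R^o) *: delta_mx 0 i)).
  by apply: nearW => y; rewrite -row_sum_delta.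
by apply: sm_sum => i; apply: sm_scale (sf i) _; exact: sm_cst.
Qed.

Lemma sm_det E n (A : E -> 'M[R]_n) x :
  (forall i j, sm (fun x => A x i j : R^o) x) -> sm (fun x => \det (A x) : R^o) x.
Proof.
move=> sA; rewrite /determinant; apply: sm_sums => s; apply: sm_mul.
  exact: sm_cst.
by apply: sm_prod => i; exact: sA.
Qed.

(** Cramer's rule: near [x] the inverse matrix is the adjugate divided by the determinant, and both
    are polynomials in the entries. *)
Lemma sm_mul_invmx E n (A : E -> 'M[R]_n) (v : E -> 'rV[R]_n) x :
  (forall i j, sm (fun x => A x i j : R^o) x) -> sm v x -> A x \in unitmx ->
  sm (fun x => v x *m invmx (A x)) x.
Proof.
move=> sA sv uA.
have sd := sm_det sA; move: (uA); rewrite unitmxE unitfE => d0.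
have nd : \forall y \near x, \det (A y) != 0 by exact: (@cvgr_neq0 R R^o E (nbhs x) _ _ _ (sm_cts sd) d0).
apply: (@sm_eq _ _ (fun x => (\det (A x))^-1 *: (v x *m \adj (A x)))).
  move: nd; apply: filterS => y dy.
  by rewrite /invmx unitmxE unitfE dy -scalemxAr.
apply: sm_scale; first exact: sm_inv.
apply: sm_rV => i.
apply: (@sm_eq _ _ (fun x => \sum_j (v x 0 j : R^o) * (\adj (A x)) j i : R^o)).
  by apply: nearW => y; rewrite mxE.
apply: sm_sum => j; apply: sm_mul; first exact: sm_coord.
apply: (@sm_eq _ _ (fun x => (-1) ^+ (i + j) * \det (row' i (col' j (A x))) : R^o)).
  by apply: nearW => y; rewrite mxE.
apply: sm_mul; first exact: sm_cst.
apply: sm_det => k l.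
apply: (@sm_eq _ _ (fun x => A x (lift i k) (lift j l) : R^o)) (sA _ _).
by apply: nearW => y; rewrite !mxE.
Qed.

End Germs.

(** * Mean value estimates and the inverse function theorem *)

Section MeanValue.
Variable R : realType.
Implicit Types E F : normedModType R.

Lemma clin_bound E F (L : E -> F) : clin L ->
  exists2 k, 0 < k & forall x, `|L x| <= k * `|x|.
Proof.
move=> [linL cL].
pose lM := GRing.isLinear.Build _ _ _ _ _ linL.
pose L' : {linear _ -> _} := HB.pack L lM.
exact: (@linear_lipschitz _ _ _ L').
Qed.

Lemma fd_bound E {fE : findim E} :
  exists2 k, 0 < k & forall x, \sum_i `|fd_co i x| * `|fd_b i| <= k * `|x|.
Proof.
have /choice [k kP] : forall i : 'I_(@fd_dim _ _ fE), exists k, 0 < k /\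
    forall x, `|fd_co i x| <= k * `|x|.
  by move=> i; have [k k0 kP] := clin_bound (fd_co_clin i); exists k.
exists (1 + \sum_i k i * `|fd_b i|).
  rewrite ltr_pwDl // sumr_ge0 // => i _.
  by rewrite mulr_ge0 //; have [/ltW] := kP i.
move=> x; rewrite mulrDl ler_wpDl ?mul1r // mulr_suml ler_sum // => i _.
by rewrite mulrAC ler_wpM2r //; have [_] := kP i.
Qed.

Lemma fd_norm E {fE : findim E} (x : E) : `|x| <= \sum_i `|fd_co i x| * `|fd_b i|.
Proof.
rewrite {1}(fd_expand x) (le_trans (ler_norm_sum _ _ _)) // ler_sum // => i _.
by rewrite normrZ.
Qed.

Lemma ball_segment E (a x y : E) (r t : R) : 0 <= t -> t <= 1 ->
  ball a r x -> ball a r y -> ball a r (y + t *: (x - y)).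
Proof.
move=> t0 t1; rewrite -!ball_normE /= => ax ay.
have -> : a - (y + t *: (x - y)) = t *: (a - x) + (1 - t) *: (a - y).
  rewrite scalerBl scale1r addrCA -scalerBr.
  have -> : a - x - (a - y) = - (x - y) by rewrite !opprB addrC subrKA.
  by rewrite scalerN opprD addrA.
rewrite (le_lt_trans (ler_normD _ _)) // !normrZ ger0_norm // ger0_norm ?subr_ge0 //.
have [->|tn] := eqVneq t 0; first by rewrite mul0r add0r subr0 mul1r.
have -> : r = t * r + (1 - t) * r by rewrite mulrBl mul1r addrC subrK.
rewrite ltr_leD // ?ltr_pM2l // ?lt_def ?tn //.
by rewrite ler_wpM2l ?subr_ge0 // ltW.
Qed.

(** The scalar mean value theorem yields an intermediate point that depends on the coordinate, so
    each coordinate is bounded separately. The constant [K] depends on [F] alone; it stays fixed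
    while [M] and the ball vary. *)
Lemma mean_value E F {fF : findim F} : exists2 K, 0 < K &
  forall (f : E -> F) (a : E) (r M : R),
  (forall z, ball a r z -> differentiable f z /\ forall w, `|'d f z w| <= M * `|w|) ->
  forall x y, ball a r x -> ball a r y -> `|f x - f y| <= K * M * `|x - y|.
Proof.
have [k k0 kP] := @fd_bound F fF.
(* The extra [k] keeps the constant positive when the dimension is 0. *)
exists (\sum_(i < @fd_dim _ _ fF) k + k).
  by rewrite ltr_wpDl // sumr_ge0 // => i _; exact: ltW.
move=> f a r M df x y ax ay; set w := x - y.
have M0 : 0 <= M * `|w|.
  by have [_ /(_ w)] := df _ ax; apply: le_trans.
rewrite (le_trans (fd_norm _)) // -mulrA mulrDl ler_wpDr //.
  by rewrite mulr_ge0 // ltW.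
rewrite mulr_suml ler_sum // => i _.
pose p t : E := y + t *: w.
have bp (t : R) : 0 <= t -> t <= 1 -> ball a r (p t) by move=> *; exact: ball_segment.
pose phi (t : R) : R := fd_co i (f (p t)).
have D (t : R) : 0 <= t -> t <= 1 -> is_derive (t : R^o) (1 : R^o) phi (fd_co i ('d f (p t) w)).
  move=> t0 t1.
  have Dp : is_diff (t : R^o) (p : R^o -> E) (fun s => s *: w).
    rewrite (_ : p = cst y + (fun s : R^o => s *: w)) //.
    apply: is_diff_eq (is_diffD (is_diff_cst y t) (clin_is_diff t (clin_scalel w))) _.
    by rewrite add0r.
  have Df : is_diff (p t) f ('d f (p t)) by apply: DiffDef; first exact: (df _ (bp _ t0 t1)).1.
  have Dc := clin_is_diff (f (p t)) (fd_co_clin i).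
  have DD := is_diff_comp Dp (is_diff_comp Df Dc).
  have dphi : differentiable (phi : R^o -> R^o) t by have /@ex_diff := DD.
  apply: DeriveDef; first exact: diff_derivable.
  rewrite deriveE //.
  by have /@diff_val -> := DD; rewrite /= scale1r.
have [c c01] : exists2 c, c \in `[0, 1]%R &
    phi 1 - phi 0 = fd_co i ('d f (p c) w) * (1 - 0).
  apply: MVT_segment => //.
    by move=> t; rewrite in_itv /= => /andP[t0 t1]; apply: D; exact: ltW.
  apply: derivable_within_continuous => t; rewrite in_itv /= => /andP[t0 t1].
  by have /@ex_derive := D t t0 t1.
have p1 : p 1 = x by rewrite /p scale1r /w addrC subrK.
have p0 : p 0 = y by rewrite /p scale0r addr0.
rewrite subr0 mulr1 /phi p1 p0 => E1.
rewrite clinB ?E1; last exact: fd_co_clin.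
move: c01; rewrite in_itv /= => /andP[c0 c1].
have [_ /(_ w) dw] := df _ (bp c c0 c1).
have h v : `|fd_co i v| * `|fd_b i| <= k * `|v|.
  apply: le_trans (kP v); rewrite (bigD1 i) //= lerDl sumr_ge0 // => j _.
  by rewrite mulr_ge0.
by rewrite (le_trans (h _)) // ler_wpM2l // ltW.
Qed.

Lemma is_diff_intro E F (g : E -> F) (L : E -> F) (y : E) : clin L ->
  (forall e, 0 < e -> \forall k \near (0 : E), `|g (k + y) - g y - L k| <= e * `|k|) ->
  is_diff y g L.
Proof.
move=> [linL cL] H.
pose lM := GRing.isLinear.Build _ _ _ _ _ linL.
pose L' : {linear _ -> _} := HB.pack L lM.
have H1 : g \o shift y = cst (g y) + L' +o_ (0 : E) id.
  apply/eqaddoP => e e0; have := H e e0; apply: filterS => k.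
  by rewrite /= !fctE /= opprD addrA.
have dE := @diff_unique _ _ _ g L' y cL H1.
by apply: DiffDef => //; apply/diff_locallyP; rewrite dE; split.
Qed.

Lemma near_norm_le E F (f : E -> F) (a : E) e : {for a, continuous f} ->
  f a = 0 -> 0 < e -> \forall z \near a, `|f z| <= e.
Proof.
move=> cf f0 e0; have := @cvgr_norm_le _ _ _ (nbhs a) _ f _ cf e.
by rewrite f0 normr0; apply.
Qed.

Lemma near_forall_fin (T : topologicalType) (x : T) n (P : 'I_n -> T -> Prop) :
  (forall i, \forall z \near x, P i z) -> \forall z \near x, forall i, P i z.
Proof. by move=> H; exact: filter_forall. Qed.

Lemma near_diff_small E F {fE : findim E} (f : E -> F) (a : E) : sm f a ->
  (forall w, 'd f a w = 0) -> forall e, 0 < e ->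
  \forall z \near a, forall w, `|'d f z w| <= e * `|w|.
Proof.
move=> sf d0 e e0; have [k k0 kP] := @fd_bound E fE.
pose m := (1 + \sum_(i < @fd_dim _ _ fE) (`|fd_b i|^-1)).
have : \forall z \near a, forall i, `|'d f z (fd_b i)| <= e / k * `|fd_b i|.
  apply: near_forall_fin => i.
  have [b0|bn] := eqVneq (fd_b i) 0.
    by apply: nearW => z; rewrite b0 linear0 !normr0 mulr0.
  apply: near_norm_le; [exact: sm_cts (sm_dir _ sf)|exact: d0|].
  by rewrite mulr_gt0 ?divr_gt0 // normr_gt0.
apply: filterS2 (sm_near sf) => z sz H w.
rewrite diff_expand; last exact: sm_diff.
rewrite (le_trans (ler_norm_sum _ _ _)) //.
apply: (@le_trans _ _ (e / k * (\sum_i `|fd_co i w| * `|fd_b i|))).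
  rewrite mulr_sumr ler_sum // => i _; rewrite normrZ mulrCA ler_wpM2l //.
by rewrite -mulrA ler_wpM2l ?(ltW e0) // ler_pdivrMl.
Qed.

Lemma near_ball_ex E (a : E) (P : E -> Prop) : (\forall z \near a, P z) ->
  exists2 r, 0 < r & forall z, ball a r z -> P z.
Proof. by move=> /nbhs_ballP [r r0 H]; exists r. Qed.

(** Strict differentiability: the mean value estimate applied to [f] minus its differential at [a],
    whose derivative is small near [a]. *)
Lemma sm_strict E F {fE : findim E} {fF : findim F} (f : E -> F) (a : E) :
  sm f a -> forall e, 0 < e -> exists2 r, 0 < r &
  forall x y, ball a r x -> ball a r y ->
    `|f x - f y - 'd f a (x - y)| <= e * `|x - y|.
Proof.
move=> sf e e0; have [K K0 KP] := @mean_value E F fF.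
have cD := clin_diff (sm_diff sf).
pose g x := f x - 'd f a x.
have sg : sm g a by apply: sm_sub => //; exact: sm_lin.
have g0 w : 'd g a w = 0.
  rewrite /g (@diff_addE _ _ _ f (fun x => - 'd f a x)).
  - have cN := clin_comp cD (@clin_scaler _ _ (-1)).
    rewrite (_ : (fun x => - _) = (fun x => -1 *: 'd f a x)).
      by rewrite (diff_clin _ cN) /= scaleN1r subrr.
    by apply/funext => x; rewrite scaleN1r.
  - exact: sm_diff.
  - by apply: sm_diff; apply: sm_opp; exact: sm_lin.
have eK : 0 < e / K by rewrite divr_gt0.
have [r r0 rP] := near_ball_ex (filterI (near_diff_small sg g0 eK) (sm_near sg)).
exists r => // x y ax ay.
have -> : f x - f y - 'd f a (x - y) = g x - g y.
  by rewrite /g linearB !opprB addrACA [RHS]addrACA; congr (_ + _); rewrite addrC.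
rewrite (le_trans (KP g a r (e / K) _ x y ax ay)) //.
  by move=> z /rP[H sz]; split=> //; exact: sm_diff.
by rewrite [K * _]mulrCA divff ?gt_eqF // mulr1.
Qed.

Lemma sm_lip E F {fE : findim E} {fF : findim F} (f : E -> F) (a : E) :
  sm f a -> exists C, 0 < C /\ exists2 r, 0 < r &
  forall x y, ball a r x -> ball a r y -> `|f x - f y| <= C * `|x - y|.
Proof.
move=> sf; have [r r0 rP] := sm_strict sf ltr01.
have [k k0 kP] := clin_bound (clin_diff (sm_diff sf)).
exists (1 + k); split; first by rewrite addr_gt0.
exists r => // x y ax ay.
have := rP _ _ ax ay; have := kP (x - y); set D := 'd f a (x - y) => h1 h2.
rewrite -(subrK D (f x - f y)) (le_trans (ler_normD _ _)) // mulrDl.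
exact: lerD.
Qed.

Lemma sm_diff_lip E F {fE : findim E} {fF : findim F} (f : E -> F) (a : E) :
  sm f a -> exists C, 0 < C /\
  \forall z \near a, forall w, `|'d f z w - 'd f a w| <= C * `|z - a| * `|w|.
Proof.
move=> sf; have [k k0 kP] := @fd_bound E fE.
have /choice [c cP] : forall i : 'I_(@fd_dim _ _ fE), exists c, 0 < c /\
    \forall z \near a, `|'d f z (fd_b i) - 'd f a (fd_b i)| <= c * `|z - a|.
  move=> i; have [c [c0 [r r0 rP]]] := sm_lip (sm_dir (fd_b i) sf).
  exists c; split=> //; apply/nbhs_ballP; exists r => // z az.
  by apply: rP => //; exact: ballxx.
have [k' k'0 k'P] : exists2 k', 0 < k' & forall i w, `|@fd_co _ _ fE i w| <= k' * `|w|.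
  have /choice [l lP] : forall i : 'I_(@fd_dim _ _ fE), exists l, 0 < l /\
    forall x, `|fd_co i x| <= l * `|x|.
    by move=> i; have [l l0 lP] := clin_bound (fd_co_clin i); exists l.
  have l0 i : 0 <= l i by have [/ltW] := lP i.
  exists (1 + \sum_i l i) => [|i w]; first by rewrite ltr_pwDl // sumr_ge0.
  rewrite (le_trans ((lP i).2 w)) // ler_wpM2r //.
  by rewrite (bigD1 i) //= addrCA lerDl addr_ge0 // sumr_ge0.
have c0 i : 0 <= c i by have [/ltW] := cP i.
exists (1 + \sum_i c i * k'); split.
  by rewrite ltr_pwDl // sumr_ge0 // => i _; rewrite mulr_ge0 // ltW.
have := near_forall_fin (fun i => (cP i).2).
apply: filterS2 (sm_near sf) => z sz H w.
rewrite !diff_expand; [|exact: sm_diff..].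
rewrite -sumrB (le_trans (ler_norm_sum _ _ _)) //.
rewrite -mulrA mulrDl ler_wpDl ?mulr_ge0 // mulr_suml ler_sum // => i _.
rewrite -scalerBr normrZ (le_trans (ler_pM _ _ (k'P i w) (H i))) //.
by rewrite mulrACA [k' * _]mulrC ler_wpM2l ?mulr_ge0 ?(ltW k'0) // mulrC.
Qed.

(** Taylor remainder of order two: the derivative of [f] minus its differential at [a] is bounded by
    a multiple of the distance to [a], and the mean value estimate is used on a ball whose radius is
    proportional to [|x - a|]. *)
Lemma sm_quad E F {fE : findim E} {fF : findim F} (f : E -> F) (a : E) :
  sm f a -> exists C, 0 < C /\
  \forall x \near a, `|f x - f a - 'd f a (x - a)| <= C * `|x - a| ^+ 2.
Proof.
move=> sf; have [K K0 KP] := @mean_value E F fF.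
have cD := clin_diff (sm_diff sf).
pose g x := f x - 'd f a x.
have [C [C0 CP]] := sm_diff_lip sf.
have dg z : sm f z -> forall w, 'd g z w = 'd f z w - 'd f a w.
  move=> sz w; rewrite /g (@diff_addE _ _ _ f (fun x => - 'd f a x)).
  - have cN := clin_comp cD (@clin_scaler _ _ (-1)).
    rewrite (_ : (fun x => - _) = (fun x => -1 *: 'd f a x)).
      by rewrite (diff_clin _ cN) /= scaleN1r.
    by apply/funext => x; rewrite scaleN1r.
  - exact: sm_diff.
  - by apply: sm_diff; apply: sm_opp; exact: sm_lin.
have [r r0 rP] := near_ball_ex (filterI CP (sm_near sf)).
(* The ball has radius [2 * |x - a|], to contain [x] in its interior; this accounts for the factor 2
   here and for the radius [r / 2] below. *)
exists (K * C * 2); split; first by rewrite !mulr_gt0.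
apply/nbhs_ballP; exists (r / 2); first by rewrite /= divr_gt0.
move=> x; rewrite -ball_normE /= distrC => xa.
have [->|xn] := eqVneq x a; first by rewrite !subrr linear0 subrr !normr0 mulr_ge0 // !mulr_ge0 // ltW.
have n0 : 0 < `|x - a| by rewrite normr_gt0 subr_eq0.
have -> : f x - f a - 'd f a (x - a) = g x - g a.
  by rewrite /g linearB !opprB addrACA [RHS]addrACA; congr (_ + _); rewrite addrC.
have bx : ball a (2 * `|x - a|) x by rewrite -ball_normE /= distrC ltr_pMl // ltr1n.
have ba : ball a (2 * `|x - a|) a by apply: ballxx; rewrite mulr_gt0.
rewrite (le_trans (KP g a (2 * `|x - a|) (C * (2 * `|x - a|)) _ x a bx ba)) //; last first.
  by rewrite expr2 !mulrA.
move=> z; rewrite -ball_normE /= distrC => az.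
have [H1 sz] : (forall w, `|'d f z w - 'd f a w| <= C * `|z - a| * `|w|) /\ sm f z.
  apply: rP; rewrite -ball_normE /= distrC (lt_trans az) //.
  by rewrite mulrC -ltr_pdivlMr.
split=> [|w].
  by apply: sm_diff; apply: sm_sub => //; exact: sm_lin.
rewrite dg // (le_trans (H1 w)) // ler_wpM2r // ler_wpM2l ?(ltW C0) //.
exact: ltW.
Qed.

End MeanValue.

(** * Sequences that converge geometrically *)

Section Geometric.
Variable R : realType.
Implicit Types E F : normedModType R.

(** Used to pass to the limit: an inequality that holds up to an error [C * q ^+ n] for every [n]
    holds exactly. *)
Lemma le_geo0 (x C q : R) : 0 <= q -> q < 1 ->
  (forall n, x <= C * q ^+ n) -> x <= 0.
Proof.
move=> q0 q1 H; rewrite leNgt; apply/negP => x0.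
have C0 : 0 < C.
  by have := H 0; rewrite expr0 mulr1; exact: lt_le_trans.
have cq : (fun n => q ^+ n : R^o) @ \oo --> (0 : R^o).
  by apply: cvg_expr; rewrite ger0_norm.
have xC : 0 < x / C by rewrite divr_gt0.
have [N _ HN] := @cvgr_dist_lt _ _ _ _ _ _ _ cq (x / C) xC.
have := HN N (leqnn N); rewrite /= sub0r normrN ger0_norm ?exprn_ge0 //.
by rewrite ltr_pdivlMr // mulrC ltNge H.
Qed.

(** Subtracting the tail [B * q ^+ n] of the geometric series makes the sequence nondecreasing and
    bounded, so completeness is used through monotone convergence. *)
Lemma geo_cvgR (u : nat -> R) (C q : R) : 0 <= q -> q < 1 ->
  (forall n, `|u n.+1 - u n| <= C * q ^+ n) ->
  exists l : R^o, (u : nat -> R^o) @ \oo --> l.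
Proof.
move=> q0 q1 H; pose B := C / (1 - q).
have B1 : B * (1 - q) = C by rewrite /B divfK // subr_eq0 gt_eqF.
have C0 : 0 <= C by have := H 0; rewrite expr0 mulr1; exact: le_trans.
have B0 : 0 <= B by rewrite divr_ge0 // subr_ge0 ltW.
have q0n n : 0 <= q ^+ n by rewrite exprn_ge0.
pose a n := u n - B * q ^+ n.
have H1 n : u n - C * q ^+ n <= u n.+1 <= u n + C * q ^+ n.
  by have := H n; rewrite ler_norml lerBrDr lerBlDr addrC [C * _ + _]addrC.
have CB n : C * q ^+ n = B * q ^+ n - B * q ^+ n.+1.
  by rewrite -B1 exprS; ring.
have nda : nondecreasing_seq (a : nat -> R).
  apply/nondecreasing_seqP => n; rewrite /a.
  have := H1 n; rewrite CB; set x := B * _; set y := B * _ => /andP[h _].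
  by move: h; lra.
have ub n : u n + B * q ^+ n <= u 0 + B.
  elim: n => [|n IH]; first by rewrite expr0 mulr1.
  apply: le_trans IH; have := H1 n; rewrite CB.
  set x := B * _; set y := B * _ => /andP[_ h].
  by move: h; lra.
have cva : cvgn (a : nat -> R^o).
  apply: nondecreasing_is_cvgn => //; exists (u 0 + B) => _ [n _ <-].
  apply: le_trans (ub n); rewrite /a.
  by have := mulr_ge0 B0 (q0n n); set x := B * _; lra.
have cq : (fun n => q ^+ n : R^o) @ \oo --> (0 : R^o).
  by apply: cvg_expr; rewrite ger0_norm.
have cBq : (fun n => B *: (q ^+ n : R^o)) @ \oo --> B *: (0 : R^o).
  exact: cvgZl_tmp cq.
exists (limn (a : nat -> R^o) + B *: (0 : R^o)).
rewrite (_ : u = fun n => (a n : R^o) + B *: (q ^+ n : R^o)); last first.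
  by apply/funext => n; rewrite /a subrK.
exact: cvgD cva cBq.
Qed.

Lemma norm_le0_eq E (x : E) : `|x| <= 0 -> x = 0.
Proof. by rewrite normr_le0 => /eqP. Qed.

Lemma norm_sub_eq E (x y : E) : `|x - y| <= 0 -> x = y.
Proof. by move=> /norm_le0_eq /subr0_eq. Qed.

Lemma clin_cvg E F (L : E -> F) (u : nat -> E) (l : E) : clin L ->
  u @ \oo --> l -> (fun n => L (u n)) @ \oo --> L l.
Proof. by move=> [_ cL] ul; apply: continuous_cvg ul; exact: cL. Qed.

Lemma cvg_sum_ord E n (u : 'I_n -> nat -> E) (l : 'I_n -> E) :
  (forall i, u i @ \oo --> l i) ->
  (fun m => \sum_i u i m) @ \oo --> \sum_i l i.
Proof.
elim: n u l => [|n IH] u l H.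
  by under eq_fun do rewrite big_ord0; rewrite big_ord0; exact: cvg_cst.
under eq_fun do rewrite big_ord_recl; rewrite big_ord_recl.
by apply: cvgD; [exact: H|apply: IH].
Qed.

Lemma geo_cvg E {fE : findim E} (u : nat -> E) (C q : R) : 0 <= q -> q < 1 ->
  (forall n, `|u n.+1 - u n| <= C * q ^+ n) ->
  exists l : E, u @ \oo --> l /\ forall n, `|u n - l| <= C / (1 - q) * q ^+ n.
Proof.
move=> q0 q1 H.
have q0n n : 0 <= q ^+ n by rewrite exprn_ge0.
have /choice [l lP] : forall i : 'I_(@fd_dim _ _ fE), exists l : R^o,
    (fun n => fd_co i (u n)) @ \oo --> l.
  move=> i; have [k k0 kP] := clin_bound (fd_co_clin i).
  apply: (@geo_cvgR (fun n => fd_co i (u n)) (k * C) q) => // n.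
  rewrite -clinB; last exact: fd_co_clin.
  by rewrite (le_trans (kP _)) // -mulrA ler_wpM2l // ltW.
have ul : u @ \oo --> \sum_i l i *: fd_b i.
  rewrite (_ : u = fun n => \sum_i fd_co i (u n) *: fd_b i).
    apply: cvg_sum_ord => i; exact: (clin_cvg (clin_scalel (fd_b i)) (lP i)).
  by apply/funext => n; rewrite -fd_expand.
exists (\sum_i l i *: fd_b i); split=> // n; set L := \sum_i _.
pose B := C / (1 - q).
have B1 : B * (1 - q) = C by rewrite /B divfK // subr_eq0 gt_eqF.
have C0 : 0 <= C by have := H 0; rewrite expr0 mulr1; exact: le_trans.
have B0 : 0 <= B by rewrite divr_ge0 // subr_ge0 ltW.
have Bk k : `|u n - u (n + k)%N| <= B * q ^+ n.
  apply: (@le_trans _ _ (B * q ^+ n - B * q ^+ (n + k)%N)); last first.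
    by have := mulr_ge0 B0 (q0n (n + k)%N); lra.
  elim: k => [|k IH]; first by rewrite addn0 !subrr normr0.
  rewrite addnS -(subrK (u (n + k)%N) (u n)) -addrA (le_trans (ler_normD _ _)) //.
  have := H (n + k)%N; rewrite distrC -B1 exprS.
  move: IH; set x := `|_|; set y := `|_|; set t := q ^+ (n + k)%N; set s := q ^+ n.
  by nra.
rewrite -/B; apply/ler_addgt0Pl => e e0.
have [N _ HN] := @cvgr_dist_lt _ _ _ _ _ _ _ ul e e0.
have := HN (n + N)%N; rewrite /= leq_addl => /(_ isT) hN.
rewrite -(subrK (u (n + N)%N) (u n)) -addrA (le_trans (ler_normD _ _)) //.
by move: (Bk N) hN; rewrite [in X in _ -> X -> _]distrC; lra.
Qed.

End Geometric.

(** * The inverse function theorem *)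

Section InverseFunction.
Variables (R : realType) (n : nat).
Implicit Types f g : 'rV[R]_n -> 'rV[R]_n.

(** The derivative at [a] is normalized to the identity; uses of the theorem arrange this by a
    choice of coordinates. Then [f] differs from the identity by a 1/2-Lipschitz map on a ball,
    which gives both the solution of [f x = y] by iteration and a 2-Lipschitz inverse. *)
Lemma inverse_function f a : sm f a -> (forall w, 'd f a w = w) ->
  exists g, [/\ sm g (f a), g (f a) = a, (\forall x \near a, g (f x) = x) &
                \forall y \near f a, f (g y) = y].
Proof.
move=> sf df.
have h0 : 0 < (1/2 : R) by lra.
have [r1 r10 r1P] := sm_strict sf h0.
have [r2 r20 r2P] := near_ball_ex (sm_near sf).
pose r := Num.min r1 r2.
have r0 : 0 < r by rewrite lt_min r10.
have St (x y : 'rV[R]_n) : ball a r x -> ball a r y -> `|f x - f y - (x - y)| <= 1/2 * `|x - y|.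
  move=> ax ay; have := r1P x y; rewrite df; apply.
    by apply: le_ball ax; rewrite ge_min lexx.
  by apply: le_ball ay; rewrite ge_min lexx.
have sfr (x : 'rV[R]_n) : ball a r x -> sm f x.
  by move=> ax; apply: r2P; apply: le_ball ax; rewrite ge_min lexx orbT.
have lip (x y : 'rV[R]_n) : ball a r x -> ball a r y -> `|x - y| <= 2 * `|f x - f y|.
  move=> ax ay; have := St x y ax ay.
  have := ler_normB (f x - f y) (f x - f y - (x - y)).
  have -> : f x - f y - (f x - f y - (x - y)) = x - y by rewrite opprB addrC subrK.
  by lra.
have lip' (x y : 'rV[R]_n) : ball a r x -> ball a r y -> `|f x - f y| <= 2 * `|x - y|.
  move=> ax ay; have := St x y ax ay.
  by have := ler_normD (f x - f y - (x - y)) (x - y); rewrite subrK; have := normr_ge0 (x - y); lra.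
have ex (y : 'rV[R]_n) : ball (f a) (r / 4) y -> exists x, ball a r x /\ f x = y.
  move=> yb; set d := `|y - f a|.
  have dr : d < r / 4 by move: yb; rewrite -ball_normE /= distrC.
  have d0 : 0 <= d by exact: normr_ge0.
  (* Newton iteration with the derivative frozen at the identity. Its steps are at least halved each
     time, so it stays within [2 * d] of [a]; taking [d < r / 4] keeps it inside the ball. *)
  pose u (k : nat) : 'rV[R]_n := iter k (fun x : 'rV[R]_n => x - f x + y) a.
  pose h k : R := (1/2) ^+ k.
  have hS k : h k.+1 = 1/2 * h k by rewrite /h exprS.
  have h01 k : 0 <= h k by rewrite exprn_ge0 //; lra.
  have balla (x : 'rV[R]_n) : `|x - a| <= 2 * d -> ball a r x.
    rewrite -ball_normE /= distrC; lra.
  have P k : `|u k - a| <= 2 * (1 - h k) * d /\ `|u k.+1 - u k| <= h k * d.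
    elim: k => [|k [IH1 IH2]].
      rewrite /h expr0 subrr normr0 /u /= [X in `|X|](_ : _ = y - f a).
        by rewrite -/d; split; lra.
      by apply/rowP => i; rewrite !mxE; ring.
    have hk := h01 k; have hdk := mulr_ge0 hk d0.
    have b1 : ball a r (u k) by apply: balla; nra.
    have u1 : `|u k.+1 - a| <= 2 * (1 - h k.+1) * d.
      rewrite -(subrK (u k) (u k.+1)) -addrA (le_trans (ler_normD _ _)) // hS.
      by nra.
    have b2 : ball a r (u k.+1).
      by apply: balla; have := mulr_ge0 (h01 k.+1) d0; nra.
    split=> //.
    have -> : u k.+2 - u k.+1 = - (f (u k.+1) - f (u k) - (u k.+1 - u k)).
      rewrite [u k.+2]/= -/(u k.+1) [in u k.+1 - f _ + _]/= .
      have -> : u k.+1 = u k - f (u k) + y by [].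
      by apply/rowP => i; rewrite !mxE; ring.
    rewrite normrN (le_trans (St _ _ b2 b1)) // hS; lra.
  have [l [_ lP]] : exists l : 'rV[R]_n, (u : nat -> 'rV[R]_n) @ \oo --> l /\ forall k, `|u k - l| <= d / (1 - 1/2) * h k.
    apply: geo_cvg; [lra|lra|] => k; rewrite mulrC; exact: (P k).2.
  have d2 : d / (1 - 1/2) = 2 * d.
    have -> : 1 - 1/2 = 2^-1 :> R by lra.
    by rewrite invrK mulrC.
  rewrite d2 in lP.
  have bl : ball a r l.
    by apply: balla; have := lP 0%N; rewrite /h expr0 /= distrC; lra.
  exists l; split; [exact: bl|apply: (@norm_sub_eq R 'rV[R]_n)].
  (* [|f l - f (u k)|] is at most 2 times [|l - u k|], hence [4 * d * h k], and the step
     [|u k.+1 - u k|] adds [d * h k]. *)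
  apply: (@le_geo0 R _ (5 * d) (1/2)); [lra|lra|] => k; rewrite -/(h k).
  have bu : ball a r (u k).
    by apply: balla; have := (P k).1; have := mulr_ge0 (h01 k) d0; nra.
  have -> : f l - y = (f l - f (u k)) - (u k.+1 - u k).
    have -> : u k.+1 = u k - f (u k) + y by [].
    by apply/rowP => i; rewrite !mxE; ring.
  rewrite (le_trans (ler_normB _ _)) //.
  have := lip' _ _ bl bu; have := (P k).2; have := lP k; rewrite distrC; lra.
pose g (y : 'rV[R]_n) : 'rV[R]_n := xget a [set x | ball a r x /\ f x = y].
have gP (y : 'rV[R]_n) : ball (f a) (r / 4) y -> ball a r (g y) /\ f (g y) = y.
  by move=> /ex [x xP]; rewrite /g; case: xgetP => [z _ //|/(_ x)].
have r4 : 0 < r / 4 by rewrite divr_gt0.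
have gfx (x : 'rV[R]_n) : ball a r x -> ball (f a) (r / 4) (f x) -> g (f x) = x.
  move=> ax /gP[ag fg]; apply: (@norm_sub_eq R 'rV[R]_n).
  by have := lip _ _ ag ax; rewrite fg subrr normr0 mulr0.
have nfa : \forall y \near f a, ball (f a) (r / 4) y.
  by apply: nbhsx_ballx.
have na : \forall y \near a, ball a r y by apply: nbhsx_ballx.
exists g.
have ga : g (f a) = a by apply: gfx; exact: ballxx.
suff C : Csmooth (ball (f a) (r / 4)) g.
  split=> //.
  - by exists (ball (f a) (r / 4)); split=> //; [exact: ball_open|exact: ballxx].
  - near=> x; apply: gfx; near: x => //.
    exact: (sm_cts sf).
  - by move: nfa; apply: filterS => y /gP[].
pose D (x : 'rV[R]_n) : 'M[R]_n := \matrix_(i < n) 'd f x (delta_mx 0 i).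
have DE (x w : 'rV[R]_n) : w *m D x = 'd f x w.
  rewrite mulmx_sum_row [in RHS](row_sum_delta w) linear_sum.
  by apply: eq_bigr => i _; rewrite rowK linearZ.
have sD (x : 'rV[R]_n) i j : ball a r x -> sm (fun x : 'rV[R]_n => D x i j : R^o) x.
  move=> ax; apply: (@sm_ext _ _ _ (fun x : 'rV[R]_n => ('d f x (delta_mx 0 i)) 0 j : R^o)).
    by move=> z; rewrite mxE.
  by apply: sm_coord; apply: sm_dir; exact: sfr.
(* Invertibility on the whole ball and not just at [a]: if the differential at [x] killed [v], then
   [f] would move a short step along [v] by at most a quarter of its length, against the lower bound
   of one half from [lip]. *)
have uD (x : 'rV[R]_n) : ball a r x -> D x \in unitmx.
  move=> ax; rewrite -row_free_unit -kermx_eq0; apply/eqP/row_matrixP => i.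
  rewrite row0; set v := row i _.
  have v0 : 'd f x v = 0 by rewrite -DE /v -row_mul mulmx_ker row0.
  apply: (@norm_le0_eq R 'rV[R]_n).
  have h4 : 0 < (1/4 : R) by lra.
  have [r3 r30 r3P] := sm_strict (sfr _ ax) h4.
  have [->|vn] := eqVneq v 0; first by rewrite normr0.
  have nv : 0 < `|v| by rewrite normr_gt0.
  have [r4' r4'0 r4P] : exists2 s, 0 < s & forall z, ball x s z -> ball a r z.
    have : \forall z \near x, ball a r z by apply: open_nbhs_nbhs; split => //; exact: ball_open.
    exact: near_ball_ex.
  pose s := Num.min r3 r4' / (2 * `|v|).
  have s0 : 0 < s by rewrite divr_gt0 ?lt_min ?r30 // mulr_gt0.
  have sv : s * `|v| = Num.min r3 r4' / 2.
    by rewrite /s invfM !mulrA divfK ?gt_eqF.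
  have bz : ball x (Num.min r3 r4') (x + s *: v).
    rewrite -ball_normE /= opprD addrA subrr sub0r normrN normrZ gtr0_norm // sv.
    by rewrite ltr_pdivrMr // ltr_pMr ?ltr1n // lt_min r30.
  have b3 : ball x r3 (x + s *: v) by apply: le_ball bz; rewrite ge_min lexx.
  have b4 : ball a r (x + s *: v) by apply: r4P; apply: le_ball bz; rewrite ge_min lexx orbT.
  have := r3P _ _ b3 (ballxx _ r30).
  have := lip _ _ b4 ax.
  have -> : x + s *: v - x = s *: v by rewrite addrC addKr.
  rewrite linearZ /= v0 scaler0 subr0 normrZ gtr0_norm //.
  have := mulr_gt0 s0 nv; lra.
pose G (v x : 'rV[R]_n) := v *m invmx (D x).
have smG (v x : 'rV[R]_n) : ball a r x -> sm (G v) x.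
  move=> ax; apply: sm_mul_invmx; [by move=> i j; exact: sD|exact: sm_cst|exact: uD].
have glip (y y' : 'rV[R]_n) : ball (f a) (r / 4) y -> ball (f a) (r / 4) y' ->
    `|g y - g y'| <= 2 * `|y - y'|.
  by move=> /gP[b1 e1] /gP[b2 e2]; rewrite -{2}e1 -{2}e2; exact: lip.
have Dg (y : 'rV[R]_n) : ball (f a) (r / 4) y -> is_diff y g (fun v => G v (g y)).
  move=> fay; have [agy fgy] := gP _ fay.
  have cL : clin (fun v => G v (g y)).
    by apply: lin_clin => b u v; rewrite /G mulmxDl scalemxAl.
  have [k k0 kP] := clin_bound cL.
  apply: is_diff_intro => // e e0.
  have ek : 0 < e / (2 * k) by rewrite divr_gt0 // mulr_gt0.
  have [r3 r30 r3P] := sm_strict (sfr _ agy) ek.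
  have n1 : \forall h \near (0 : 'rV[R]_n), ball (f a) (r / 4) (h + y).
    have : \forall z \near y, ball (f a) (r / 4) z.
      by apply: open_nbhs_nbhs; split => //; exact: ball_open.
    by rewrite (near_shift 0 y) /=; apply: filterS => h; rewrite /= subr0.
  have n2 : \forall h \near (0 : 'rV[R]_n), ball (0 : 'rV[R]_n) (r3 / 2) h.
    by apply: nbhsx_ballx; rewrite divr_gt0.
  apply: filterS2 n1 n2 => h b1 b2.
  set w := g (h + y) - g y.
  have wh : `|w| <= 2 * `|h|.
    by have := glip _ _ b1 fay; rewrite addrK.
  have b3 : ball (g y) r3 (g (h + y)).
    move: b2; rewrite -!ball_normE /= sub0r normrN distrC -/w; lra.
  have := r3P _ _ b3 (ballxx _ r30).
  rewrite (gP _ b1).2 fgy addrK -/w => H.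
  have -> : w - G h (g y) = - G (h - 'd f (g y) w) (g y).
    by rewrite /G mulmxBl opprB -DE mulmxK //; exact: uD.
  rewrite normrN (le_trans (kP _)) // -ler_pdivlMl // (le_trans H) //.
  apply: (@le_trans _ _ (e / (2 * k) * (2 * `|h|))).
    by rewrite ler_wpM2l // ltW.
  have kn : k != 0 by rewrite gt_eqF.
  have -> // : e / (2 * k) * (2 * `|h|) = k^-1 * (e * `|h|) by field.
have oW : open (ball (f a) (r / 4)) by exact: ball_open.
(* The derivative of [g] is a smooth function of [g] itself, so class C^k of [g] gives class
   C^(k+1). *)
elim=> [|k IH].
  by move=> y yW; apply: differentiable_continuous; have /@ex_diff := Dg _ yW.
split=> [y yW|v]; first by have /@ex_diff := Dg _ yW.
apply: (@Ck_eq _ _ _ _ _ (fun y => G v (g y)) _ oW).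
  by move=> y yW; have /@diff_val -> := Dg _ yW.
apply: (@Ck_comp _ _ _ _ _ k _ (ball a r)) IH _ => //; first exact: ball_open.
  by move=> _ [y /gP[b _] <-].
by apply: sm_Csmooth; exact: smG.
Unshelve. all: by end_near. Qed.

End InverseFunction.

(** * Koenigs linearization *)

Section Koenigs.
Variable R : realType.
Implicit Types E : normedModType R.

Lemma pair_norm_lt E E' (x : E) (y : E') (r : R) :
  `|x| < r -> `|y| < r -> `|(x, y) : (E * E')%type| < r.
Proof. by move=> xr yr; rewrite prod_normE /= gt_max xr yr. Qed.

Lemma norm_snd_le E E' (p : E * E') : `|p.2| <= `|p|.
Proof. by rewrite prod_normE /= le_max lexx orbT. Qed.

Lemma subr_shift (V : zmodType) (dx dy hx hy : V) :
  hx - hy = (dx + hx) - (dy + hy) - dx + dy.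
Proof.
have -> : (dx + hx) - (dy + hy) = (hx - hy) + (dx - dy) by rewrite opprD addrACA addrC.
by rewrite -(addrA _ (- dx) dy) [- dx + dy]addrC -(opprB dx) addrK.
Qed.

Lemma subr_telescope (V : zmodType) (p s p' s' a b : V) :
  p - s - b = ((p - p') - (s - s')) + (p' - s' - a) + (a - b).
Proof.
have -> : (p - p') - (s - s') = (p - s) - (p' - s').
  by rewrite !opprB [LHS]addrACA [RHS]addrACA [- p' - s]addrC.
by rewrite (addrA _ (p' - s') (- a)) subrK (addrA _ a) subrK.
Qed.

Lemma ball0P E (x : E) r : ball (0 : E) r x <-> `|x| < r.
Proof. by rewrite -ball_normE /= sub0r normrN. Qed.

(** The example in view is the square root of a Lie group, read in a chart centred at the
    identity. *)
Definition halving E (F : E -> E) : Prop :=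
  [/\ sm F 0, F 0 = 0 & forall w, 'd F 0 w = (1/2 : R) *: w].

Definition kseq E (F : E -> E) (n : nat) (v : E) : E := (2 ^+ n : R) *: iter n F v.

Definition kL E (F : E -> E) (v : E) : E :=
  xget 0 [set l | (fun n => kseq F n v) @ \oo --> l].

Lemma kLE E (F : E -> E) v l : (fun n => kseq F n v) @ \oo --> l -> kL F v = l.
Proof.
move=> vl; rewrite /kL; case: xgetP => [z _ zl|/(_ l)//].
exact: (@cvg_unique _ (@norm_hausdorff R E) _ _ _ _ zl vl).
Qed.

Lemma geo_small (C q e : R) : 0 <= q -> q < 1 -> 0 < e -> exists n, C * q ^+ n <= e.
Proof.
move=> q0 q1 e0; apply: contrapT => /forallNP H.
suff : e <= 0 by rewrite leNgt e0.
apply: (@le_geo0 R e C q) => // n.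
by have /negP := H n; rewrite -ltNge => /ltW.
Qed.

(** Close to 0 the map contracts by 3/5 instead of 1/2. The quadratic error at step n is multiplied
    by 2^(n+1), so the increments decay like (2 (3/5)^2)^n = (18/25)^n. Any contraction rate above
    1/2 whose square is below 1/2 would serve. *)
Lemma halving_iter E {fE : findim E} (F : E -> E) : halving F ->
  exists r C, [/\ 0 < r, 0 <= C & forall v, `|v| < r ->
    sm F v /\ forall n, `|iter n F v| <= (3/5) ^+ n * `|v| /\
       `|kseq F n.+1 v - kseq F n v| <= C * (18/25) ^+ n].
Proof.
move=> [sF F0 dF]; have [C [C0 CP]] := sm_quad sF.
have [r1 r10 r1P] := near_ball_ex (filterI CP (sm_near sF)).
(* This makes the quadratic term at most [1/10 * |v|], and 1/2 + 1/10 = 3/5. *)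
pose r := Num.min r1 (1 / (10 * C)).
have r0 : 0 < r by rewrite lt_min r10 divr_gt0 // mulr_gt0.
have r1r : r <= r1 by rewrite ge_min lexx.
have rC : r <= 1 / (10 * C) by rewrite ge_min lexx orbT.
have rC' : 10 * C * r <= 1 by rewrite mulrC -ler_pdivlMr ?mulr_gt0.
have Q v : `|v| < r -> sm F v /\ `|F v - (1/2 : R) *: v| <= C * `|v| ^+ 2.
  move=> vr; have [] := r1P v.
    by rewrite -ball_normE /= sub0r normrN (lt_le_trans vr).
  by rewrite !subr0 F0 subr0 dF.
exists r, (2 * C * r ^+ 2); split=> //.
  by rewrite !mulr_ge0 // ?sqr_ge0 // ltW.
move=> v vr; split; first exact: (Q v vr).1.
have half u : `|u| < r -> `|F u| <= 3/5 * `|u|.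
  move=> ur; have [_ h] := Q u ur.
  rewrite -(subrK ((1/2 : R) *: u) (F u)) (le_trans (ler_normD _ _)) //.
  rewrite normrZ gtr0_norm; last by lra.
  have u0 := normr_ge0 u.
  have : C * `|u| ^+ 2 <= 1/10 * `|u|.
    rewrite expr2 mulrA ler_wpM2r //.
    have : C * `|u| <= C * r by rewrite ler_wpM2l // ltW.
    by lra.
  by move: h; lra.
have p01 (n : nat) : 0 <= (3/5 : R) ^+ n by rewrite exprn_ge0 //; lra.
have p1 (n : nat) : (3/5 : R) ^+ n <= 1 by rewrite exprn_ile1 //; lra.
have it n : `|iter n F v| <= (3/5) ^+ n * `|v|.
  elim: n => [|n IH]; first by rewrite expr0 mul1r.
  rewrite iterS exprS.
  have ir : `|iter n F v| < r.
    by rewrite (le_lt_trans IH) // (le_lt_trans _ vr) // ler_piMl.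
  by rewrite (le_trans (half _ ir)) // -(mulrA (3/5)) ler_wpM2l //; lra.
move=> n; split; first exact: it.
have ir : `|iter n F v| < r.
  by rewrite (le_lt_trans (it n)) // (le_lt_trans _ vr) // ler_piMl.
have -> : kseq F n.+1 v - kseq F n v =
    (2 ^+ n.+1 : R) *: (F (iter n F v) - (1/2 : R) *: iter n F v).
  rewrite /kseq iterS scalerBr scalerA.
  by have -> : (2 ^+ n.+1 * (1/2) : R) = 2 ^+ n by rewrite exprS; field.
rewrite normrZ ger0_norm; last by rewrite exprn_ge0.
have [_ h] := Q _ ir.
rewrite (le_trans (ler_wpM2l _ h)) ?exprn_ge0 //.
have h2 : `|iter n F v| ^+ 2 <= ((3/5) ^+ n * `|v|) ^+ 2.
  by rewrite lerXn2r ?nnegrE ?mulr_ge0.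
have h3 : `|iter n F v| ^+ 2 <= ((3/5) ^+ n * r) ^+ 2.
  apply: (le_trans h2); rewrite lerXn2r ?nnegrE ?mulr_ge0 ?(ltW r0) //.
  by rewrite ler_wpM2l // ltW.
have h4 := ler_wpM2l (exprn_ge0 n.+1 (ler0n R 2)) (ler_wpM2l (ltW C0) h3).
apply: (le_trans h4).
suff -> : (18/25 : R) ^+ n = 2 ^+ n * ((3/5) ^+ n) ^+ 2.
  by rewrite exprS le_eqVlt; apply/orP; left; apply/eqP; ring.
by rewrite -exprM mulnC exprM -exprMn; congr (_ ^+ n); field.
Qed.

Let q01 : 0 <= (18/25 : R). Proof. lra. Qed.
Let q11 : (18/25 : R) < 1. Proof. lra. Qed.

Lemma kL_cvg E {fE : findim E} (F : E -> E) : halving F ->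
  exists r C, [/\ 0 < r, 0 <= C & forall v, `|v| < r ->
    (fun n => kseq F n v) @ \oo --> kL F v /\
    forall n, `|kseq F n v - kL F v| <= C * (18/25) ^+ n].
Proof.
move=> /halving_iter [r [C [r0 C0 H]]]; exists r, (C / (1 - 18/25)); split=> //.
  by rewrite divr_ge0 //; lra.
move=> v /H [_ vP].
have [l [lv lP]] := geo_cvg q01 q11 (fun n => (vP n).2).
by rewrite (kLE lv).
Qed.

Definition tmap E (F : E -> E) (p : E * E) : E * E := (F p.1, 'd F (p.1) (p.2)).

(** For the second component ['d F v w], the partial derivative in [v] vanishes at the origin
    because the map is zero along [w = 0], and the partial derivative in [w] is ['d F 0], which is
    half the identity. *)
Lemma halving_tmap E {fE : findim E} (F : E -> E) : halving F -> halving (tmap F).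
Proof.
move=> [sF F0 dF].
have sT : sm (fun p : E * E => 'd F (p.1) (p.2)) (0, 0) by exact: sm_tangent.
have s1 : sm (fun p : E * E => F p.1) (0, 0).
  by apply: (@sm_comp _ _ _ _ _ (fst : E * E -> E) F) => //; exact: sm_fst (sm_id _).
split; first exact: sm_pair s1 sT.
  by rewrite /tmap /= F0 linear0.
move=> [v w]; rewrite /tmap diff_pairE; [|exact: sm_diff s1|exact: sm_diff sT].
have c1 := @clin_fst R E E.
rewrite (@sm_diff_comp _ _ _ _ (fst : E * E -> E) F); last 2 first.
- exact: sm_diff (sm_lin _ c1).
- exact: sm_diff.
rewrite (diff_clin _ c1) /= dF; congr pair.
have -> : (v, w) = (v, 0) + (0, w) :> E * E by congr pair; rewrite /= ?addr0 ?add0r.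
rewrite linearD /= .
have ci1 := clin_pair (@clin_id _ E) (@clin_cst0 _ E E).
have ci2 := clin_pair (@clin_cst0 _ E E) (@clin_id _ E).
have dT := sm_diff sT.
have E0 : (fun z : E => 'd F z 0) = (fun _ => 0).
  by apply/funext => z; rewrite linear0.
have E1 := @sm_diff_comp _ E _ _ (fun v : E => (v, 0)) (fun p : E * E => 'd F (p.1) (p.2)) 0 v
  (sm_diff (sm_lin _ ci1)) dT.
rewrite (diff_clin _ ci1) /= E0 diff_cstE in E1.
have E2 := @sm_diff_comp _ E _ _ (fun v : E => (0, v)) (fun p : E * E => 'd F (p.1) (p.2)) 0 w
    (sm_diff (sm_lin _ ci2)) dT.
rewrite (diff_clin _ ci2) /= (diff_clin _ (clin_diff (sm_diff sF))) dF in E2.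
by rewrite -E1 -E2 !add0r.
Qed.

Lemma iter_tmap E {fE : findim E} (F : E -> E) v w n :
  (forall m, sm F (iter m F v)) ->
  sm (iter n F) v /\ iter n (tmap F) (v, w) = (iter n F v, 'd (iter n F) v w).
Proof.
move=> sF; elim: n => [|n [s1 IH]].
  by split; [exact: sm_id|rewrite /= (@diff_idE _ E)].
have E1 : iter n.+1 F = (fun x => F (iter n F x)) by apply/funext.
split; first by rewrite E1; apply: sm_comp.
have E2 := @sm_diff_comp _ E E E (iter n F) F v w (sm_diff s1) (sm_diff (sF n)).
rewrite iterS IH E1 E2; reflexivity.
Qed.

(* The tangent map of the linearization of [F] is the linearization of the
   tangent map of [F]; smoothness follows by induction on the order. *)
Lemma kL_diff E {fE : findim E} (F : E -> E) : halving F ->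
  exists2 r, 0 < r & forall v, `|v| < r ->
    differentiable (kL F) v /\ forall w, kL (tmap F) (v, w) = (kL F v, 'd (kL F) v w).
Proof.
move=> hF; have hT : halving (tmap F) by exact: halving_tmap.
have [r1 [C1 [r10 C10 P1]]] := halving_iter hF.
have [r2 [C2 [r20 C20 P2]]] := halving_iter hT.
have [r3 [C3 [r30 C30 P3]]] := kL_cvg hF.
have [K K0 KP] := @mean_value R E E fE.
pose r := Num.min r1 (Num.min r2 r3).
have r0 : 0 < r by rewrite !lt_min r10 r20 r30.
have rr1 : r <= r1 by rewrite ge_min lexx.
have rr2 : r <= r2 by rewrite ge_min ge_min lexx orbT.
have rr3 : r <= r3 by rewrite ge_min ge_min lexx !orbT.
pose a (n : nat) (v w : E) : E := (2 ^+ n : R) *: 'd (iter n F) v w.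
pose q : R := 18/25.
have qn (n : nat) : 0 <= q ^+ n by rewrite exprn_ge0.
have sit (v : E) : `|v| < r -> forall m, sm F (iter m F v).
  move=> vr m; apply: (P1 _ _).1.
  have [_ /(_ m)[h _]] := P1 v (lt_le_trans vr rr1).
  rewrite (le_lt_trans h) // (le_lt_trans _ (lt_le_trans vr rr1)) //.
  by rewrite ler_piMl // exprn_ile1 //; lra.
have kT (v w : E) n : `|v| < r -> kseq (tmap F) n (v, w) = (kseq F n v, a n v w).
  by move=> vr; rewrite /kseq (iter_tmap w n (sit v vr)).2.
pose M := 2 * C2 / r.
have M0 : 0 <= M by rewrite divr_ge0 ?(ltW r0) // mulr_ge0.
(* The estimate for the tangent map holds for short [w] only; it extends to all [w] by homogeneity,
   after scaling [w] to length [r / 2]. *)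
have aM (v w : E) : `|v| < r -> forall n, `|a n.+1 v w - a n v w| <= M * `|w| * q ^+ n.
  move=> vr n; have [->|wn] := eqVneq w 0.
    have a0 k : a k v 0 = 0 by rewrite /a (linear0 ('d (iter k F) v)) scaler0.
    by rewrite !a0 subrr normr0 mulr0 mul0r.
  have w0 : 0 < `|w| by rewrite normr_gt0.
  pose s := r / (2 * `|w|).
  have s0 : 0 < s by rewrite divr_gt0 // mulr_gt0.
  have sw : `|s *: w| < r.
    rewrite normrZ gtr0_norm // /s invfM mulrA divfK ?gt_eqF // ltr_pdivrMr //.
    by rewrite ltr_pMr // ltr1n.
  have vs := pair_norm_lt (lt_le_trans vr rr2) (lt_le_trans sw rr2).
  have [_ /(_ n) [_ h]] := P2 _ vs.
  rewrite !kT // in h.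
  have h2 : `|a n.+1 v (s *: w) - a n v (s *: w)| <= C2 * q ^+ n.
    by apply: le_trans h; exact: (norm_snd_le (_, _)).
  have aZ k : a k v (s *: w) = s *: a k v w.
    by rewrite /a linearZ /= !scalerA mulrC.
  move: h2; rewrite !aZ -scalerBr normrZ gtr0_norm // -ler_pdivlMl // => h3.
  apply: (le_trans h3).
  have -> // : s^-1 * (C2 * q ^+ n) = M * `|w| * q ^+ n.
  by rewrite /s /M; field; rewrite !gt_eqF.
pose B := M / (1 - q).
have B0 : 0 <= B by rewrite divr_ge0 // /q; lra.
have /choice [A AP] : forall p : E * E, exists l : E, `|p.1| < r ->
    (fun n => a n p.1 p.2) @ \oo --> l /\ forall n, `|a n p.1 p.2 - l| <= B * `|p.2| * q ^+ n.
  move=> [v w] /=; case: (ltP `|v| r) => vr; last by exists 0.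
  have [l [lv lP]] := geo_cvg q01 q11 (aM v w vr); exists l => _; split=> // n.
  by rewrite /B [M / _ * _]mulrAC; exact: lP.
have clA (y : E) : `|y| < r -> clin (fun w => A (y, w)).
  move=> yr; apply: lin_clin => b u w.
  apply: (@norm_sub_eq R E).
  apply: (@le_geo0 R _ (B * `|b *: u + w| + `|b| * (B * `|u|) + B * `|w|) q) => // n.
  have aL : a n y (b *: u + w) = b *: a n y u + a n y w.
    by rewrite /a linearP scalerDr !scalerA mulrC.
  have -> : A (y, b *: u + w) - (b *: A (y, u) + A (y, w)) =
      - (a n y (b *: u + w) - A (y, b *: u + w)) + b *: (a n y u - A (y, u)) +
      (a n y w - A (y, w)).
    by rewrite aL opprB scalerBr -[RHS]addrA [X in _ = _ + X]addrACA -[X in _ = _ + (_ + X)]opprD [RHS]addrA subrK.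
  rewrite !mulrDl (le_trans (ler_normD _ _)) // lerD //; last exact: (AP (y, w) yr).2.
  rewrite (le_trans (ler_normD _ _)) // lerD //.
    by rewrite normrN; exact: (AP (y, b *: u + w) yr).2.
  by rewrite normrZ -(mulrA `|b|) ler_wpM2l //; exact: (AP (y, u) yr).2.
have ski n (v : E) : `|v| < r -> sm (kseq F n) v.
  move=> vr; apply: (sm_clin (@clin_scaler _ E (2 ^+ n))).
  exact: (iter_tmap 0 n (sit v vr)).1.
have dki n (v w : E) : `|v| < r -> 'd (kseq F n) v w = a n v w.
  move=> vr; have d : differentiable (iter n F) v.
    exact: sm_diff (iter_tmap 0 n (sit v vr)).1.
  exact: (diff_clin_comp w d (@clin_scaler _ E (2 ^+ n))).
(* A Lipschitz bound on the remainder [kL F - kseq F n] that tends to 0 with [n]: the mean value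
   estimate for [kseq F m - kseq F n], in the limit of large [m]. It plays the part of uniform
   convergence of the derivatives. *)
have U n (x y : E) : `|x| < r -> `|y| < r ->
    `|(kL F x - kseq F n x) - (kL F y - kseq F n y)| <= K * B * q ^+ n * `|x - y|.
  move=> xr yr; rewrite -subr_le0.
  apply: (@le_geo0 R _ (K * B * `|x - y| + 2 * C3) q) => // m.
  have dg (z : E) : ball (0 : E) r z -> differentiable (fun z => kseq F m z - kseq F n z) z /\
      forall w, `|'d (fun z => kseq F m z - kseq F n z) z w| <= (B * q ^+ m + B * q ^+ n) * `|w|.
    move=> /ball0P zr; split.
      by apply: sm_diff; apply: sm_sub; exact: ski.
    move=> w; rewrite (@diff_addE _ _ _ (kseq F m) (fun z => - kseq F n z)); last 2 first.
    - exact: sm_diff (ski _ _ zr).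
    - exact: sm_diff (sm_opp (ski _ _ zr)).
    have -> : (fun z => - kseq F n z) = (fun z => (-1) *: kseq F n z).
      by apply/funext => ?; rewrite scaleN1r.
    rewrite (diff_clin_comp (L := fun x => (-1) *: x)); last 2 first.
    - exact: sm_diff (ski _ _ zr).
    - exact: clin_scaler.
    rewrite scaleN1r !dki //.
    have := (AP (z, w) zr).2 m; have := (AP (z, w) zr).2 n => /= h1 h2.
    rewrite -(subrK (A (z, w)) (a m z w)) -addrA (le_trans (ler_normD _ _)) //.
    by rewrite mulrDl [B * q ^+ m * _]mulrAC [B * q ^+ n * _]mulrAC lerD // distrC.
  have bx := (ball0P x r).2 xr.
  have by_ := (ball0P y r).2 yr.
  have := KP _ 0 r _ dg x y bx by_.
  have [_ /(_ m) hx] := P3 x (lt_le_trans xr rr3).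
  have [_ /(_ m) hy] := P3 y (lt_le_trans yr rr3).
  set G := _ - _ - _ => hG; set H := _ - _ - _.
  have -> : H = G - (kseq F m x - kL F x) + (kseq F m y - kL F y).
    rewrite /H /G; set dx := kseq F m x - kL F x; set dy := kseq F m y - kL F y.
    rewrite -(subrK (kL F x) (kseq F m x)) -(subrK (kL F y) (kseq F m y)) -/dx -/dy.
    by rewrite -(addrA dx) -(addrA dy); exact: subr_shift.
  have := ler_normD (G - (kseq F m x - kL F x)) (kseq F m y - kL F y).
  have := ler_normB G (kseq F m x - kL F x).
  move: hx hy hG; rewrite -/q.
  set n1 := `|_|; set n2 := `|_|; set n3 := `|_|; set n4 := `|_|; set n5 := `|_|; set n6 := `|_|.
  lra.
exists r => // y yr.
have D : is_diff y (kL F) (fun w => A (y, w)).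
  apply: is_diff_intro; first exact: clA.
  move=> e e0; have e2 : 0 < e / 2 by rewrite divr_gt0.
  (* One half of [e] pays for replacing [kL F] by [kseq F n] (the term [K * B]) and [A] by the
     differential of [kseq F n] (the term [B]); the other half pays for the strict differentiability
     of [kseq F n]. *)
  have [n nP] := @geo_small (K * B + B) q (e / 2) q01 q11 e2.
  have [r4 r40 r4P] := sm_strict (ski n y yr) e2.
  have n1 : \forall h \near (0 : E), `|h + y| < r.
    have : \forall z \near y, `|z| < r.
      have : \forall z \near y, ball (0 : E) r z.
        by apply: open_nbhs_nbhs; split; [exact: ball_open|apply/ball0P].
      by apply: filterS => z /ball0P.
    by rewrite (near_shift 0 y) /=; apply: filterS => h; rewrite /= subr0.
  have n2 : \forall h \near (0 : E), ball (0 : E) r4 h by apply: nbhsx_ballx.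
  apply: filterS2 n1 n2 => h hr h4.
  have b4 : ball y r4 (h + y).
    by move: h4; rewrite -!ball_normE /= opprD addrCA subrr addr0 sub0r.
  have h1 := r4P _ _ b4 (ballxx _ r40).
  have h2 := U n _ _ hr yr.
  have h3 := (AP (y, h) yr).2 n.
  rewrite addrK dki // in h1; rewrite addrK in h2.
  have -> : kL F (h + y) - kL F y - A (y, h) =
     ((kL F (h + y) - kseq F n (h + y)) - (kL F y - kseq F n y)) +
     (kseq F n (h + y) - kseq F n y - a n y h) + (a n y h - A (y, h)).
    exact: subr_telescope.
  rewrite (le_trans (ler_normD _ _)) //.
  have := ler_normD ((kL F (h + y) - kseq F n (h + y)) - (kL F y - kseq F n y)) (kseq F n (h + y) - kseq F n y - a n y h).
  have : (K * B + B) * q ^+ n * `|h| <= e / 2 * `|h| by rewrite ler_wpM2r.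
  move: h1 h2 h3 => /=; lra.
split=> [|w]; first by have /@ex_diff := D.
have -> : 'd (kL F) y w = A (y, w) by have /@diff_val -> := D.
apply: kLE; under eq_fun do rewrite kT //.
apply: cvg_pair => /=; last exact: (AP (y, w) yr).1.
exact: (P3 y (lt_le_trans yr rr3)).1.
Qed.

End Koenigs.

Section KoenigsSmooth.
Variable R : realType.
Implicit Types E : normedModType R.

Lemma scale_small E (w : E) (r : R) : 0 < r -> exists2 s : R, 0 < s & `|s *: w| < r.
Proof.
move=> r0; exists (r / (`|w| + 1)); first by rewrite divr_gt0 // ltr_wpDl.
have w1 : 0 < `|w| + 1 by rewrite ltr_wpDl.
rewrite normrZ gtr0_norm ?divr_gt0 // mulrAC ltr_pdivrMr // ltr_pM2l //.
by rewrite ltrDl.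
Qed.

(** The statement ranges over all spaces, because the derivative of [kL F] is a component of the
    linearization of [tmap F] on [E * E]. The radius found this way depends on [k]. *)
Lemma kL_Ck (k : nat) E {fE : findim E} (F : E -> E) : halving F ->
  exists2 r, 0 < r & Ck k (ball (0 : E) r) (kL F).
Proof.
elim: k E fE F => [|k IH] E fE F hF.
  have [r r0 rP] := kL_diff hF; exists r => // v /ball0P /rP [d _].
  exact: differentiable_continuous.
have [r1 r10 r1P] := kL_diff hF.
have hT : halving (tmap F) by exact: halving_tmap.
have [r2 r20 r2P] := IH _ _ _ hT.
pose r := Num.min r1 r2.
have r0 : 0 < r by rewrite lt_min r10.
have rr1 : r <= r1 by rewrite ge_min lexx.
have rr2 : r <= r2 by rewrite ge_min lexx orbT.
exists r => //; split=> [v /ball0P vr|w].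
  by have [] := r1P v (lt_le_trans vr rr1).
(* The induction hypothesis covers only the ball of radius [r2] of [E * E], so the direction [w] is
   shrunk into it and restored by linearity. *)
have [s s0 sw] := scale_small w r20.
have ob : open (ball (0 : E) r) by exact: ball_open.
have ob2 : open (ball (0 : E * E) r2) by exact: ball_open.
apply: (@Ck_eq _ _ _ _ _ (fun v => s^-1 *: (kL (tmap F) (v, s *: w)).2) _ ob).
  move=> v /ball0P vr; have [dv ->] := r1P v (lt_le_trans vr rr1).
  by rewrite /= linearZ /= scalerA mulVf ?gt_eqF // scale1r.
have c2 : clin (fun p : E * E => s^-1 *: p.2).
  exact: (clin_comp (@clin_snd _ _ _) (@clin_scaler _ _ _)).
apply: (Ck_clin ob c2).
apply: (@Ck_comp _ E (E * E)%type (E * E)%type _ k _ _ (fun v : E => (v, s *: w)) _ ob ob2 _ _ r2P).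
  move=> _ [v /ball0P vr <-]; apply/ball0P; apply: pair_norm_lt => //.
  exact: lt_le_trans rr2.
apply: (_ : Csmooth _ _); apply: sm_Csmooth => v _.
exact: sm_pair (sm_id _) (sm_cst _ _).
Qed.

(** One ball has to serve all orders, although [kL_Ck] gives a radius for each. The functional
    equation L = 2^N L o F^N does it: a high iterate of [F] carries the fixed ball into the one
    where class C^k is known. *)
Lemma koenigs E {fE : findim E} (F : E -> E) : halving F ->
  exists L : E -> E, [/\ sm L 0, L 0 = 0, (forall w, 'd L 0 w = w) &
    \forall v \near (0 : E), (fun n => (2 ^+ n : R) *: iter n F v) @ \oo --> L v].
Proof.
move=> hF; have [sF F0 dF] := hF.
have [r1 [C1 [r10 C10 P1]]] := halving_iter hF.
have [r2 [C2 [r20 C20 P2]]] := kL_cvg hF.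
have [r3 r30 P3] := kL_diff hF.
pose r := Num.min r1 r2.
have r0 : 0 < r by rewrite lt_min r10.
have rr1 : r <= r1 by rewrite ge_min lexx.
have rr2 : r <= r2 by rewrite ge_min lexx orbT.
have itr v n : `|v| < r1 -> `|iter n F v| < r1.
  move=> vr; have [_ /(_ n)[h _]] := P1 v vr.
  rewrite (le_lt_trans h) // (le_lt_trans _ vr) // ler_piMl // exprn_ile1 //; lra.
have it0 n : iter n F 0 = 0 by elim: n => //= n ->.
have L0 : kL F 0 = 0.
  apply: kLE; rewrite (_ : (fun _ => _) = (fun _ => 0)); first exact: cvg_cst.
  by apply/funext => n; rewrite /kseq it0 scaler0.
have db (v : E) : `|v| < r -> nbhs v (ball (0 : E) r).
  by move=> vr; apply: open_nbhs_nbhs; split; [exact: ball_open|apply/ball0P].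
exists (kL F); split=> //.
- exists (ball (0 : E) r); split; [exact: ball_open|exact: ballxx|].
  move=> k; apply/Ck_pt => v /ball0P vr.
  have [r4 r40 P4] := kL_Ck k hF.
  have [N NP] : exists N, r * (3/5) ^+ N <= r4 / 2.
    by apply: geo_small; [lra|lra|rewrite divr_gt0].
  have sit m : sm F (iter m F v).
    exact: (P1 _ (itr v m (lt_le_trans vr rr1))).1.
  have sN : sm (iter N F) v by exact: (iter_tmap 0 N sit).1.
  have iN : `|iter N F v| < r4.
    have [_ /(_ N)[h _]] := P1 v (lt_le_trans vr rr1).
    apply: (le_lt_trans h).
    have p0 : 0 <= (3/5 : R) ^+ N by rewrite exprn_ge0 //; lra.
    have := ler_wpM2l p0 (ltW vr); rewrite [_ * r]mulrC.
    by move: NP r40; lra.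
  have [U [oU Uv cU]] := sN.
  have /near_open [W [oW Wv WP]] :
      \forall u \near v, U u /\ ball (0 : E) r4 (iter N F u) /\ ball (0 : E) r u.
    apply: filterI; first exact: open_nbhs_nbhs.
    apply: filterI; last exact: db.
    apply: (sm_cts sN); apply: open_nbhs_nbhs; split; first exact: ball_open.
    exact/ball0P.
  apply: (@Ck_sub _ _ _ k W); first by move=> _ ->.
  apply: (@Ck_eq _ _ _ _ _ (fun u => (2 ^+ N : R) *: kL F (iter N F u)) _ oW).
    move=> u /WP [_ [_ /ball0P ur]].
    have [c _] := P2 u (lt_le_trans ur rr2).
    rewrite (kLE (v := iter N F u) (l := (2 ^+ N : R)^-1 *: kL F u)).
      by rewrite scalerA divff ?scale1r // expf_neq0 // pnatr_eq0.
    have cN : (fun n => kseq F (n + N)%N u) @ \oo --> kL F u.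
      by rewrite (cvg_shiftn N (fun n => kseq F n u)).
    rewrite (_ : (fun _ => _) = fun n => (2 ^+ N : R)^-1 *: kseq F (n + N)%N u).
      exact: (clin_cvg (@clin_scaler _ _ _) cN).
    apply/funext => n; rewrite /kseq scalerA iterD exprD mulrCA.
    by rewrite mulVf ?mulr1 // expf_neq0 // pnatr_eq0.
  have ob4 : open (ball (0 : E) r4) by exact: ball_open.
  apply: (Ck_clin oW (@clin_scaler _ _ _)).
  apply: (@Ck_comp _ E E E _ k _ _ (iter N F) _ oW ob4 _ _ P4).
    by move=> _ [u /WP [_ [h _]] <-].
  by apply: Ck_sub (cU k) => u /WP [].
- move=> w; have z3 : `|0 : E| < r3 by rewrite normr0.
  have [d0 Lw] := P3 0 z3.
  have sit m : sm F (iter m F 0) by rewrite it0.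
  have hT : halving (tmap F) by exact: halving_tmap.
  have [r5 [C5 [r50 _ P5]]] := kL_cvg hT.
  (* Above the fixed point 0 the tangent map is exactly multiplication by 1/2, so the rescaled
     sequence that computes the derivative of the linearization is constant. *)
  have itw n : iter n (tmap F) (0, w) = (0, ((1/2 : R) ^+ n) *: w).
    elim: n => [|n IHn]; first by rewrite expr0 scale1r.
    rewrite iterS IHn /tmap /= F0 dF scalerA -exprS //.
  have := Lw w; rewrite (kLE (l := (0, w))); first by case.
  rewrite (_ : (fun _ => _) = (fun _ => (0, w))); first exact: cvg_cst.
  apply/funext => n; rewrite /kseq itw; congr pair; first exact: scaler0.
  rewrite /= scalerA -exprMn.
  have -> : 2 * (1/2) = 1 :> R by field.
  by rewrite expr1n scale1r.
- apply: filterS (db 0 _); last by rewrite normr0.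
  by move=> v /ball0P vr; exact: (P2 v (lt_le_trans vr rr2)).1.
Qed.

End KoenigsSmooth.

(** * Smooth germs on manifolds *)

Section ManifoldGerms.
Variable R : realType.

Section OneChart.
Variables (E : normedModType R) (M : smoothSpaceType E).

(** Membership in the maximal atlas: the charts adapted to a submanifold are only known to be
    compatible with the given atlas. *)
Definition compat (c : chart E M) : Prop :=
  forall a, atlas a -> transition_smooth c a /\ transition_smooth a c.

Lemma atlas_compat (c : chart E M) : atlas c -> compat c.
Proof. by move=> ac a aa; split; exact: atlas_smooth. Qed.

Lemma chart_at_compat (p : M) : compat (chart_at p).
Proof. exact/atlas_compat/chart_at_atlas. Qed.

Lemma near_cdom (c : chart E M) p : cdom c p -> \forall q \near p, cdom c q.
Proof. by move=> cp; apply: open_nbhs_nbhs; split => //; exact: cdom_open. Qed.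

Lemma near_cinv (c : chart E M) p (P : M -> Prop) : cdom c p ->
  (\forall q \near p, P q) -> \forall v \near cmap c p, P (cinv c v).
Proof.
move=> cp nP; have vr : (cmap c @` cdom c) (cmap c p) by exists p.
have := cinv_cts vr; rewrite /prop_for /continuous_at cmapK //.
by move=> h; exact: (h P nP).
Qed.

Lemma near_cmap (c : chart E M) p (P : E -> Prop) : cdom c p ->
  (\forall v \near cmap c p, P v) -> \forall q \near p, P (cmap c q).
Proof. by move=> cp nP; have h := cmap_cts cp; exact: (h P nP). Qed.

Lemma cinvK_near (c : chart E M) p : cdom c p ->
  \forall v \near cmap c p, cmap c (cinv c v) = v /\ cdom c (cinv c v).
Proof.
move=> cp; have : nbhs (cmap c p) (cmap c @` cdom c).
  by apply: open_nbhs_nbhs; split; [exact: crange_open|exists p].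
by apply: filterS => _ [q cq <-]; rewrite cmapK.
Qed.

Lemma trans_atlas_sm (c c' : chart E M) p : transition_smooth c c' ->
  cdom c p -> cdom c' p -> sm (cmap c' \o cinv c) (cmap c p).
Proof.
move=> cc' cp c'p; exists (cmap c @` (cdom c `&` cdom c')); split=> //.
  by apply: chart_image_open; exact: cdom_open.
by exists p.
Qed.

Lemma trans_sm {fE : findim E} (c c' : chart E M) p : compat c -> compat c' ->
  cdom c p -> cdom c' p -> sm (cmap c' \o cinv c) (cmap c p).
Proof.
move=> kc kc' cp c'p; pose a := chart_at p.
have ap : cdom a p by exact: chart_at_dom.
have s1 := trans_atlas_sm (kc a (chart_at_atlas p)).1 cp ap.
have s2 := trans_atlas_sm (kc' a (chart_at_atlas p)).2 ap c'p.
apply: (@sm_eq _ _ _ (fun v => (cmap c' \o cinv a) ((cmap a \o cinv c) v))).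
  have := near_cinv cp (near_cdom ap).
  by apply: filterS => v av; rewrite /= cmapK.
by apply: (sm_comp s1); rewrite /= cmapK.
Qed.

End OneChart.

Section Msm.
Variables (E F : normedModType R) (M : smoothSpaceType E) (N : smoothSpaceType F).

(** The representative is taken in the same charts as in [mderiv]. Continuity is required
    separately: [cmap] is arbitrary outside its domain, so the representative alone does not keep
    [f] near [f p]. *)
Definition msm (f : M -> N) (p : M) : Prop :=
  {for p, continuous f} /\
  sm (cmap (chart_at (f p)) \o f \o cinv (chart_at p)) (cmap (chart_at p) p).

Lemma msm_cts (f : M -> N) p : msm f p -> {for p, continuous f}.
Proof. by case. Qed.

Lemma near_comp (f : M -> N) p (P : N -> Prop) : {for p, continuous f} ->
  (\forall q \near f p, P q) -> \forall q \near p, P (f q).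
Proof. by move=> cf nP; exact: (cf P nP). Qed.

Lemma sm_recharts {fE : findim E} {fF : findim F} (f : M -> N) p
    (c a : chart E M) (c' a' : chart F N) :
  compat c -> compat a -> compat c' -> compat a' ->
  cdom c p -> cdom a p -> cdom c' (f p) -> cdom a' (f p) ->
  {for p, continuous f} ->
  sm (cmap a' \o f \o cinv a) (cmap a p) ->
  sm (cmap c' \o f \o cinv c) (cmap c p).
Proof.
move=> kc ka kc' ka' cp ap c'p a'p cf sf.
have s1 : sm (cmap a \o cinv c) (cmap c p) by exact: trans_sm.
have s2 : sm (cmap c' \o cinv a') (cmap a' (f p)) by exact: trans_sm.
apply: (@sm_eq _ _ _ (fun v => (cmap c' \o cinv a')
    ((cmap a' \o f \o cinv a) ((cmap a \o cinv c) v)))).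
  have h1 := near_cinv cp (near_cdom ap).
  have h2 := near_cinv cp (near_comp cf (near_cdom a'p)).
  by apply: filterS2 h1 h2 => v av a'v /=; rewrite cmapK // cmapK.
have e1 : (cmap a \o cinv c) (cmap c p) = cmap a p by rewrite /= cmapK.
have e2 : (cmap a' \o f \o cinv a) (cmap a p) = cmap a' (f p) by rewrite /= cmapK.
have s3 : sm (fun v => (cmap a' \o f \o cinv a) ((cmap a \o cinv c) v)) (cmap c p).
  by apply: (@sm_comp _ _ _ _ fE _ _ _ s1); rewrite e1.
by apply: (@sm_comp _ _ _ _ fF _ _ _ s3); rewrite e1 e2.
Qed.

Lemma msmP {fE : findim E} {fF : findim F} (f : M -> N) p
    (c : chart E M) (c' : chart F N) :
  compat c -> compat c' -> cdom c p -> cdom c' (f p) ->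
  msm f p <-> {for p, continuous f} /\ sm (cmap c' \o f \o cinv c) (cmap c p).
Proof.
move=> kc kc' cp c'p.
have ka := chart_at_compat p; have ka' := chart_at_compat (f p).
have ap := chart_at_dom p; have a'p := chart_at_dom (f p).
by split=> -[cf sf]; split=> //; apply: sm_recharts sf.
Qed.

Lemma msm_near {fE : findim E} {fF : findim F} (f : M -> N) p : msm f p ->
  \forall q \near p, msm f q.
Proof.
move=> [cf sf]; set c := chart_at p in sf; set c' := chart_at (f p) in sf.
have kc : compat c := chart_at_compat p; have kc' : compat c' := chart_at_compat (f p).
have cp : cdom c p := chart_at_dom p; have c'p : cdom c' (f p) := chart_at_dom (f p).
have n1 := near_cdom cp.
have n2 := near_comp cf (near_cdom c'p).
have n3 := near_cmap cp (sm_near sf).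
have [W [oW Wp WP]] := near_open (filterI n1 (filterI n2 n3)).
have : nbhs p W by exact: open_nbhs_nbhs.
apply: filterS => q Wq; have [cq [c'q sq]] := WP q Wq.
apply/(msmP kc kc' cq c'q); split=> //.
have nW : \forall z \near q, W z by exact: open_nbhs_nbhs.
(* Continuity is assumed at [p] only; at a nearby [q] it is recovered from the smooth
   representative. *)
have e : {near q, cinv c' \o (cmap c' \o f \o cinv c) \o cmap c =1 f}.
  by apply: filterS nW => z /WP [cz [c'z _]]; rewrite /= cmapK // cmapK.
rewrite /prop_for /continuous_at -(nbhs_singleton e).
apply: (cvg_trans (near_eq_cvg e)).
apply: (@continuous_comp _ _ _ (cmap c)); first exact: cmap_cts.
apply: (@continuous_comp _ _ _ _ (cinv c')); first exact: sm_cts.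
by apply: cinv_cts; rewrite /= cmapK //; exists (f q).
Qed.

Lemma msm_eq (f g : M -> N) p : {near p, f =1 g} -> msm f p -> msm g p.
Proof.
move=> fg [cf sf]; have fgp := nbhs_singleton fg; split.
  rewrite /prop_for /continuous_at -fgp; apply: cvg_trans cf.
  exact: near_eq_cvg.
rewrite -fgp; apply: sm_eq sf.
have := near_cinv (chart_at_dom p) fg.
by apply: filterS => v /= ->.
Qed.

Lemma mderiv_eq (f g : M -> N) p v : {near p, f =1 g} -> msm f p ->
  mderiv f p v = mderiv g p v.
Proof.
move=> fg [_ sf]; have fgp := nbhs_singleton fg; rewrite /mderiv -fgp.
apply: diff_eq; last exact: sm_diff.
have := near_cinv (chart_at_dom p) fg.
by apply: filterS => u /= ->.
Qed.

Lemma msm_cst (q : N) (p : M) : msm (fun _ => q) p.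
Proof. by split; [exact: cst_continuous|exact: sm_cst]. Qed.

Lemma mderiv_cst (q : N) (p : M) v : mderiv (fun _ => q) p v = 0.
Proof. exact: diff_cstE. Qed.

Lemma clin_mderiv (f : M -> N) p : msm f p -> clin (mderiv f p).
Proof. by move=> [_ sf]; apply: clin_diff; exact: sm_diff. Qed.

End Msm.

Section MsmComp.
Variables (E F E' : normedModType R).
Variables (M : smoothSpaceType E) (N : smoothSpaceType F) (P : smoothSpaceType E').

Lemma rep_comp_near (f : M -> N) (g : N -> P) p : {for p, continuous f} ->
  {near (cmap (chart_at p) p),
    (fun v => (cmap (chart_at (g (f p))) \o g \o cinv (chart_at (f p)))
     ((cmap (chart_at (f p)) \o f \o cinv (chart_at p)) v)) =1
    cmap (chart_at (g (f p))) \o (fun x => g (f x)) \o cinv (chart_at p)}.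
Proof.
move=> cf.
have := near_cinv (chart_at_dom p) (near_comp cf (near_cdom (chart_at_dom (f p)))).
by apply: filterS => v h /=; rewrite cmapK.
Qed.

Lemma msm_comp {fF : findim F} (f : M -> N) (g : N -> P) p :
  msm f p -> msm g (f p) -> msm (fun x => g (f x)) p.
Proof.
move=> [cf sf] [cg sg]; split; first exact: continuous_comp.
apply: (sm_eq (rep_comp_near g cf)); apply: (sm_comp sf).
by rewrite /= cmapK //; exact: chart_at_dom.
Qed.

Lemma mderiv_comp (f : M -> N) (g : N -> P) p v :
  msm f p -> msm g (f p) ->
  mderiv (fun x => g (f x)) p v = mderiv g (f p) (mderiv f p v).
Proof.
move=> [cf sf] [cg sg].
set r1 := cmap (chart_at (f p)) \o f \o cinv (chart_at p).
set r2 := cmap (chart_at (g (f p))) \o g \o cinv (chart_at (f p)).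
have e1 : r1 (cmap (chart_at p) p) = cmap (chart_at (f p)) (f p).
  by rewrite /r1 /= cmapK //; exact: chart_at_dom.
have d1 : differentiable r1 (cmap (chart_at p) p) by exact: sm_diff.
have d2 : differentiable r2 (r1 (cmap (chart_at p) p)).
  by rewrite e1; exact: sm_diff.
have d3 : differentiable (fun v => r2 (r1 v)) (cmap (chart_at p) p).
  exact: differentiable_comp.
have := sm_diff_comp v d1 d2; rewrite e1 => e3.
rewrite [RHS](_ : _ = 'd r2 (cmap (chart_at (f p)) (f p)) ('d r1 (cmap (chart_at p) p) v)) //.
rewrite -e3; apply/esym; apply: diff_eq => //; exact: rep_comp_near.
Qed.

End MsmComp.

Section MsmId.
Variables (E : normedModType R) (M : smoothSpaceType E).

Lemma rep_id_near (p : M) :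
  {near cmap (chart_at p) p, (fun v => v) =1 cmap (chart_at p) \o (fun x => x) \o cinv (chart_at p)}.
Proof. by have := cinvK_near (chart_at_dom p); apply: filterS => v [/= ->]. Qed.

Lemma msm_id (p : M) : msm (fun x => x) p.
Proof.
by split; [exact: cvg_id|apply: (sm_eq (rep_id_near p)); exact: sm_id].
Qed.

Lemma mderiv_id (p : M) v : mderiv (fun x : M => x) p v = v.
Proof.
rewrite /mderiv -(diff_eq _ (rep_id_near p)) ?diff_idE //.
Qed.

End MsmId.

Section MsmProd.
Variables (E F E' : normedModType R).
Variables (M : smoothSpaceType E) (N : smoothSpaceType F) (P : smoothSpaceType E').

Lemma msm_pair (f : M -> N) (g : M -> P) p :
  msm f p -> msm g p -> msm (fun x => (f x, g x)) p.
Proof.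
move=> [cf sf] [cg sg]; split; first exact: cvg_pair.
exact: sm_pair sf sg.
Qed.

Lemma mderiv_pair (f : M -> N) (g : M -> P) p v : msm f p -> msm g p ->
  mderiv (fun x => (f x, g x)) p v = (mderiv f p v, mderiv g p v).
Proof. by move=> [_ sf] [_ sg]; exact: diff_pairE (sm_diff sf) (sm_diff sg). Qed.

Lemma rep_fst_near (p : N * P) :
  {near cmap (chart_at p) p, fst =1 cmap (chart_at p.1) \o fst \o cinv (chart_at p)}.
Proof.
have h : \forall v \near cmap (chart_at p) p,
    cmap (chart_at p.1) (cinv (chart_at p.1) v.1) = v.1 /\ cdom (chart_at p.1) (cinv (chart_at p.1) v.1).
  exact: ((@clin_fst R F E').2 (cmap (chart_at p) p) _ (cinvK_near (chart_at_dom p.1))).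
by apply: filterS h => v [h _]; rewrite /= h.
Qed.

Lemma rep_snd_near (p : N * P) :
  {near cmap (chart_at p) p, snd =1 cmap (chart_at p.2) \o snd \o cinv (chart_at p)}.
Proof.
have h : \forall v \near cmap (chart_at p) p,
    cmap (chart_at p.2) (cinv (chart_at p.2) v.2) = v.2 /\ cdom (chart_at p.2) (cinv (chart_at p.2) v.2).
  exact: ((@clin_snd R F E').2 (cmap (chart_at p) p) _ (cinvK_near (chart_at_dom p.2))).
by apply: filterS h => v [h _]; rewrite /= h.
Qed.

Lemma msm_fst (p : N * P) : msm fst p.
Proof.
split; first exact: cvg_fst.
exact: sm_eq (rep_fst_near p) (sm_lin _ (@clin_fst _ F E')).
Qed.

Lemma msm_snd (p : N * P) : msm snd p.
Proof.
split; first exact: cvg_snd.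
exact: sm_eq (rep_snd_near p) (sm_lin _ (@clin_snd _ F E')).
Qed.

Lemma mderiv_snd (p : N * P) v : mderiv (snd : N * P -> P) p v = v.2.
Proof.
rewrite /mderiv -(diff_eq _ (rep_snd_near p)).
  by rewrite (diff_clin _ (@clin_snd _ F E')).
exact: sm_diff (sm_lin _ (@clin_snd _ F E')).
Qed.

End MsmProd.

Section SmoothOn.
Variables (E F : normedModType R) (M : smoothSpaceType E) (N : smoothSpaceType F).
Context {fE : findim E} {fF : findim F}.

Lemma smooth_open_msm (U : set M) (f : M -> N) p : open U -> U p ->
  smooth_open U f -> msm f p.
Proof.
move=> oU Up [cf sf]; split; first exact: cf.
set c := chart_at p; set c' := chart_at (f p).
have cp : cdom c p := chart_at_dom p; have c'p : cdom c' (f p) := chart_at_dom (f p).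
have S := sf c c' (chart_at_atlas p) (chart_at_atlas (f p)).
have n1 := near_cdom cp.
have n2 := near_comp (cf p Up) (near_cdom c'p).
have nU : \forall q \near p, U q by exact: open_nbhs_nbhs.
have [W [oW Wp WP]] := near_open (filterI n1 (filterI n2 nU)).
exists (cmap c @` (cdom c `&` W)); split.
- exact: chart_image_open.
- by exists p.
- move=> k; apply: Ck_sub (S k) => _ [q [cq Wq] <-]; exists q => //.
  by have [_ [h1 h2]] := WP q Wq.
Qed.

Lemma smooth_extP (A : set M) (f : M -> N) p f1 : smooth_ext A f p f1 <->
  msm f1 p /\ \forall q \near p, A q -> f1 q = f q.
Proof.
split=> [[U [oU Up sU fA]]|[sf fA]].
  split; first exact: smooth_open_msm sU.
  have : nbhs p U by exact: open_nbhs_nbhs.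
  by apply: filterS => q Uq Aq; exact: fA.
have [U [oU Up UP]] := near_open (filterI (msm_near sf) fA).
exists U; split=> //; last by move=> q [/UP[_ h] Aq]; exact: h.
split=> [q /UP [[]]|c c' ac ac'] //.
apply: sm_Csmooth => _ [q [[Uq cq] c'q] <-].
have [sq _] := UP q Uq.
by have [] := (msmP (atlas_compat ac) (atlas_compat ac') cq c'q).1 sq.
Qed.

Lemma smooth_on_ext (A : set M) (f : M -> N) p : smooth_on A f -> A p ->
  exists f1, msm f1 p /\ \forall q \near p, A q -> f1 q = f q.
Proof. by move=> sf Ap; have [f1 /smooth_extP] := sf p Ap; exists f1. Qed.

Lemma msm_smooth_on (A : set M) (f : M -> N) :
  (forall p, A p -> msm f p) -> smooth_on A f.
Proof.
move=> sf p Ap; exists f; apply/smooth_extP; split; first exact: sf.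
exact: nearW.
Qed.

Lemma smooth_on_msm (A : set M) (f : M -> N) p :
  smooth_on A f -> (\forall q \near p, A q) -> msm f p.
Proof.
move=> sf nA; have [f1 [s1 e1]] := smooth_on_ext sf (nbhs_singleton nA).
apply: msm_eq s1; by apply: filterS2 nA e1 => q Aq; apply.
Qed.

End SmoothOn.

Section Tangent.
Variables (E : normedModType R) (M : smoothSpaceType E).
Context {fE : findim E}.

Lemma near0_ball (P : R^o -> Prop) : (\forall t \near (0 : R^o), P t) <->
  exists2 e : R, 0 < e & forall t : R^o, `|t| < e -> P t.
Proof.
split=> [/near_ball_ex [e e0 eP]|[e e0 eP]].
  by exists e => // t te; apply: eP; apply/ball0P.
have : nbhs (0 : R^o) (ball (0 : R^o) e) by exact: nbhsx_ballx.
by apply: filterS => t /ball0P; exact: eP.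
Qed.

Lemma tangentP (A : set M) p v : tangent_to A p v <->
  exists gamma : R^o -> M, [/\ msm gamma 0, (\forall t \near (0 : R^o), A (gamma t)),
    gamma 0 = p & velocity gamma 0 = v].
Proof.
split=> [[e [g /= [e0 sg gA g0 gv]]]|[g [sg gA g0 gv]]].
  exists g; split=> //; last by apply/near0_ball; exists e.
  by apply: (smooth_on_msm sg); apply/near0_ball; exists e.
have [e e0 eP] := (near0_ball _).1 (filterI (msm_near sg) gA).
exists e, g; split=> //; last by move=> t /eP[].
by apply: msm_smooth_on => t /eP[].
Qed.

End Tangent.

Section TangentMap.
Variables (E F : normedModType R) (M : smoothSpaceType E) (N : smoothSpaceType F).
Context {fE : findim E} {fF : findim F}.

Lemma velocity_comp (f : M -> N) (g : R^o -> M) p : msm g 0 -> g 0 = p ->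
  msm f p -> velocity (fun t => f (g t)) 0 = mderiv f p (velocity g 0).
Proof. by move=> sg <- sf; exact: mderiv_comp. Qed.

Lemma near_curve (g : R^o -> M) p (P : M -> Prop) : msm g 0 -> g 0 = p ->
  (\forall q \near p, P q) -> \forall t \near (0 : R^o), P (g t).
Proof. by move=> [cg _] <- nP; exact: near_comp cg nP. Qed.

(** Tested on a curve in [A], along which the two maps coincide. Hence a derivative along tangent
    vectors depends only on the restriction to [A]. *)
Lemma mderiv_tangent_eq (A : set M) (f f1 : M -> N) p v : msm f p -> msm f1 p ->
  (\forall q \near p, A q -> f q = f1 q) -> tangent_to A p v ->
  mderiv f p v = mderiv f1 p v.
Proof.
move=> sf sf1 e /tangentP [g [sg gA g0 <-]].
rewrite -(velocity_comp sg g0 sf) -(velocity_comp sg g0 sf1).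
apply: mderiv_eq; last by apply: msm_comp => //; rewrite g0.
by apply: filterS2 gA (near_curve sg g0 e) => t At; apply.
Qed.

(** Removes the choice of an extension in [mderiv_on]: any smooth extension computes it. *)
Lemma mderiv_onE (A : set M) (f f1 : M -> N) p v : msm f1 p ->
  (\forall q \near p, A q -> f1 q = f q) -> tangent_to A p v ->
  mderiv_on A f p v = mderiv f1 p v.
Proof.
move=> sf1 e1 tv; rewrite /mderiv_on.
case: xgetP => [f2 _ /smooth_extP [sf2 e2]|/(_ f1) []]; last exact/smooth_extP.
apply: (@mderiv_tangent_eq A) => //.
by apply: filterS2 e1 e2 => q h1 h2 Aq; rewrite h1 // h2.
Qed.

Lemma tangent_image (A : set M) (B : set N) (f : M -> N) p v : msm f p ->
  (\forall q \near p, A q -> B (f q)) -> tangent_to A p v ->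
  tangent_to B (f p) (mderiv f p v).
Proof.
move=> sf AB /tangentP [g [sg gA g0 <-]]; apply/tangentP.
exists (fun t => f (g t)); split.
- by apply: msm_comp => //; rewrite g0.
- by apply: filterS2 gA (near_curve sg g0 AB) => t At; apply.
- by rewrite g0.
- exact: velocity_comp.
Qed.

End TangentMap.
End ManifoldGerms.

(** * Maps into vector spaces, charts as maps, partial derivatives *)

Section FlatSpaces.
Variable R : realType.

Lemma msm_rV a b (f : 'rV[R]_a -> 'rV[R]_b) x : sm f x -> msm f x.
Proof. by move=> sf; split; [exact: sm_cts|exact: sf]. Qed.

Lemma msm_rV_sm a b (f : 'rV[R]_a -> 'rV[R]_b) x : msm f x -> sm f x.
Proof. by move=> [_]. Qed.

Lemma mderiv_rV a b (f : 'rV[R]_a -> 'rV[R]_b) x v : mderiv f x v = 'd f x v.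
Proof. by []. Qed.

Lemma msm_curve_rV b (f : R^o -> 'rV[R]_b) x : sm f x -> msm f x.
Proof. by move=> sf; split; [exact: sm_cts|exact: sf]. Qed.

Lemma msm_RR (f : R^o -> R^o) x : sm f x -> msm f x.
Proof. by move=> sf; split; [exact: sm_cts|exact: sf]. Qed.

Lemma velocity_rV b (f : R^o -> 'rV[R]_b) x : velocity f x = 'd f x (1 : R^o).
Proof. by []. Qed.

Section ToFlat.
Variables (E : normedModType R) (M : smoothSpaceType E) (k : nat).

Lemma msm_flat (f : M -> 'rV[R]_k) p :
  sm (f \o cinv (chart_at p)) (cmap (chart_at p) p) -> msm f p.
Proof.
move=> sf; split; last exact: sf.
have cp : cdom (chart_at p) p by exact: chart_at_dom.
have e : {near p, (f \o cinv (chart_at p)) \o cmap (chart_at p) =1 f}.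
  by apply: filterS (near_cdom cp) => q cq; rewrite /= cmapK.
rewrite /prop_for /continuous_at -(nbhs_singleton e).
apply: (cvg_trans (near_eq_cvg e)).
apply: (@continuous_comp _ _ _ (cmap (chart_at p))); first exact: cmap_cts.
exact: sm_cts.
Qed.

Lemma msm_flat_sm (f : M -> 'rV[R]_k) p : msm f p ->
  sm (f \o cinv (chart_at p)) (cmap (chart_at p) p).
Proof. by case. Qed.

Lemma msm_addf (f g : M -> 'rV[R]_k) p : msm f p -> msm g p ->
  msm (fun x => f x + g x) p.
Proof.
by move=> /msm_flat_sm sf /msm_flat_sm sg; apply: msm_flat; exact: sm_add sf sg.
Qed.

Lemma msm_linf l (L : 'rV[R]_k -> 'rV[R]_l) (f : M -> 'rV[R]_k) p : linear L ->
  msm f p -> msm (fun x => L (f x)) p.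
Proof.
move=> lL sf; apply: msm_comp => //.
by apply: msm_rV; apply: sm_lin; exact: lin_clin.
Qed.

Lemma msm_oppf (f : M -> 'rV[R]_k) p : msm f p -> msm (fun x => - f x) p.
Proof.
have lL : linear (fun x : 'rV[R]_k => - x) by move=> a x y; rewrite opprD scalerN.
by move=> sf; exact: (msm_linf lL sf).
Qed.

Lemma msm_subf (f g : M -> 'rV[R]_k) p : msm f p -> msm g p ->
  msm (fun x => f x - g x) p.
Proof. by move=> sf sg; exact: (msm_addf sf (msm_oppf sg)). Qed.

End ToFlat.

Section ChartMaps.
Variables (n : nat) (M : smoothSpaceType 'rV[R]_n).
Implicit Types (c : chart 'rV[R]_n M) (p : M).

Let kid (x : 'rV[R]_n) : compat (id_chart 'rV[R]_n).
Proof. exact: (@chart_at_compat R _ 'rV[R]_n x). Qed.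

Lemma msm_cmap c p : compat c -> cdom c p -> msm (cmap c) p.
Proof.
move=> kc cp; have i1 : cdom (id_chart 'rV[R]_n) (cmap c p) by [].
apply: (@msmP R _ _ M 'rV[R]_n _ _ (cmap c) p c _ kc (kid (cmap c p)) cp i1).2.
split; first exact: cmap_cts.
apply: (sm_eq _ (sm_id _)).
by apply: filterS (cinvK_near cp) => v [/= ->].
Qed.

Lemma msm_cinv c p : compat c -> cdom c p -> msm (cinv c) (cmap c p).
Proof.
move=> kc cp; have ccp : cdom c (cinv c (cmap c p)) by rewrite cmapK.
have i1 : cdom (id_chart 'rV[R]_n) (cmap c p) by [].
apply: (@msmP R _ _ 'rV[R]_n M _ _ (cinv c) (cmap c p) _ c (kid (cmap c p)) kc i1 ccp).2.
split; first by apply: cinv_cts; exists p.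
apply: (sm_eq _ (sm_id _)).
by apply: filterS (cinvK_near cp) => v [/= ->].
Qed.

Lemma dcmapK c p w : compat c -> cdom c p ->
  mderiv (cmap c) p (mderiv (cinv c) (cmap c p) w) = w.
Proof.
move=> kc cp; have e := cmapK cp.
have h := @mderiv_comp _ _ _ _ _ _ _ (cinv c) (cmap c) (cmap c p) w (msm_cinv kc cp).
rewrite e in h; rewrite -h; last exact: msm_cmap.
rewrite mderiv_rV -[RHS](diff_idE (cmap c p)); apply/esym; apply: diff_eq.
  by apply: filterS (cinvK_near cp) => v [->].
exact: sm_diff (sm_id _).
Qed.

Lemma dcinvK c p v : compat c -> cdom c p ->
  mderiv (cinv c) (cmap c p) (mderiv (cmap c) p v) = v.
Proof.
move=> kc cp; rewrite -mderiv_comp; [|exact: msm_cmap|exact: msm_cinv].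
rewrite -[RHS](mderiv_id p); apply/esym; apply: mderiv_eq; last exact: msm_id.
by apply: filterS (near_cdom cp) => q cq; rewrite cmapK.
Qed.

Lemma dcmap_at p v : mderiv (cmap (chart_at p)) p v = v.
Proof.
transitivity (mderiv (fun x : M => x) p v); last exact: mderiv_id.
by [].
Qed.

(** The normalization of the derivative is expressed in a chart [c] of the target, so that the
    vector space version applies to [f] followed by [cmap c]. *)
Lemma inverse_function_mfd (f : 'rV[R]_n -> M) a c : compat c -> cdom c (f a) ->
  msm f a -> (forall w, mderiv (cmap c) (f a) (mderiv f a w) = w) ->
  exists g : M -> 'rV[R]_n, [/\ msm g (f a), g (f a) = a,
    (\forall x \near a, g (f x) = x) & \forall y \near f a, f (g y) = y].
Proof.
move=> kc cfa sf df; have sc : msm (cmap c) (f a) by exact: msm_cmap.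
have sF : msm (fun x => cmap c (f x)) a by exact: msm_comp.
have dF w : 'd (fun x => cmap c (f x)) a w = w.
  by rewrite -[RHS]df; exact: (mderiv_comp w sf sc).
have [g0 [sg0 g0a gf fg]] := inverse_function (msm_rV_sm sF) dF.
have sg : msm (fun y => g0 (cmap c y)) (f a).
  by apply: msm_comp => //; exact: msm_rV.
exists (fun y => g0 (cmap c y)); split=> //.
have fc : \forall x \near a, cdom c (f x) := near_comp (msm_cts sf) (near_cdom cfa).
have n1 : \forall y \near f a, cdom c (f (g0 (cmap c y))).
  have fc' : \forall x \near g0 (cmap c (f a)), cdom c (f x) by rewrite g0a.
  exact: (near_comp (msm_cts sg) fc').
have n2 := near_cmap cfa fg.
have n3 := near_cdom cfa.
apply: filterS3 n1 n2 n3 => y c1 e2 cy.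
by rewrite -(cmapK c1) e2 cmapK.
Qed.

End ChartMaps.

Section Partial.
Variables (E F' : normedModType R) (b k : nat).
Variables (N : smoothSpaceType 'rV[R]_b) (M : smoothSpaceType E).
Variables (P : smoothSpaceType F').
Context {fE : findim E} {fF' : findim F'}.

Lemma partial_chart (f : N -> 'rV[R]_k) c y v : compat c -> cdom c y -> msm f y ->
  mderiv f y v = 'd (f \o cinv c) (cmap c y) (mderiv (cmap c) y v).
Proof.
move=> kc cy sf; have e : cinv c (cmap c y) = y by rewrite cmapK.
have s1 : msm (f \o cinv c) (cmap c y).
  by apply: msm_comp; [exact: msm_cinv|rewrite e].
rewrite -[RHS]mderiv_rV -(mderiv_comp _ (msm_cmap kc cy) s1).
apply/esym; apply: mderiv_eq.
  by apply: filterS (near_cdom cy) => q cq; rewrite /= cmapK.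
by apply: (msm_comp (msm_cmap kc cy)).
Qed.

(* In charts the partial derivative is the tangent map of [f] evaluated at
   [(w, 0)], hence jointly smooth. *)
Lemma msm_partial0 (f : N * M -> 'rV[R]_k) q p w0 : msm f (q, p) ->
  msm (fun t : (N * M) * 'rV[R]_b =>
    'd ((fun y => f (y, t.1.2)) \o cinv (chart_at q)) (cmap (chart_at q) t.1.1) t.2)
    ((q, p), w0).
Proof.
move=> sf; have := msm_flat_sm sf => /=.
set c := chart_at q; set c' := chart_at p.
pose h (v : 'rV[R]_b * E) := f (cinv c v.1, cinv c' v.2).
move=> sh0; have sh : sm h (cmap c q, cmap c' p) by exact: sh0.
apply: msm_flat => /=.
pose H (r : ('rV[R]_b * E) * ('rV[R]_b * E)) := 'd h (r.1) (r.2).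
have s1 : sm H ((cmap c q, cmap c' p), (w0, 0)) by exact: sm_tangent.
pose i (t : ('rV[R]_b * E) * 'rV[R]_b) : ('rV[R]_b * E) * ('rV[R]_b * E) := (t.1, (t.2, 0)).
have si : sm i ((cmap c q, cmap c' p), w0).
  apply: sm_lin; apply: clin_pair; first exact: clin_fst.
  apply: clin_pair; [exact: clin_snd|exact: clin_cst0].
have s2 : sm (fun t => H (i t)) ((cmap c q, cmap c' p), w0) by exact: (sm_comp si s1).
apply: sm_eq s2.
have n1 : \forall t \near ((cmap c q, cmap c' p), w0), sm h t.1.
  exact: ((@clin_fst R _ 'rV[R]_b).2 ((cmap c q, cmap c' p), w0) _ (sm_near sh)).
have n2 : \forall t \near ((cmap c q, cmap c' p), w0),
    cmap c (cinv c t.1.1) = t.1.1 /\ cdom c (cinv c t.1.1).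
  have cl := clin_comp (@clin_fst R _ 'rV[R]_b) (@clin_fst R 'rV[R]_b E).
  exact: (cl.2 ((cmap c q, cmap c' p), w0) _ (cinvK_near (chart_at_dom q))).
apply: filterS2 n1 n2 => -[[u x] w] /= shx [e _].
rewrite e; have si1 : sm (fun u : 'rV[R]_b => (u, x)) u.
  by apply: sm_pair; [exact: sm_id|exact: sm_cst].
have := sm_diff_comp w (sm_diff si1) (sm_diff shx).
rewrite diff_pairE; [|exact: sm_diff (sm_id _)|exact: sm_diff (sm_cst _ _)].
by rewrite diff_idE diff_cstE => /esym.
Qed.

(** The form in which derivatives along vector fields are proved smooth. The field [V] enters
    through the fixed chart at [y s], because its components in the preferred charts at the moving
    points [y t] need not vary smoothly. *)
Lemma msm_mderiv (f : N * M -> 'rV[R]_k) (y : P -> N) (z : P -> M) (V : P -> 'rV[R]_b) s :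
  msm f (y s, z s) -> msm y s -> msm z s ->
  msm (fun t => mderiv (cmap (chart_at (y s))) (y t) (V t)) s ->
  msm (fun t => mderiv (fun y' => f (y', z t)) (y t) (V t)) s.
Proof.
move=> sf sy sz sV; set c := chart_at (y s) in sV.
have syz : msm (fun t => (y t, z t)) s by exact: msm_pair.
pose G (r : (N * M) * 'rV[R]_b) : 'rV[R]_k :=
  'd ((fun y' => f (y', r.1.2)) \o cinv c) (cmap c r.1.1) r.2.
have s1 : msm G ((y s, z s), mderiv (cmap c) (y s) (V s)) by exact: msm_partial0.
have s2 : msm (fun t => G ((y t, z t), mderiv (cmap c) (y t) (V t))) s.
  exact: (msm_comp (msm_pair syz sV) s1).
apply: msm_eq s2.
have n0 : \forall r \near (y s, z s), msm f r by exact: msm_near.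
have n1 := near_comp (msm_cts syz) n0.
have n2 := near_comp (msm_cts sy) (near_cdom (chart_at_dom (y s))).
apply: filterS2 n1 n2 => t /= st ct.
rewrite (partial_chart _ (chart_at_compat (y s)) ct) //.
apply: (@msm_comp _ _ _ _ _ _ _ _ (fun y' => (y', z t)) f) => //.
by apply: msm_pair; [exact: msm_id|exact: msm_cst].
Qed.

End Partial.

Section SliceCharts.
Variables (n : nat) (M : smoothSpaceType 'rV[R]_n) (k : nat) (S : set M).

Definition slice_chart (c : chart 'rV[R]_n M) (p : M) : Prop :=
  [/\ compat c, cdom c p & forall q, cdom c q ->
     (S q <-> forall i : 'I_n, (k <= i)%N -> cmap c q ord0 i = 0)].

Lemma slice_chart_tangent c p (v : 'rV[R]_n) : slice_chart c p -> tangent_to S p v ->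
  forall i : 'I_n, (k <= i)%N -> (mderiv (cmap c) p v) ord0 i = 0.
Proof.
move=> [kc cp cS] /tangentP [g [sg gS g0 <-]] i ki.
have sc : msm (cmap c) p by exact: msm_cmap.
rewrite -(velocity_comp sg g0 sc) velocity_rV.
have s1 : sm (fun t => cmap c (g t)) 0.
  have scg : msm (cmap c) (g 0) by rewrite g0.
  by have [_] := msm_comp sg scg.
have cl := @clin_coord R 1 n ord0 i.
rewrite -(diff_clin_comp (1 : R^o) (sm_diff s1) cl).
rewrite -[RHS](@diff_cstE R R^o R^o 0 0 1); apply: diff_eq; last first.
  exact: sm_diff (sm_clin cl s1).
apply: filterS2 gS (near_curve sg g0 (near_cdom cp)) => t St ct.
exact: (cS _ ct).1 St i ki.
Qed.

(** The curve is a straight line in the chart. Together with [slice_chart_tangent] this identifies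
    the tangent space with a coordinate subspace, and so provides the linear structure that the
    definition by curves does not display. *)
Lemma tangent_slice_chart c p (w : 'rV[R]_n) : slice_chart c p -> S p ->
  (forall i : 'I_n, (k <= i)%N -> w ord0 i = 0) ->
  tangent_to S p (mderiv (cinv c) (cmap c p) w).
Proof.
move=> [kc cp cS] Sp w0; apply/tangentP.
pose l (t : R^o) : 'rV[R]_n := cmap c p + t *: w.
have sl : sm l 0.
  by apply: sm_add; [exact: sm_cst|exact: sm_lin (clin_scalel _)].
have l0 : l 0 = cmap c p by rewrite /l scale0r addr0.
have sc : msm (cinv c) (l 0) by rewrite l0; exact: msm_cinv.
have sg : msm (fun t => cinv c (l t)) 0 by apply: msm_comp => //; exact: msm_curve_rV.
exists (fun t => cinv c (l t)); split => //.
- have : \forall v \near l 0, cmap c (cinv c v) = v /\ cdom c (cinv c v).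
    by rewrite l0; exact: cinvK_near.
  move=> nc; have h := near_comp (sm_cts sl) nc.
  apply: filterS h => t [e ct]; apply/(cS _ ct) => i ki.
  by rewrite e /l !mxE w0 // mulr0 addr0; exact: (cS _ cp).1.
- by rewrite l0 cmapK.
- have sl' : msm l 0 by exact: msm_curve_rV.
  have sc' : msm (cinv c) (cmap c p) by exact: msm_cinv.
  rewrite (velocity_comp sl' l0 sc'); congr (mderiv (cinv c) _ _).
  have s1 : sm (fun _ : R^o => cmap c p) 0 by exact: sm_cst.
  have s2 : sm (fun t : R^o => t *: w) 0 by exact: sm_lin (clin_scalel _).
  transitivity ('d (fun _ : R^o => cmap c p) (0 : R^o) (1 : R^o) +
                'd (fun t : R^o => t *: w) (0 : R^o) (1 : R^o)).
    exact: (diff_addE _ (sm_diff s1) (sm_diff s2)).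
  have h1 : 'd (fun _ : R^o => cmap c p) (0 : R^o) (1 : R^o) = 0 by exact: diff_cstE.
  have h2 : 'd (fun t : R^o => t *: w) (0 : R^o) (1 : R^o) = w.
    apply: etrans (scale1r w).
    exact: (congr1 (fun g : R^o -> 'rV[R]_n => g (1 : R^o)) (diff_clin (0 : R^o) (clin_scalel w))).
  exact: etrans (congr2 +%R h1 h2) (add0r w).
Qed.

End SliceCharts.

End FlatSpaces.

Lemma diff_add_cst (R : realType) (E F : normedModType R) (f : E -> F) (a : F) x v :
  differentiable f x -> 'd (fun x => f x + a) x v = 'd f x v.
Proof.
move=> df; apply: etrans (diff_addE _ df (differentiable_cst a x)) _.
exact: etrans (congr1 _ (diff_cstE a x v)) (addr0 _).
Qed.

Lemma diff_inv (R : realType) (E F : normedModType R) (f : E -> F) (g : F -> E) x v :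
  differentiable f x -> differentiable g (f x) -> (\forall y \near x, g (f y) = y) ->
  'd g (f x) ('d f x v) = v.
Proof.
move=> df dg gf; apply: etrans (esym (sm_diff_comp v df dg)) _.
apply: etrans (diff_idE x v); apply/esym; apply: diff_eq.
  by apply: filterS gf => y ->.
exact: sm_diff (sm_id _).
Qed.

Lemma diff_inv_eq (R : realType) (E F : normedModType R) (f : E -> F) (g : F -> E)
    x y u v : f x = y -> 'd f x v = u ->
  differentiable f x -> differentiable g y -> (\forall z \near x, g (f z) = z) ->
  'd g y u = v.
Proof. by move=> <- <-; exact: diff_inv. Qed.

Section PartialDerivatives.
Variable R : realType.
Variables (E F E' F' : normedModType R).
Variables (N : smoothSpaceType E) (M : smoothSpaceType F) (P : smoothSpaceType E').
Variable (Q : smoothSpaceType F').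
Context {fE : findim E} {fF : findim F}.

Lemma mderiv_prod (f : N * M -> P) q p v w : msm f (q, p) ->
  mderiv f (q, p) (v, w) =
  mderiv (fun y => f (y, p)) q v + mderiv (fun z => f (q, z)) p w.
Proof.
move=> sf; have cl := clin_mderiv sf.
have -> : (v, w) = (v, 0) + (0, w) :> E * F by congr pair; rewrite /= ?addr0 ?add0r.
rewrite (clinD _ _ cl).
have s1 : msm (fun y : N => (y, p)) q by apply: msm_pair; [exact: msm_id|exact: msm_cst].
have s2 : msm (fun z : M => (q, z)) p by apply: msm_pair; [exact: msm_cst|exact: msm_id].
rewrite (mderiv_comp v s1 sf) (mderiv_comp w s2 sf).
rewrite mderiv_pair; [|exact: msm_id|exact: msm_cst].
rewrite mderiv_pair; [|exact: msm_cst|exact: msm_id].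
by rewrite !mderiv_id !mderiv_cst.
Qed.

Lemma mderiv_comp2 (f : N * M -> P) (y : Q -> N) (z : Q -> M) s v :
  msm f (y s, z s) -> msm y s -> msm z s ->
  mderiv (fun t => f (y t, z t)) s v =
  mderiv (fun y' => f (y', z s)) (y s) (mderiv y s v) +
  mderiv (fun z' => f (y s, z')) (z s) (mderiv z s v).
Proof.
move=> sf sy sz.
by rewrite (mderiv_comp v (msm_pair sy sz) sf) mderiv_pair // mderiv_prod.
Qed.

End PartialDerivatives.

(** * The exponential map of a Lie group *)

Section GroupMaps.
Variables (R : realType) (d : nat) (G : lieGroupType 'rV[R]_d).
Variables (E : normedModType R) (P : smoothSpaceType E).
Context {fE : findim E}.
Implicit Types (f g : P -> G) (p : P).

Lemma msm_mul0 (q : G * G) : msm (fun gh : G * G => (gh.1 * gh.2)%g) q.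
Proof. by apply: (smooth_on_msm (@mulg_smooth R _ G)); exact: filterT. Qed.

Lemma msm_inv0 (q : G) : msm (fun g : G => (g^-1)%g) q.
Proof. by apply: (smooth_on_msm (@invg_smooth R _ G)); exact: filterT. Qed.

Lemma msm_mulg f g p : msm f p -> msm g p -> msm (fun x => (f x * g x)%g) p.
Proof. by move=> sf sg; exact: (msm_comp (msm_pair sf sg) (msm_mul0 _)). Qed.

Lemma msm_invg f p : msm f p -> msm (fun x => (f x)^-1%g) p.
Proof. by move=> sf; exact: (msm_comp sf (msm_inv0 _)). Qed.

Lemma msm_conjg (a : G) f p : msm f p -> msm (fun x => (a * f x * a^-1)%g) p.
Proof.
move=> sf; apply: msm_mulg; last exact: msm_cst.
by apply: msm_mulg => //; exact: msm_cst.
Qed.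

Lemma mderiv_mul1 f g p v : msm f p -> msm g p -> f p = 1%g -> g p = 1%g ->
  mderiv (fun x => (f x * g x)%g) p v = mderiv f p v + mderiv g p v.
Proof.
move=> sf sg f1 g1.
have h := mderiv_comp2 v (msm_mul0 (f p, g p)) sf sg.
rewrite /= in h; rewrite h {h} f1 g1.
have -> : (fun y' : G => (y' * 1)%g) = (fun y' => y').
  by apply/funext => y; rewrite mulg1.
have -> : (fun y' : G => (1 * y')%g) = (fun y' => y').
  by apply/funext => y; rewrite mul1g.
by congr (_ + _); exact: mderiv_id.
Qed.

End GroupMaps.

Section LogExp.
Variables (R : realType) (d : nat) (G : lieGroupType 'rV[R]_d).
Implicit Types (g h : G) (v w xi : 'rV[R]_d).

Let c1 : chart 'rV[R]_d G := chart_at (1%g : G).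
Let e1 : 'rV[R]_d := cmap c1 1%g.
Let k1 : compat c1 := chart_at_compat _.
Let d1 : cdom c1 1%g := chart_at_dom _.

(** A chart of the group at the identity, centred at 0; [kapi] is its local inverse. *)
Definition kap g : 'rV[R]_d := cmap c1 g - e1.
Definition kapi v : G := cinv c1 (v + e1).

Lemma kapi0 : kapi 0 = 1%g. Proof. by rewrite /kapi add0r cmapK. Qed.
Lemma kap1 : kap 1%g = 0. Proof. by rewrite /kap subrr. Qed.

Lemma msm_kap : msm kap 1%g.
Proof. by apply: msm_subf; [exact: msm_cmap|exact: msm_cst]. Qed.

Lemma msm_kapi : msm kapi 0.
Proof.
have s0 : msm (fun v : 'rV[R]_d => v + e1) 0.
  by apply: msm_addf; [exact: msm_id|exact: msm_cst].
by apply: (msm_comp s0); rewrite add0r; exact: msm_cinv.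
Qed.

Lemma kapK_near : \forall g \near (1%g : G), kapi (kap g) = g.
Proof.
by apply: filterS (near_cdom d1) => g cg; rewrite /kapi /kap subrK cmapK.
Qed.

Lemma kapiK_near : \forall v \near (0 : 'rV[R]_d), kap (kapi v) = v.
Proof.
have n1 : \forall v \near (0 : 'rV[R]_d) + e1, cmap c1 (cinv c1 v) = v.
  by rewrite add0r; apply: filterS (cinvK_near d1) => v [].
have s0 : sm (fun v : 'rV[R]_d => v + e1) 0.
  by apply: sm_add; [exact: sm_id|exact: sm_cst].
by have := near_comp (sm_cts s0) n1; apply: filterS => v; rewrite /kap /kapi => ->; rewrite addrK.
Qed.

Lemma dkap v : mderiv kap 1%g v = v.
Proof.
have := @mderiv_comp _ _ _ _ _ _ _ (cmap c1) (fun x : 'rV[R]_d => x - e1) 1%g v (msm_cmap k1 d1).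
have sB : sm (fun x : 'rV[R]_d => x - e1) e1 by apply: sm_add; [exact: sm_id|exact: sm_cst].
move=> /(_ (msm_rV sB)) ->; rewrite dcmap_at.
apply: etrans (diff_add_cst (- e1) v (sm_diff (sm_id e1))) _.
exact: diff_idE.
Qed.

Lemma dkapi v : mderiv kapi 0 v = v.
Proof.
have h := @mderiv_comp _ _ _ _ _ _ _ kapi kap 0 v msm_kapi.
rewrite kapi0 in h; rewrite -[LHS]dkap -(h msm_kap).
rewrite -[RHS](mderiv_id (0 : 'rV[R]_d)); apply/esym; apply: mderiv_eq; last exact: msm_id.
by apply: filterS kapiK_near => u ->.
Qed.

Lemma near_kap (P : 'rV[R]_d -> Prop) : (\forall v \near (0 : 'rV[R]_d), P v) ->
  \forall g \near (1%g : G), P (kap g).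
Proof. by rewrite -kap1; exact: near_comp (msm_cts msm_kap). Qed.

Definition sqk v : 'rV[R]_d := kap (kapi v * kapi v)%g.

Lemma sm_sqk : sm sqk 0.
Proof.
apply: msm_rV_sm; apply: (@msm_comp _ _ _ _ _ _ _ _ (fun v => (kapi v * kapi v)%g) kap).
  by apply: msm_mulg; exact: msm_kapi.
by rewrite kapi0 mulg1; exact: msm_kap.
Qed.

Lemma sqk0 : sqk 0 = 0. Proof. by rewrite /sqk kapi0 mulg1 kap1. Qed.

Lemma dsqk v : 'd sqk 0 v = v + v.
Proof.
rewrite -mderiv_rV.
have s2 : msm (fun v => (kapi v * kapi v)%g) 0 by apply: msm_mulg; exact: msm_kapi.
have h := @mderiv_comp _ _ _ _ _ _ _ (fun v => (kapi v * kapi v)%g) kap 0 v s2.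
rewrite kapi0 mulg1 in h; rewrite (h msm_kap) dkap.
by rewrite (mderiv_mul1 v msm_kapi msm_kapi kapi0 kapi0) dkapi.
Qed.

(** Squaring has derivative 2 at the identity, so half of it satisfies the normalization of the
    inverse function theorem. *)
Lemma sqrt_exists : exists q : 'rV[R]_d -> 'rV[R]_d, [/\ halving q,
  (\forall v \near (0 : 'rV[R]_d), q (sqk v) = v) &
  (\forall v \near (0 : 'rV[R]_d), sqk (q v) = v)].
Proof.
pose f v := (1/2 : R) *: sqk v.
have cl : clin (fun v : 'rV[R]_d => (1/2 : R) *: v) by exact: clin_scaler.
have f0 : f 0 = 0 by rewrite /f sqk0 scaler0.
have sf : sm f 0 by exact: (sm_clin cl sm_sqk).
have df w : 'd f 0 w = w.
  rewrite (diff_clin_comp w (sm_diff sm_sqk) cl) dsqk scalerDr -scalerDl.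
  by have -> : 1/2 + 1/2 = 1 :> R by [lra]; rewrite scale1r.
have [g [sg ga gf fg]] := inverse_function sf df.
rewrite f0 in sg ga fg.
exists (fun v => g ((1/2 : R) *: v)).
have h0 : (1/2 : R) *: (0 : 'rV[R]_d) = 0 by rewrite scaler0.
have nh (P : 'rV[R]_d -> Prop) : (\forall v \near (0 : 'rV[R]_d), P v) ->
    \forall v \near (0 : 'rV[R]_d), P ((1/2 : R) *: v).
  by move=> nP; apply: (near_comp (cl.2 0)); rewrite h0.
split.
- split.
  + by apply: (sm_comp (sm_lin 0 cl)); rewrite h0.
  + by rewrite h0.
  + move=> w.
    have := @sm_diff_comp _ _ _ _ (fun v => (1/2 : R) *: v) g 0 w (sm_diff (sm_lin 0 cl)).
    have dh : 'd (fun v : 'rV[R]_d => (1/2 : R) *: v) 0 w = (1/2 : R) *: w.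
      exact: (congr1 (fun k : 'rV[R]_d -> 'rV[R]_d => k w) (diff_clin 0 cl)).
    rewrite h0 => /(_ (sm_diff sg)) ->; apply: etrans (congr1 ('d g 0) dh) _.
    exact: (diff_inv_eq f0 (df ((1/2 : R) *: w)) (sm_diff sf) (sm_diff sg) gf).
- exact: gf.
- apply: filterS (nh _ fg) => v; rewrite /f => h.
  have : 2 *: ((1/2 : R) *: sqk (g ((1/2 : R) *: v))) = 2 *: ((1/2 : R) *: v) by rewrite h.
  rewrite !scalerA; have -> : 2 * (1/2) = 1 :> R by field.
  by rewrite !scale1r.
Qed.

(* [l] is the Koenigs linearization of the square root, [E] its local inverse. *)
Lemma log_exists : exists (l : G -> 'rV[R]_d) (E : 'rV[R]_d -> G) (W : G -> Prop),
  [/\ msm E 0 /\ E 0 = 1%g, forall v, mderiv E 0 v = v,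
   (\forall v \near (0 : 'rV[R]_d), l (E v) = v) /\ (\forall g \near (1%g : G), W g),
   (forall g, W g -> E (l g) = g) /\
   (forall u : nat -> G, (forall n, W (u n)) -> (forall n, (u n.+1 * u n.+1)%g = u n) ->
     (fun n => (2 ^+ n : R) *: kap (u n)) @ \oo --> l (u 0%N)) &
   (\forall v \near (0 : 'rV[R]_d), (E ((1/2 : R) *: v) * E ((1/2 : R) *: v))%g = E v)].
Proof.
have [q [hq qs sq]] := sqrt_exists.
have [L [sL L0 dL cL]] := koenigs hq.
have [E0 [sE0 E00 EL LE]] := inverse_function sL dL.
rewrite L0 in sE0 E00 LE.
pose E v := kapi (E0 v).
have sE : msm E 0.
  by apply: (msm_comp (msm_rV sE0)); rewrite E00; exact: msm_kapi.
have E1 : E 0 = 1%g by rewrite /E E00 kapi0.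
have nE0 (P : 'rV[R]_d -> Prop) : (\forall v \near (0 : 'rV[R]_d), P v) ->
    \forall v \near (0 : 'rV[R]_d), P (E0 v).
  by move=> nP; apply: (near_comp (sm_cts sE0)); rewrite E00.
have [sq' q0 dq] := hq.
have nq (P : 'rV[R]_d -> Prop) : (\forall v \near (0 : 'rV[R]_d), P v) ->
    \forall v \near (0 : 'rV[R]_d), P (q v).
  by move=> nP; apply: (near_comp (sm_cts sq')); rewrite q0.
have n1 := near_kap qs; have n2 := near_kap cL; have n3 := near_kap EL.
(* On [W] the chart is invertible, [q] undoes squaring, the Koenigs sequence converges and [E0]
   inverts [L]. *)
have [W [oW W1 WP]] := near_open (filterI (filterI kapK_near n1) (filterI n2 n3)).
exists (fun g => L (kap g)), E, W; split.
- by [].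
- move=> v; have h := @mderiv_comp _ _ _ _ _ _ _ E0 kapi 0 v (msm_rV sE0).
  rewrite E00 in h; rewrite (h msm_kapi) dkapi.
  exact: (diff_inv_eq L0 (dL v) (sm_diff sL) (sm_diff sE0) EL).
- split; last by apply: open_nbhs_nbhs.
  by apply: filterS2 LE (nE0 _ kapiK_near) => v e1' e2; rewrite /E e2.
- split=> [g /WP [[h1 _] [_ h2]]|u Wu u2]; first by rewrite /E h2.
  (* A square root that lies in [W] is the one given by [q], so the whole sequence is determined by
     its first term and is the orbit defining [L]. *)
  have qu n : q (kap (u n)) = kap (u n.+1).
    have [[h1 h2] _] := WP _ (Wu n.+1).
    by rewrite -[RHS]h2 /sqk h1 u2.
  have [_ [h _]] := WP _ (Wu 0%N).
  suff itq n : iter n q (kap (u 0%N)) = kap (u n).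
    by under eq_fun do rewrite -itq.
  by elim: n => //= n ->.
(* Without its first term, the sequence for [v] is twice the sequence for [q v]. Transported by
   [E0], halving a vector is therefore taking a square root. *)
- have Lq : \forall v \near (0 : 'rV[R]_d), L (q v) = (1/2 : R) *: L v.
    apply: filterS2 cL (nq _ cL) => v c c'.
    have c2 : (fun n => (2 ^+ n.+1 : R) *: iter n.+1 q v) @ \oo --> L v.
      by rewrite -(cvg_shiftS (fun n => (2 ^+ n : R) *: iter n q v)) in c.
    have c3 := clin_cvg (@clin_scaler R 'rV[R]_d (1/2)) c2.
    apply: (@cvg_unique _ (@norm_hausdorff R 'rV[R]_d) _ _ _ _ c').
    apply: cvg_trans c3; apply: near_eq_cvg; apply: nearW => n.
    rewrite iterSr scalerA; congr (_ *: _).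
    by rewrite exprS; field.
  have nEq := nE0 _ (nq _ EL).
  have nLE := nE0 _ Lq.
  have nsq := nE0 _ sq.
  have kk := nE0 _ (nq _ kapiK_near).
  have s3 : msm (fun v => (kapi v * kapi v)%g) 0 by apply: msm_mulg; exact: msm_kapi.
  have s4 : \forall u \near (0 : 'rV[R]_d),
      kapi (kap (kapi u * kapi u)%g) = (kapi u * kapi u)%g.
    have n0 : \forall g \near (kapi 0 * kapi 0)%g, kapi (kap g) = g.
      by rewrite kapi0 mulg1; exact: kapK_near.
    exact: (near_comp (msm_cts s3) n0).
  have c1' := nE0 _ (nq _ s4).
  have N1 : \forall v \near (0 : 'rV[R]_d), L (E0 v) = v /\ E0 (L (q (E0 v))) = q (E0 v).
    by apply: filterS2 LE nEq => v.
  have N2 : \forall v \near (0 : 'rV[R]_d),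
      L (q (E0 v)) = (1/2 : R) *: L (E0 v) /\ sqk (q (E0 v)) = E0 v.
    by apply: filterS2 nLE nsq => v.
  apply: filterS3 N1 N2 c1' => v [h1 h2] [h3 h4] h5.
  have e : E0 ((1/2 : R) *: v) = q (E0 v) by rewrite -[in LHS]h1 -h3 h2.
  by rewrite /E e -h5 -/(sqk _) h4.
Qed.

End LogExp.

Lemma msm_ext (R : realType) (E F : normedModType R) (M : smoothSpaceType E)
  (N : smoothSpaceType F) (f g : M -> N) p : f =1 g -> msm f p -> msm g p.
Proof. by move=> /funext ->. Qed.

Section Curves.
Variable R : realType.

Lemma msm_line n (w : 'rV[R]_n) (t : R^o) : msm (fun t : R^o => t *: w) t.
Proof. by apply: msm_curve_rV; exact: sm_lin (clin_scalel w). Qed.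

Lemma velocity_line n (w : 'rV[R]_n) : velocity (fun t : R^o => t *: w) 0 = w.
Proof.
apply: etrans (scale1r w).
exact: (congr1 (fun g : R^o -> 'rV[R]_n => g (1 : R^o)) (diff_clin (0 : R^o) (clin_scalel w))).
Qed.

Section VelocityLine.
Variables (n : nat) (E : normedModType R) (M : smoothSpaceType E).

Lemma msm_comp_line (f : 'rV[R]_n -> M) w (t : R^o) : msm f (t *: w) ->
  msm (fun t : R^o => f (t *: w)) t.
Proof. by move=> sf; exact: (msm_comp (msm_line w t) sf). Qed.

Lemma velocity_comp_line (f : 'rV[R]_n -> M) w : msm f 0 ->
  velocity (fun t : R^o => f (t *: w)) 0 = mderiv f 0 w.
Proof.
move=> sf; have e : (0 : R^o) *: w = 0 by rewrite scale0r.
by rewrite (velocity_comp (msm_line w 0) e sf) velocity_line.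
Qed.

End VelocityLine.

Lemma pow2_neq0 n : (2 ^+ n : R) != 0.
Proof. by rewrite expf_neq0 // pnatr_eq0. Qed.

Lemma half_pow (t : R) n : t / 2 ^+ n.+1 = 1/2 * (t / 2 ^+ n).
Proof. by rewrite exprS invfM; field; exact: pow2_neq0. Qed.

Lemma div_pow2 (x : R) n : x / 2 ^+ n = x * (1/2) ^+ n.
Proof. by rewrite -exprVn; congr (_ * _ ^+ _); field. Qed.

Lemma dyadic_cvg n (f : R^o -> 'rV[R]_n) (t : R) : sm f 0 -> f 0 = 0 ->
  (fun k => (2 ^+ k : R) *: f (t / 2 ^+ k)) @ \oo --> (t *: 'd f 0 (1 : R^o) : 'rV[R]_n).
Proof.
move=> sf f0; apply/cvgrPdist_le => e e0.
have t1 : 0 < `|t| + 1 by rewrite ltr_wpDl.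
have e1 : 0 < e / (`|t| + 1) by rewrite divr_gt0.
have [r r0 rP] := sm_strict sf e1.
have [N NP] := @geo_small R `|t| (1/2) (r/2) ltac:(lra) ltac:(lra) ltac:(by rewrite divr_gt0).
exists N => // k /= Nk.
have p2 : 0 < (2 ^+ k : R) by rewrite exprn_gt0.
pose s : R^o := t / 2 ^+ k.
have ns : `|s| = `|t| * (1/2) ^+ k.
  rewrite /s div_pow2 normrM; congr (_ * _); rewrite ger0_norm // exprn_ge0 //; lra.
have sr : ball (0 : R^o) r s.
  apply/ball0P; rewrite ns; apply: (@le_lt_trans _ _ (r/2)); last by lra.
  apply: le_trans NP; rewrite ler_wpM2l // ler_wiXn2l //; lra.
have := rP _ _ sr (ballxx _ r0); rewrite f0 !subr0 => h.
have ds : 'd f 0 s = s *: 'd f 0 (1 : R^o).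
  rewrite -(clinZ s (1 : R^o) (clin_diff (sm_diff sf))); congr ('d f 0 _).
  by rewrite [RHS]mulr1.
rewrite ds in h.
have -> : t *: 'd f 0 (1 : R^o) - (2 ^+ k : R) *: f (t / 2 ^+ k) =
   - ((2 ^+ k : R) *: (f s - s *: 'd f 0 (1 : R^o))).
  rewrite scalerBr opprB scalerA; congr (_ *: _ - _).
  by rewrite /s mulrC divfK // pow2_neq0.
rewrite normrN normrZ gtr0_norm // mulrC -ler_pdivlMr //.
apply: (le_trans h).
have -> : `|s| = `|t| / 2 ^+ k by rewrite ns div_pow2.
rewrite mulrA ler_wpM2r ?invr_ge0 ?(ltW p2) //.
by rewrite mulrAC ler_pdivrMr // ler_wpM2l ?(ltW e0) // lerDl.
Qed.

End Curves.

(** * From the local logarithm to one-parameter subgroups *)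

Section GlobalExp.
Variables (R : realType) (d : nat) (G : lieGroupType 'rV[R]_d).
Implicit Types (g h a : G) (v w x y xi : 'rV[R]_d).

Variables (l : G -> 'rV[R]_d) (E : 'rV[R]_d -> G) (W : G -> Prop).
Hypothesis sE0 : msm E 0.
Hypothesis E0 : E 0 = 1%g.
Hypothesis dE : forall v, mderiv E 0 v = v.
Hypothesis lE : \forall v \near (0 : 'rV[R]_d), l (E v) = v.
Hypothesis W1 : \forall g \near (1%g : G), W g.
Hypothesis El : forall g, W g -> E (l g) = g.
Hypothesis lW : forall u : nat -> G, (forall n, W (u n)) ->
  (forall n, (u n.+1 * u n.+1)%g = u n) ->
  (fun n => (2 ^+ n : R) *: kap (u n)) @ \oo --> l (u 0%N).
Hypothesis Esq :
  \forall v \near (0 : 'rV[R]_d), (E ((1/2 : R) *: v) * E ((1/2 : R) *: v))%g = E v.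

(** The points [phi (t / 2 ^+ n)] are successive square roots, so the limit that defines [l (phi t)]
    is a limit of difference quotients of [phi] at 0. Every later identity between group elements
    near 1 is an instance of this one, used with a suitable path. *)
Lemma path_log (phi : R^o -> G) xi (t : R) : msm phi 0 -> phi 0 = 1%g ->
  velocity phi 0 = xi -> (forall n, W (phi (t / 2 ^+ n))) ->
  (forall n, (phi (t / 2 ^+ n.+1)%R * phi (t / 2 ^+ n.+1)%R)%g = phi (t / 2 ^+ n)) ->
  l (phi t) = t *: xi.
Proof.
move=> sp p0 vp Wp sqp.
have c := lW Wp sqp; rewrite expr0 divr1 in c.
have sk : msm (@kap R d G) (phi 0) by rewrite p0; exact: msm_kap.
have sf : sm (fun t => kap (phi t)) 0 by have [_] := msm_comp sp sk.
have f0 : kap (phi 0) = 0 by rewrite p0 kap1.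
have c2 := dyadic_cvg (t := t) sf f0.
have e : 'd (fun t => kap (phi t)) 0 (1 : R^o) = xi.
  have := velocity_comp sp p0 (@msm_kap R d G); rewrite vp dkap => <-.
  by [].
rewrite e in c2.
exact: (@cvg_unique _ (@norm_hausdorff R 'rV[R]_d) _ _ _ _ c c2).
Qed.

Lemma small_radius : exists2 r : R, 0 < r & forall v, `|v| < r ->
  [/\ l (E v) = v, W (E v), msm E v &
      (E ((1/2 : R) *: v) * E ((1/2 : R) *: v))%g = E v].
Proof.
have nW : \forall v \near (0 : 'rV[R]_d), W (E v).
  have W0 : \forall g \near E 0, W g by rewrite E0.
  exact: near_comp (msm_cts sE0) W0.
have N1 : \forall v \near (0 : 'rV[R]_d), l (E v) = v /\ W (E v).
  by apply: filterS2 lE nW => v.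
have N2 : \forall v \near (0 : 'rV[R]_d), msm E v /\
    (E ((1/2 : R) *: v) * E ((1/2 : R) *: v))%g = E v.
  by apply: filterS2 (msm_near sE0) Esq => v.
have [r1 r10 P1] := near_ball_ex N1; have [r2 r20 P2] := near_ball_ex N2.
exists (Num.min r1 r2); first by rewrite lt_min r10.
move=> v; rewrite lt_min => /andP[/ball0P v1 /ball0P v2].
by have [? ?] := P1 v v1; have [? ?] := P2 v v2.
Qed.

Lemma small_radius2 : exists2 r : R, 0 < r & forall x y, `|x| < r -> `|y| < r ->
  W (E x * E y * (E x)^-1)%g /\ W (E x * E y)%g.
Proof.
have s1 : msm (fun p : 'rV[R]_d * 'rV[R]_d => E p.1) (0, 0).
  by apply: (msm_comp (msm_fst _)).
have s2 : msm (fun p : 'rV[R]_d * 'rV[R]_d => E p.2) (0, 0).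
  by apply: (msm_comp (msm_snd _)).
have s3 := msm_mulg s1 s2.
have s4 := msm_mulg s3 (msm_invg s1).
have n3 : \forall p \near ((0 : 'rV[R]_d), (0 : 'rV[R]_d)), W (E p.1 * E p.2)%g.
  have W0 : \forall g \near (E 0 * E 0)%g, W g by rewrite E0 mulg1.
  exact: near_comp (msm_cts s3) W0.
have n4 : \forall p \near ((0 : 'rV[R]_d), (0 : 'rV[R]_d)), W (E p.1 * E p.2 * (E p.1)^-1)%g.
  have W0 : \forall g \near (E 0 * E 0 * (E 0)^-1)%g, W g by rewrite E0 mulg1 mulgV.
  exact: near_comp (msm_cts s4) W0.
have [r1 r10 P1] := near_ball_ex n3; have [r2 r20 P2] := near_ball_ex n4.
exists (Num.min r1 r2); first by rewrite lt_min r10.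
move=> x y; rewrite !lt_min => /andP[x1 x2] /andP[y1 y2]; split.
  by apply: (P2 (x, y)); apply/ball0P; exact: pair_norm_lt.
by apply: (P1 (x, y)); apply/ball0P; exact: pair_norm_lt.
Qed.

Variable r : R.
Hypothesis r0 : 0 < r.
Hypothesis rP : forall v, `|v| < r ->
  [/\ l (E v) = v, W (E v), msm E v &
      (E ((1/2 : R) *: v) * E ((1/2 : R) *: v))%g = E v].
Hypothesis rP2 : forall x y, `|x| < r -> `|y| < r ->
  W (E x * E y * (E x)^-1)%g /\ W (E x * E y)%g.

Let pow01 n : 0 <= (1 / 2 ^+ n : R) <= 1.
Proof.
rewrite div1r invr_ge0 exprn_ge0 //= invf_le1 ?exprn_gt0 //.
by rewrite exprn_ege1 // ler1n.
Qed.

Let scale_lt (s : R) v : 0 <= s <= 1 -> `|v| < r -> `|s *: v| < r.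
Proof.
move=> /andP[s0 s1] vr; rewrite normrZ ger0_norm //.
by rewrite (le_lt_trans _ vr) // ler_piMl.
Qed.

Let E_half (t : R) n v : `|(t / 2 ^+ n) *: v| < r ->
  (E ((t / 2 ^+ n.+1)%R *: v) * E ((t / 2 ^+ n.+1)%R *: v))%g = E ((t / 2 ^+ n) *: v).
Proof. by move=> h; rewrite half_pow -(scalerA (1/2)); have [_ _ _] := rP h. Qed.

(** Conjugation preserves square roots, so [path_log] applies to the conjugate of the path t |->
    [E (t *: v)], whose velocity is [Ad a v]. *)
Lemma conj_local a v : `|v| < r ->
  (forall s : R, 0 <= s <= 1 -> W (a * E (s *: v) * a^-1)%g) ->
  l (a * E v * a^-1)%g = Ad a v.
Proof.
move=> vr Wa; pose phi (t : R^o) := (a * E (t *: v) * a^-1)%g.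
have sEv : msm (fun t : R^o => E (t *: v)) 0 by apply: msm_comp_line; rewrite scale0r.
have sphi : msm phi 0 by exact: msm_conjg.
have phi0 : phi 0 = 1%g by rewrite /phi scale0r E0 mulg1 mulgV.
have sc : msm (fun g : G => (a * g * a^-1)%g) 1%g by apply: msm_conjg; exact: msm_id.
have vphi : velocity phi 0 = Ad a v.
  have e0 : E ((0 : R^o) *: v) = 1%g by rewrite scale0r.
  by rewrite (velocity_comp sEv e0 sc) velocity_comp_line // dE.
have := @path_log phi (Ad a v) 1 sphi phi0 vphi.
rewrite scale1r /phi scale1r => -> //.
  by move=> n; exact: Wa.
move=> n; rewrite -(E_half (t := 1) (n := n)); last exact: scale_lt.
by rewrite !mulgA mulgVK.
Qed.

Lemma Ad_clin a : clin (Ad a).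
Proof. by apply: clin_mderiv; apply: msm_conjg; exact: msm_id. Qed.

(* [a = E (s xi)] commutes with itself, so [Ad a] fixes [xi]. *)
Lemma E_commute (s t : R) xi : `|s *: xi| < r -> `|t *: xi| < r ->
  (E (s *: xi) * E (t *: xi))%g = (E (t *: xi) * E (s *: xi))%g.
Proof.
move=> sr tr; have [->|sn0] := eqVneq s 0.
  by rewrite scale0r E0 mul1g mulg1.
set a := E (s *: xi).
have W' v : `|v| < r -> forall u : R, 0 <= u <= 1 -> W (a * E (u *: v) * a^-1)%g.
  by move=> vr u u01; exact: (rP2 sr (scale_lt u01 vr)).1.
have h1 := conj_local sr (W' _ sr).
have h2 := conj_local tr (W' _ tr).
have e1 : Ad a xi = xi.
  have := h1; rewrite -/a mulgK; have [-> _ _ _] := rP sr.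
  by rewrite (clinZ _ _ (Ad_clin a)) => /(scalerI sn0).
have := El (rP2 sr tr).1; rewrite -/a h2 (clinZ _ _ (Ad_clin a)) e1 => e2.
by apply: (@mulIg G (a^-1)%g); rewrite -e2 mulgK.
Qed.

(** [path_log] for the product path u |-> [E (u *: (s *: xi)) * E (u *: (t *: xi))]. The square of a
    point of this path is again on it because the two factors commute. *)
Lemma E_add (s t : R) xi : `|s *: xi| < r -> `|t *: xi| < r ->
  (E (s *: xi) * E (t *: xi))%g = E ((s + t) *: xi).
Proof.
move=> sr tr; pose phi (u : R^o) := (E (u *: (s *: xi)) * E (u *: (t *: xi)))%g.
have sEv v : msm (fun t : R^o => E (t *: v)) 0 by apply: msm_comp_line; rewrite scale0r.
have sphi : msm phi 0 by exact: msm_mulg.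
have E00 v : E ((0 : R^o) *: v) = 1%g by rewrite scale0r.
have phi0 : phi 0 = 1%g by rewrite /phi !E00 mulg1.
have vphi : velocity phi 0 = (s + t) *: xi.
  have := mderiv_mul1 (1 : R^o) (sEv (s *: xi)) (sEv (t *: xi)) (E00 _) (E00 _).
  have := velocity_comp_line (s *: xi) sE0; rewrite /velocity => ->.
  have := velocity_comp_line (t *: xi) sE0; rewrite /velocity => ->.
  by rewrite !dE -scalerDl.
have := @path_log phi _ 1 sphi phi0 vphi.
have phi1 : phi 1 = (E (s *: xi) * E (t *: xi))%g by rewrite /phi !scale1r.
rewrite scale1r phi1 => h.
have [_ wl] := rP2 sr tr.
rewrite -(El wl) h //.
  by move=> n; apply: (rP2 _ _).2; exact: scale_lt.
move=> n; rewrite /phi.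
have e1 := E_half (scale_lt (pow01 n) sr).
have e2 := E_half (scale_lt (pow01 n) tr).
rewrite -e1 -e2; set x := E _; set y := E _.
have c : (x * y)%g = (y * x)%g.
  rewrite /x /y !scalerA; apply: E_commute; rewrite -scalerA; exact: scale_lt.
by rewrite -!mulgA; congr (_ * _)%g; rewrite !mulgA c.
Qed.

Definition sqg g : G := (g * g)%g.

Lemma iter_sqg_mul n g h : (g * h)%g = (h * g)%g ->
  iter n sqg (g * h)%g = (iter n sqg g * iter n sqg h)%g /\
  (iter n sqg g * iter n sqg h)%g = (iter n sqg h * iter n sqg g)%g.
Proof.
move=> c; elim: n => [|n [IH1 IH2]] //=.
rewrite IH1 /sqg; set x := iter _ _ g in IH2 *; set y := iter _ _ h in IH2 *.
split; first by rewrite -!mulgA; congr (_ * _)%g; rewrite !mulgA IH2.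
have yxx : commute y (x * x)%g by apply: commuteM; exact: esym IH2.
by apply: commuteM; exact: esym yxx.
Qed.

(* The choice of [n] does not matter, and the default value of [xget] is never
   used. *)
Definition eG v : G :=
  let n := xget 0%N [set n | `|(2 ^+ n)^-1 *: v| < r] in
  iter n sqg (E ((2 ^+ n)^-1 *: v)).

Lemma pow_small (M : R) : exists n, (2 ^+ n)^-1 * M < r.
Proof.
have q0 : 0 <= (1/2 : R) by lra.
have q1 : (1/2 : R) < 1 by lra.
have r2 : 0 < r / 2 by rewrite divr_gt0.
have [n nP] := geo_small M q0 q1 r2.
exists n; rewrite mulrC div_pow2; apply: (le_lt_trans nP).
by move: r0; lra.
Qed.

Lemma pow_small_scale n k v : `|(2 ^+ n)^-1 *: v| < r -> `|(2 ^+ (n + k)%N)^-1 *: v| < r.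
Proof.
move=> h; rewrite exprD invfM mulrC -scalerA; apply: scale_lt => //.
by rewrite -div1r; exact: pow01.
Qed.

Lemma eG_shift n k v : `|(2 ^+ n)^-1 *: v| < r ->
  iter (n + k) sqg (E ((2 ^+ (n + k)%N)^-1 *: v)) = iter n sqg (E ((2 ^+ n)^-1 *: v)).
Proof.
move=> h; elim: k => [|k IH]; first by rewrite addn0.
rewrite addnS iterSr -IH; congr (iter _ _ _).
have := @E_half 1 (n + k)%N v; rewrite !div1r => H.
by rewrite /sqg H //; exact: pow_small_scale.
Qed.

Lemma eGE n v : `|(2 ^+ n)^-1 *: v| < r -> eG v = iter n sqg (E ((2 ^+ n)^-1 *: v)).
Proof.
move=> h; rewrite /eG; set m := xget _ _.
have hm : `|(2 ^+ m)^-1 *: v| < r by rewrite /m; case: xgetP => [//|/(_ n)].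
have [h1|/ltnW h1] := leqP n m; first by rewrite -(subnKC h1) eG_shift.
by rewrite -(subnKC h1) eG_shift.
Qed.

Lemma eG_small v : `|v| < r -> eG v = E v.
Proof. by move=> vr; rewrite (@eGE 0%N) /= expr0 invr1 scale1r. Qed.

Lemma eG_add (s t : R) xi : eG ((s + t) *: xi) = (eG (s *: xi) * eG (t *: xi))%g.
Proof.
have [n nP] := pow_small (`|s *: xi| + `|t *: xi|).
have p0 : 0 <= (2 ^+ n : R)^-1 by rewrite invr_ge0 exprn_ge0.
have ns : `|(2 ^+ n : R)^-1 *: (s *: xi)| < r.
  rewrite normrZ ger0_norm // (le_lt_trans _ nP) // ler_wpM2l // lerDl //.
have nt : `|(2 ^+ n : R)^-1 *: (t *: xi)| < r.
  rewrite normrZ ger0_norm // (le_lt_trans _ nP) // ler_wpM2l // lerDr //.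
have nst : `|(2 ^+ n : R)^-1 *: ((s + t) *: xi)| < r.
  rewrite normrZ ger0_norm // (le_lt_trans _ nP) // ler_wpM2l // scalerDl.
  exact: ler_normD.
rewrite (eGE ns) (eGE nt) (eGE nst); move: ns nt; rewrite !scalerA => ns nt.
rewrite mulrDr -E_add //.
by have [] := iter_sqg_mul n (E_commute ns nt).
Qed.

Lemma eG0 : eG 0 = 1%g.
Proof. by rewrite eG_small ?normr0. Qed.

Lemma msm_eG0 : msm eG 0.
Proof.
apply: msm_eq sE0; have : \forall v \near (0 : 'rV[R]_d), ball (0 : 'rV[R]_d) r v.
  exact: nbhsx_ballx.
by apply: filterS => v /ball0P vr; rewrite eG_small.
Qed.

Lemma dE_eG v : mderiv eG 0 v = v.
Proof.
rewrite -[RHS]dE; apply/esym; apply: mderiv_eq => //.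
have : \forall v \near (0 : 'rV[R]_d), ball (0 : 'rV[R]_d) r v.
  exact: nbhsx_ballx.
by apply: filterS => u /ball0P ur; rewrite eG_small.
Qed.

Lemma eG_one_parameter xi : one_parameter_subgroup xi (fun t : R^o => eG (t *: xi)).
Proof.
split.
- apply: msm_smooth_on => t0 _.
  (* Near [t0] the curve is a left translate of its germ at 0, where smoothness is known. *)
  apply: (@msm_ext _ _ _ _ _ (fun t : R^o => (eG (t0 *: xi) * eG ((t - t0)%R *: xi))%g)).
    by move=> t; rewrite -eG_add addrC subrK.
  apply: msm_mulg; first exact: msm_cst.
  have s1 : msm (fun t : R^o => (t - t0) *: xi) t0.
    apply: msm_curve_rV; apply: sm_scale; last exact: sm_cst.
    by apply: sm_add; [exact: sm_id|exact: sm_cst].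
  apply: (msm_comp s1).
  have -> : (t0 - t0) *: xi = 0 by rewrite subrr scale0r.
  exact: msm_eG0.
- by move=> s t; rewrite eG_add.
- by rewrite velocity_comp_line ?dE_eG //; exact: msm_eG0.
Qed.

(** For small parameters [path_log] applies to the subgroup itself; a general [t] is halved until it
    is small, and the result is squared back. *)
Lemma one_parameter_unique xi (gam : R^o -> G) (t : R) :
  one_parameter_subgroup xi gam -> gam t = eG (t *: xi).
Proof.
move=> [sg gD vg].
have sg0 : msm gam 0 by apply: (smooth_on_msm sg); exact: filterT.
have g0 : gam 0 = 1%g.
  by apply: (@mulgI G (gam 0)); rewrite -gD addr0 mulg1.
have nW : \forall s \near (0 : R^o), W (gam s).
  have W0 : \forall g \near gam 0, W g by rewrite g0.
  exact: near_comp (msm_cts sg0) W0.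
have [e e0 eP] := (near0_ball _).1 nW.
have hk (s : R) : gam (s / 2 ^+ 0) = gam s by rewrite expr0 divr1.
have sq (s : R) n : (gam (s / 2 ^+ n.+1)%R * gam (s / 2 ^+ n.+1)%R)%g = gam (s / 2 ^+ n).
  rewrite -gD half_pow; congr gam.
  by rewrite -mulrDl; have -> : 1/2 + 1/2 = 1 :> R by [lra]; rewrite mul1r.
have small (s : R) : `|s| < e -> `|s *: xi| < r -> gam s = E (s *: xi).
  move=> se sr; have Wn n : W (gam (s / 2 ^+ n)).
    apply: eP; have /andP[q0 q1] := pow01 n.
    have -> : s / 2 ^+ n = (1 / 2 ^+ n) * s by rewrite div1r mulrC.
    by rewrite normrM (ger0_norm q0) (le_lt_trans _ se) // ler_piMl.
  rewrite -(path_log sg0 g0 vg Wn (sq s)) El //.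
  by have := Wn 0%N; rewrite hk.
have it n : gam t = iter n sqg (gam (t / 2 ^+ n)).
  elim: n => [|n IH]; first by rewrite hk.
  by rewrite iterSr /sqg sq.
have r'0 : 0 < Num.min e r by rewrite lt_min e0.
have q0 : 0 <= (1/2 : R) by lra.
have q1 : (1/2 : R) < 1 by lra.
have r2 : 0 < Num.min e r / 2 by rewrite divr_gt0.
have [n nP] := geo_small (`|t| + `|t *: xi|) q0 q1 r2.
have p0 : 0 <= (1/2 : R) ^+ n by rewrite exprn_ge0 //; lra.
have lt1 : (`|t| + `|t *: xi|) * (1/2) ^+ n < Num.min e r.
  by apply: (le_lt_trans nP); lra.
move: lt1; rewrite lt_min => /andP[le lr].
have te : `|t / 2 ^+ n| < e.
  by rewrite div_pow2 normrM (ger0_norm p0) (le_lt_trans _ le) // ler_wpM2r // lerDl.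
have tr : `|(t / 2 ^+ n) *: xi| < r.
  rewrite div_pow2 mulrC -scalerA normrZ (ger0_norm p0) mulrC.
  by rewrite (le_lt_trans _ lr) // ler_wpM2r // lerDr.
rewrite (it n) (small _ te tr) (@eGE n) scalerA [_^-1 * t]mulrC //.
Qed.

Lemma Lie_exp_eG xi : Lie_exp G xi = eG xi.
Proof.
rewrite /Lie_exp; case: xgetP => [gam _ op|/(_ _ (eG_one_parameter xi))//].
by rewrite (one_parameter_unique 1 op) scale1r.
Qed.

End GlobalExp.

(** * Exponential map and adjoint action *)

Section LieExp.
Variables (R : realType) (d : nat) (G : lieGroupType 'rV[R]_d).
Implicit Types (g h a : G) (v w xi : 'rV[R]_d).

Lemma Lie_exp_facts :
  [/\ forall s t xi, Lie_exp G ((s + t) *: xi) = (Lie_exp G (s *: xi) * Lie_exp G (t *: xi))%g,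
     msm (Lie_exp G) 0, Lie_exp G 0 = 1%g, forall v, mderiv (Lie_exp G) 0 v = v &
     forall xi, one_parameter_subgroup xi (fun t : R^o => Lie_exp G (t *: xi)) /\
       forall gam, one_parameter_subgroup xi gam -> forall t, gam t = Lie_exp G (t *: xi)].
Proof.
have [l [E [W [[sE0 E0] dE [lE W1] [El lW] Esq]]]] := log_exists G.
have [r1 r10 P1] := small_radius sE0 E0 lE W1 Esq.
have [r2 r20 P2] := small_radius2 sE0 E0 W1.
pose r := Num.min r1 r2.
have r0 : 0 < r by rewrite lt_min r10.
have rP v : `|v| < r -> [/\ l (E v) = v, W (E v), msm E v &
      (E ((1/2 : R) *: v) * E ((1/2 : R) *: v))%g = E v].
  by rewrite lt_min => /andP[/P1].
have rP2 x y : `|x| < r -> `|y| < r ->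
    W (E x * E y * (E x)^-1)%g /\ W (E x * E y)%g.
  by rewrite !lt_min => /andP[_ x2] /andP[_ y2]; exact: P2.
have eE xi : Lie_exp G xi = eG E r xi by exact: (@Lie_exp_eG _ _ _ l E W).
split.
- by move=> s t xi; rewrite !eE; exact: (@eG_add _ _ _ l E W).
- have -> : Lie_exp G = eG E r by apply/funext.
  exact: (msm_eG0 sE0 r0 rP).
- by rewrite eE; apply: (eG0 _ r0 rP).
- move=> v; have -> : Lie_exp G = eG E r by apply/funext.
  exact: (dE_eG sE0 dE r0 rP v).
- move=> xi; have -> : (fun t : R^o => Lie_exp G (t *: xi)) = (fun t => eG E r (t *: xi)).
    by apply/funext => t.
  split; first exact: (@eG_one_parameter _ _ _ l E W).
  by move=> gam og t; rewrite eE; exact: (@one_parameter_unique _ _ _ l E W).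
Qed.

Lemma exp_add s t xi :
  Lie_exp G ((s + t) *: xi) = (Lie_exp G (s *: xi) * Lie_exp G (t *: xi))%g.
Proof. by have [] := Lie_exp_facts. Qed.

Lemma exp0 : Lie_exp G 0 = 1%g. Proof. by have [] := Lie_exp_facts. Qed.

Lemma msm_exp0 : msm (Lie_exp G) 0. Proof. by have [] := Lie_exp_facts. Qed.

Lemma dexp v : mderiv (Lie_exp G) 0 v = v. Proof. by have [] := Lie_exp_facts. Qed.

Lemma expN xi : Lie_exp G (- xi) = (Lie_exp G xi)^-1%g.
Proof.
apply: (@mulgI G (Lie_exp G xi)); rewrite mulgV -exp0.
rewrite -{1}[xi]scale1r -scaleN1r -exp_add.
by rewrite subrr scale0r.
Qed.

Lemma msm_exp_line xi (t : R^o) : msm (fun t : R^o => Lie_exp G (t *: xi)) t.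
Proof.
have [_ _ _ _ /(_ xi) [[s _ _] _]] := Lie_exp_facts.
by apply: (smooth_on_msm s); exact: filterT.
Qed.

Lemma velocity_exp_line xi : velocity (fun t : R^o => Lie_exp G (t *: xi)) 0 = xi.
Proof. by have [_ _ _ _ /(_ xi) [[]]] := Lie_exp_facts. Qed.

(** By uniqueness: conjugating a one-parameter subgroup gives the one of velocity [Ad a xi]. *)
Lemma exp_conj a xi : (a * Lie_exp G xi * a^-1)%g = Lie_exp G (Ad a xi).
Proof.
have [_ _ _ _ /(_ (Ad a xi)) [_ U]] := Lie_exp_facts.
have := U (fun t : R^o => (a * Lie_exp G (t *: xi) * a^-1)%g) _ 1.
rewrite !scale1r; apply; split.
- by apply: msm_smooth_on => t _; apply: msm_conjg; exact: msm_exp_line.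
- by move=> s t; rewrite exp_add !mulgA mulgVK.
- have sc : msm (fun g : G => (a * g * a^-1)%g) 1%g by apply: msm_conjg; exact: msm_id.
  have e0 : Lie_exp G ((0 : R^o) *: xi) = 1%g by rewrite scale0r exp0.
  by rewrite (velocity_comp (msm_exp_line xi 0) e0 sc) velocity_exp_line.
Qed.

Lemma AdM a b xi : Ad (a * b)%g xi = Ad a (Ad b xi).
Proof.
have sc c : msm (fun g : G => (c * g * c^-1)%g) 1%g by apply: msm_conjg; exact: msm_id.
have e : (b * 1 * b^-1)%g = 1%g :> G by rewrite mulg1 mulgV.
have sa : msm (fun g : G => (a * g * a^-1)%g) (b * 1 * b^-1)%g.
  by apply: msm_conjg; exact: msm_id.
have ef : (fun g : G => (a * b * g * (a * b)^-1)%g) = (fun g => (a * (b * g * b^-1) * a^-1)%g).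
  by apply/funext => g; rewrite invgM !mulgA.
apply: etrans (congr1 (fun f => mderiv f 1%g xi) ef) _.
apply: etrans (mderiv_comp xi (sc b) sa) _.
exact: (congr1 (fun q => mderiv (fun g : G => (a * g * a^-1)%g) q (Ad b xi)) e).
Qed.

Lemma Ad1 xi : Ad (1%g : G) xi = xi.
Proof.
apply: etrans (mderiv_id (1%g : G) xi).
apply: (congr1 (fun f => mderiv f (1%g : G) xi)).
by apply/funext => g; rewrite invg1 mulg1 mul1g.
Qed.

Lemma AdK a xi : Ad (a^-1)%g (Ad a xi) = xi.
Proof. by rewrite -AdM mulVg Ad1. Qed.

Lemma AdVK a xi : Ad a (Ad (a^-1)%g xi) = xi.
Proof. by rewrite -AdM mulgV Ad1. Qed.

(** [Ad (a t)] is the derivative at 1 of a conjugation with [a t] as parameter, hence an instance of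
    [msm_mderiv] once the target is flattened by the chart at 1. *)
Lemma msm_Ad (E : normedModType R) (P : smoothSpaceType E) {fE : findim E}
    (a : P -> G) (xi : P -> 'rV[R]_d) s :
  msm a s -> msm xi s -> msm (fun t => Ad (a t) (xi t)) s.
Proof.
move=> sa sxi; pose c := chart_at (1%g : G).
pose f (p : G * G) : 'rV[R]_d := cmap c (p.2 * p.1 * p.2^-1)%g.
have sf : msm f (1%g, a s).
  have s1 : msm (fun p : G * G => p.1) (1%g, a s) by exact: msm_fst.
  have s2 : msm (fun p : G * G => p.2) (1%g, a s) by exact: msm_snd.
  have s3 := msm_mulg (msm_mulg s2 s1) (msm_invg s2).
  apply: (msm_comp s3); rewrite /= mulg1 mulgV.
  by apply: msm_cmap; [exact: chart_at_compat|exact: chart_at_dom].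
have sV : msm (fun t => mderiv (cmap (chart_at (1%g : G))) 1%g (xi t)) s.
  by apply: (msm_ext _ sxi) => t; rewrite dcmap_at.
have h : msm (fun t => mderiv (fun y' => f (y', a t)) 1%g (xi t)) s.
  exact: (msm_mderiv (y := fun _ : P => 1%g) sf (msm_cst _ _) sa sV).
apply: (msm_ext _ h) => t.
have sc : msm (fun g : G => (a t * g * (a t)^-1)%g) 1%g by apply: msm_conjg; exact: msm_id.
have e : (a t * 1 * (a t)^-1)%g = 1%g by rewrite mulg1 mulgV.
have sk : msm (cmap c) (a t * 1 * (a t)^-1)%g.
  by rewrite e; apply: msm_cmap; [exact: chart_at_compat|exact: chart_at_dom].
apply: etrans (mderiv_comp _ sc sk) _.
apply: etrans (congr1 (fun q => mderiv (cmap c) q (Ad (a t) (xi t))) e) _.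
exact: dcmap_at.
Qed.

End LieExp.

(** * Smooth and proper actions *)

Section Action.
Variables (R : realType) (d n : nat).
Variables (G : lieGroupType 'rV[R]_d) (M : manifoldType 'rV[R]_n).
Variable act : G -> M -> M.
Hypothesis act_smooth : smooth_action act.
Implicit Types (g h a : G) (p q x y z : M) (xi : 'rV[R]_d).

Lemma act1 p : act 1%g p = p. Proof. by have [] := act_smooth. Qed.

Lemma actM g h p : act (g * h)%g p = act g (act h p).
Proof. by have [] := act_smooth. Qed.

Lemma actK g p : act (g^-1)%g (act g p) = p.
Proof. by rewrite -actM mulVg act1. Qed.

Lemma actVK g p : act g (act (g^-1)%g p) = p.
Proof. by rewrite -actM mulgV act1. Qed.

Lemma msm_act0 (q : G * M) : msm (fun gp : G * M => act gp.1 gp.2) q.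
Proof. by have [_ _ s] := act_smooth; apply: (smooth_on_msm s); exact: filterT. Qed.

Lemma msm_act (E : normedModType R) (P : smoothSpaceType E) (f : P -> G) (k : P -> M) s :
  msm f s -> msm k s -> msm (fun t => act (f t) (k t)) s.
Proof. by move=> sf sk; exact: (msm_comp (msm_pair sf sk) (msm_act0 _)). Qed.

Lemma msm_actl g p : msm (act g) p.
Proof. by apply: msm_act; [exact: msm_cst|exact: msm_id]. Qed.

Lemma msm_actr p g : msm (fun g => act g p) g.
Proof. by apply: msm_act; [exact: msm_id|exact: msm_cst]. Qed.

(** The infinitesimal action as the derivative of the orbit map. It agrees with the fundamental
    field, and in this form its linearity in [xi] is immediate. *)
Definition orb p xi : 'rV[R]_n := mderiv (fun g => act g p) 1%g xi.

Lemma orb_clin p : clin (orb p).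
Proof. exact: clin_mderiv (msm_actr p 1%g). Qed.

Lemma fundE xi p : fundamental_field act xi p = orb p xi.
Proof.
have e0 : Lie_exp G ((0 : R^o) *: xi) = 1%g by rewrite scale0r exp0.
by rewrite /fundamental_field (velocity_comp (msm_exp_line G xi 0) e0 (msm_actr p 1%g))
  velocity_exp_line.
Qed.

Lemma orb_equiv g p xi : mderiv (act g) p (orb p xi) = orb (act g p) (Ad g xi).
Proof.
have s1 : msm (act g) (act 1%g p) by exact: msm_actl.
have sc : msm (fun a : G => (g * a * g^-1)%g) 1%g by apply: msm_conjg; exact: msm_id.
have s2 : msm (fun a => act a (act g p)) (g * 1 * g^-1)%g by exact: msm_actr.
have e : (g * 1 * g^-1)%g = 1%g by rewrite mulg1 mulgV.
have ef : (fun a => act g (act a p)) = (fun a => act (g * a * g^-1)%g (act g p)).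
  by apply/funext => a; rewrite -!actM mulgVK.
have h1 := mderiv_comp xi (msm_actr p 1%g) s1.
have h2 := mderiv_comp xi sc s2.
apply: etrans (congr1 (fun q => mderiv (act g) q (orb p xi)) (esym (act1 p))) _.
apply: etrans (esym h1) _.
apply: etrans (congr1 (fun f => mderiv f 1%g xi) ef) _.
apply: etrans h2 _.
exact: (congr1 (fun b : G => mderiv (fun a => act a (act g p)) b (Ad g xi)) e).
Qed.

Lemma stab1 p : stabilizer act p 1%g. Proof. exact: act1. Qed.

Lemma stabM p g h : stabilizer act p g -> stabilizer act p h ->
  stabilizer act p (g * h)%g.
Proof. by rewrite /stabilizer /= => gp hp; rewrite actM hp. Qed.

Lemma stabV p g : stabilizer act p g -> stabilizer act p (g^-1)%g.
Proof. by rewrite /stabilizer /= => gp; rewrite -{1}gp actK. Qed.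

Lemma stabJ x1 x2 g h : act g x1 = x2 -> stabilizer act x1 h ->
  stabilizer act x2 (g * h * g^-1)%g.
Proof. by rewrite /stabilizer /= => <- hx; rewrite !actM actK hx. Qed.

(* The velocity of the curve at [t] is the image of [orb p xi] under
   [exp (t xi)]. *)
Lemma exp_line_const p xi : orb p xi = 0 ->
  \forall t \near (0 : R^o), act (Lie_exp G (t *: xi)) p = p.
Proof.
move=> o0; pose gam (t : R^o) := act (Lie_exp G (t *: xi)) p.
have sg t : msm gam t by apply: msm_act; [exact: msm_exp_line|exact: msm_cst].
have g0 : gam 0 = p by rewrite /gam scale0r exp0 act1.
have v0 : velocity gam 0 = 0.
  by rewrite -o0 -fundE.
have dg (t : R^o) : mderiv gam t (1 : R^o) = 0.
  have sh : msm (fun s : R^o => (s - t)%R : R^o) t.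
    by apply: msm_RR; apply: sm_add; [exact: sm_id|exact: sm_cst].
  have e0 : t - t = 0 :> R^o by rewrite subrr.
  have s1 : msm gam (t - t) by exact: sg.
  have s2 : msm (fun s : R^o => gam (s - t)%R) t by exact: (msm_comp sh s1).
  have s3 : msm (act (Lie_exp G (t *: xi))) (gam (t - t)%R) by exact: msm_actl.
  have ef : gam = (fun s => act (Lie_exp G (t *: xi)) (gam (s - t)%R)).
    by apply/funext => s; rewrite /gam -actM -exp_add addrC subrK.
  apply: etrans (congr1 (fun f => mderiv f t (1 : R^o)) ef) _.
  apply: etrans (mderiv_comp (1 : R^o) s2 s3) _.
  have e1 : mderiv (fun s : R^o => (s - t)%R : R^o) t (1 : R^o) = 1.
    apply: etrans (diff_add_cst (- t) (1 : R^o) (sm_diff (sm_id t))) _.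
    exact: diff_idE.
  have e2 : mderiv gam (t - t) (mderiv (fun s : R^o => (s - t)%R : R^o) t (1 : R^o)) = 0.
    apply: etrans (congr1 (mderiv gam (t - t)) e1) _.
    exact: etrans (congr1 (fun u : R^o => mderiv gam u (1 : R^o)) e0) v0.
  apply: etrans (congr1 (mderiv (act (Lie_exp G (t *: xi))) (gam (t - t)%R)) _) _.
    exact: etrans (mderiv_comp (1 : R^o) sh s1) e2.
  exact: clin0 (clin_mderiv s3).
have kc : compat (chart_at p) := chart_at_compat p.
have cp : cdom (chart_at p) p := chart_at_dom p.
have nc := near_curve (sg 0) g0 (near_cdom cp).
pose f (t : R^o) := cmap (chart_at p) (gam t).
have sk : msm (cmap (chart_at p)) (gam 0) by rewrite g0; exact: msm_cmap.
have sf : sm f 0 by have [_] := msm_comp (sg 0) sk.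
have [K K0 KP] := @mean_value R R^o 'rV[R]_n _.
have [r r0 rP] := near_ball_ex (filterI nc (sm_near sf)).
have d0 t : ball (0 : R^o) r t -> differentiable f t /\ forall w, `|'d f t w| <= 0 * `|w|.
  move=> /rP [ct st]; split; first exact: sm_diff.
  move=> w; rewrite mul0r.
  have sk' : msm (cmap (chart_at p)) (gam t) by exact: msm_cmap.
  have cl := clin_diff (sm_diff st).
  have dw : 'd f t w = w *: 'd f t (1 : R^o).
    by rewrite -(clinZ _ _ cl); congr ('d f t _); rewrite [RHS]mulr1.
  have d1 : 'd f t (1 : R^o) = 0.
    apply: etrans (mderiv_comp (1 : R^o) (sg t) sk') _.
    by rewrite dg; exact: clin0 (clin_mderiv sk').
  by rewrite dw d1 scaler0 normr0.
have nb : \forall t \near (0 : R^o), ball (0 : R^o) r t by exact: nbhsx_ballx.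
apply: filterS2 nb nc => t bt ct.
have := KP f 0 r 0 d0 t 0 bt (ballxx _ r0); rewrite mulr0 mul0r => /norm_sub_eq.
by rewrite /f g0 => e; rewrite -[LHS](cmapK ct) e cmapK.
Qed.

(** If the field vanishes at [p], then the curve exp(t xi) fixes [p] for small [t]; any other
    parameter is reached by doubling, since the stabilizer is closed under products. *)
Lemma Lie_algebra_stab p xi : Lie_algebra (stabilizer act p) xi <-> orb p xi = 0.
Proof.
split=> [H|o0 t].
  rewrite -fundE /fundamental_field.
  have -> : (fun t : R^o => act (Lie_exp G (t *: xi)) p) = (fun _ => p).
    by apply/funext => t; exact: H.
  exact: mderiv_cst.
have [e e0 eP] := (near0_ball _).1 (exp_line_const o0).
have q0 : 0 <= (1/2 : R) by lra.
have q1 : (1/2 : R) < 1 by lra.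
have e2 : 0 < e / 2 by rewrite divr_gt0.
have [k kP] := geo_small `|t| q0 q1 e2.
have Hk m : stabilizer act p (Lie_exp G ((t / 2 ^+ m) *: xi)) ->
    stabilizer act p (Lie_exp G (t *: xi)).
  elim: m => [|m IH]; first by rewrite expr0 divr1.
  move=> h; apply: IH.
  have -> : t / 2 ^+ m = t / 2 ^+ m.+1 + t / 2 ^+ m.+1.
    rewrite half_pow -mulrDl; have -> : 1/2 + 1/2 = 1 :> R by lra.
    by rewrite mul1r.
  by rewrite exp_add; exact: stabM.
apply: (Hk k); apply: eP.
rewrite div_pow2 normrM (ger0_norm (exprn_ge0 k q0)).
by apply: (le_lt_trans kP); move: e0; lra.
Qed.

Lemma orb_partial_diff xi p v :
  mderiv (fun gp : G * M => act gp.1 gp.2) (1%g, p) (xi, v) = orb p xi + v.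
Proof.
rewrite mderiv_prod; last exact: msm_act0.
congr (_ + _); apply: etrans (mderiv_id p v).
by apply: (congr1 (fun f => mderiv f p v)); apply/funext => q; exact: act1.
Qed.

Section Compactness.
Hypothesis act_proper : proper_action act.

Lemma stab_compact p : compact (stabilizer act p).
Proof.
have c1 : compact [set (p, p)] by exact: compact_set1.
have := act_proper c1; set B := [set gp | _] => cB.
have -> : stabilizer act p = fst @` B.
  apply/seteqP; split=> [h hp|_ [[h q] [/= h1 h2] <-]].
    by exists (h, p) => //; rewrite /B /= hp.
  by rewrite /stabilizer /= -{1}h2 h1.
by apply: continuous_compact => //; apply: continuous_subspaceT => q; exact: cvg_fst.
Qed.

(** Compactness of the stabilizer makes the neighbourhood of [x] uniform in [h]. *)
Lemma tube x (P : G -> M -> Prop) :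
  (forall h, stabilizer act x h -> \forall q \near (h, x), P q.1 q.2) ->
  \forall z \near x, forall h, stabilizer act x h -> P h z.
Proof.
move=> H; have /compact_near_coveringP cov := @stab_compact x.
have := cov M (nbhs x) (fun z h => P h z) _.
have H2 h : stabilizer act x h -> \forall h' \near h & i \near nbhs x, P h' i.
  by move=> hx; exact: H.
move=> /(_ _ H2); apply: filterS => z; exact.
Qed.

(* The largest invariant part of a neighbourhood of [x] is again one, by
   compactness of the stabilizer. *)
Lemma invariant_nbhs x (P : M -> Prop) : (\forall z \near x, P z) ->
  exists U : set M, [/\ open U, U x, (forall z, U z -> P z) &
    forall h z, stabilizer act x h -> U z -> U (act h z)].
Proof.
move=> nP; pose V := [set z | forall h, stabilizer act x h -> P (act h z)].
have nV : nbhs x V.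
  apply: (tube (P := fun h z => P (act h z))) => h hx.
  have nP' : \forall z \near act h x, P z by rewrite hx.
  exact: (near_comp (msm_cts (msm_act0 (h, x))) nP').
exists (interior V); split.
- exact: open_interior.
- exact: nV.
- by move=> z /interior_subset /(_ _ (stab1 x)); rewrite act1.
- move=> h z hx Vz.
  have h1 : \forall q \near act h z, V (act (h^-1)%g q).
    have nz : \forall q \near act (h^-1)%g (act h z), V q by rewrite actK.
    exact: (near_comp (msm_cts (msm_actl _ _)) nz).
  apply: filterS h1 => q Vq k kx.
  have := Vq (k * h)%g (stabM kx hx); by rewrite actM actVK.
Qed.

End Compactness.
End Action.

Lemma near_all (T : topologicalType) (p : T) (P : T -> Prop) :
  (forall q, P q) -> \forall q \near p, P q.
Proof. by move=> H; exact: nearW. Qed.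

(** * Slices *)

Section SliceFacts.
Variables (R : realType) (d n : nat).
Variables (G : lieGroupType 'rV[R]_d) (M : manifoldType 'rV[R]_n).
Variable act : G -> M -> M.
Hypothesis act_smooth : smooth_action act.
Implicit Types (g h a : G) (p q x y z : M) (xi : 'rV[R]_d).

Let GS (S : set M) : set (G * M) := [set: G] `*` S.

(* [slice] with the auxiliary manifold G x^H S eliminated. *)
Record pre_slice (x : M) (S : set M) (k : nat) : Prop := PreSlice {
  ps_chart : forall y, S y -> exists c, slice_chart k S c y;
  ps_mem : S x;
  ps_inv : forall h s, stabilizer act x h -> S s -> S (act h s);
  ps_fib : forall g g' s s', S s -> S s' ->
    (act g s = act g' s' <->
     exists2 h, stabilizer act x h & g' = (g * h^-1)%g /\ s' = act h s);
  ps_subm : forall g y w, S y -> exists v, tangent_to (GS S) (g, y) v /\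
    mderiv (fun gp : G * M => act gp.1 gp.2) (g, y) v = w }.

(** On G x S the action is [Phi] after [pi]. As [Phi] is a diffeomorphism onto the open set G S, the
    fibres of the action are those of [pi], and its differential is surjective along with that of
    [pi]. *)
Lemma slice_pre x S : slice act x S -> exists k, pre_slice x S k.
Proof.
move=> [[k emb] Sx Sinv So [q [Q [pi [Phi [Phi' [[spi spj pif pis] phip dif]]]]]]].
exists k; split=> //.
- move=> g g' s s' Ss Ss'.
  have e1 := phip g s Ss; have e2 := phip g' s' Ss'.
  have [d1 _ _ _] := dif.
  split=> [e|[h hx [-> ->]]]; last first.
    by rewrite actM // actK.
  have e3 : pi (g, s) = pi (g', s').
    by rewrite -[LHS](d1 _ I).2 -[RHS](d1 _ I).2 e1 e2 e.
  have [h hx /= [eg es]] := (pif (g, s) (g', s') (conj I Ss) (conj I Ss')).1 e3.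
  by exists h.
- move=> g y w Sy; pose p := (g, y).
  have GSp : GS S p by [].
  have [d1 d2 d3 d4] := dif.
  have sPhi b : msm Phi b by apply: (smooth_on_msm d3); exact: filterT.
  have sat : saturation act S (act g y) by exists g, y.
  have sPhi' : msm Phi' (act g y).
    by apply: (smooth_on_msm d4); apply: open_nbhs_nbhs.
  (* [pi] is smooth only as a map on the subset G x S; an extension is differentiated in its place,
     with the same values on tangent vectors. *)
  have [pi1 [sp1 e1]] := smooth_on_ext spi GSp.
  have pi1p : pi1 p = pi p by exact: (nbhs_singleton e1).
  have Phip : Phi (pi p) = act g y by exact: phip.
  have [v tv pv] := pis p GSp (mderiv Phi' (act g y) w).
  exists v; split=> //.
  have e1' : \forall b \near p, GS S b -> pi1 b = pi b by exact: e1.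
  have pv1 : mderiv pi1 p v = mderiv Phi' (act g y) w.
    by rewrite -pv; apply/esym; apply: (mderiv_onE sp1 e1').
  have sc : msm (fun b => Phi (pi1 b)) p by exact: (msm_comp sp1 (sPhi _)).
  have e4 : mderiv (fun gp : G * M => act gp.1 gp.2) p v = mderiv (fun b => Phi (pi1 b)) p v.
    apply: (mderiv_tangent_eq (msm_act0 act_smooth p) sc _ tv).
    apply: filterS e1' => -[a z] hb GSq; rewrite hb //=; apply/esym; apply: phip.
    exact: GSq.2.
  apply: etrans e4 _; apply: etrans (mderiv_comp v sp1 (sPhi _)) _.
  apply: etrans (congr1 (mderiv Phi (pi1 p)) pv1) _.
  have ePhi : pi1 p = Phi' (act g y).
    by rewrite pi1p -Phip (d1 _ I).2.
  have sPhi2 : msm Phi (Phi' (act g y)) by exact: sPhi.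
  apply: etrans (congr1 (fun b => mderiv Phi b (mderiv Phi' (act g y) w)) ePhi) _.
  apply: etrans (esym (mderiv_comp w sPhi' sPhi2)) _.
  apply: etrans (mderiv_id (act g y) w); apply/esym; apply: mderiv_eq.
    have : nbhs (act g y) (saturation act S) by exact: open_nbhs_nbhs.
    by apply: filterS => z /d2 [_ ->].
  exact: msm_id.
Qed.

Section Coordinates.
Variables (x : M) (S : set M) (k : nat).
Hypothesis PS : pre_slice x S k.

Lemma slice_stab g s : S s -> S (act g s) -> stabilizer act x g.
Proof.
move=> Ss Sgs; have e : act g s = act 1%g (act g s) by rewrite act1.
have [h hx [e1 _]] := (ps_fib PS g 1%g Ss Sgs).1 e.
have -> : g = h by apply: (@mulIg G (h^-1)%g); rewrite -e1 mulgV.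
exact: hx.
Qed.

Lemma tangent_zero y : S y -> tangent_to S y 0.
Proof.
move=> Sy; apply/tangentP; exists (fun _ => y); split=> //.
- exact: msm_cst.
- by apply/near0_ball; exists 1.
- exact: mderiv_cst.
Qed.

Variables (y : M) (c : chart 'rV[R]_n M).
Hypotheses (Sy : S y) (cy : slice_chart k S c y).

Let kc : compat c. Proof. by case: cy. Qed.
Let cdy : cdom c y. Proof. by case: cy. Qed.

Definition slice_vec (u : 'rV[R]_n) := forall i : 'I_n, (k <= i)%N -> u ord0 i = 0.

Lemma slice_vecB u v : slice_vec u -> slice_vec v -> slice_vec (u - v).
Proof. by move=> hu hv i ki; rewrite !mxE hu // hv // subr0. Qed.

Lemma tangent_slice_vec v : tangent_to S y v -> slice_vec (mderiv (cmap c) y v).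
Proof. exact: slice_chart_tangent cy. Qed.

Lemma slice_vec_tangent u : slice_vec u -> tangent_to S y (mderiv (cinv c) (cmap c y) u).
Proof. exact: tangent_slice_chart cy Sy. Qed.

(** A linear section, read in the chart [c], of the surjection (xi, u) |-> xi_M(y) + u from the Lie
    algebra times T_y S onto T_y M: [J1] is the group part and [J2] the slice part. *)
Definition split_coords (J1 : 'rV[R]_n -> 'rV[R]_d) (J2 : 'rV[R]_n -> 'rV[R]_n) :=
  [/\ linear J1, linear J2, forall w, slice_vec (J2 w) &
      forall w, mderiv (cmap c) y (orb act y (J1 w)) + J2 w = w].

Lemma dcmap_clin : clin (mderiv (cmap c) y).
Proof. exact: clin_mderiv (msm_cmap kc cdy). Qed.

(** Preimages of the basis vectors of the chart are chosen and extended linearly. The predicate [m]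
    records where the group parts are taken: anywhere at a general point of the slice, in the
    complement at the base point. *)
Lemma split_basis (m : 'rV[R]_d -> Prop) :
  (forall w, exists xi u, [/\ m xi, tangent_to S y u & orb act y xi + u = w]) ->
  exists (X : 'M[R]_(n, d)) (J2 : 'rV[R]_n -> 'rV[R]_n),
    (forall i, m (row i X)) /\ split_coords (fun w => w *m X) J2.
Proof.
move=> H.
have /choice [b bP] : forall i : 'I_n, exists b : 'rV[R]_d * 'rV[R]_n,
    [/\ m b.1, tangent_to S y b.2 &
     orb act y b.1 + b.2 = mderiv (cinv c) (cmap c y) (delta_mx 0 i)].
  move=> i; have [xi [u [h1 h2 h3]]] := H (mderiv (cinv c) (cmap c y) (delta_mx 0 i)).
  by exists (xi, u).
pose X : 'M[R]_(n, d) := \matrix_(i < n) (b i).1.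
pose Y : 'M[R]_(n, n) := \matrix_(i < n) mderiv (cmap c) y (b i).2.
exists X, (fun w => w *m Y); split=> [i|].
  by rewrite rowK; have [] := bP i.
have rY w : w *m Y = \sum_i w ord0 i *: mderiv (cmap c) y (b i).2.
  by rewrite mulmx_sum_row; apply: eq_bigr => i _; rewrite rowK.
have rX w : w *m X = \sum_i w ord0 i *: (b i).1.
  by rewrite mulmx_sum_row; apply: eq_bigr => i _; rewrite rowK.
split.
- by move=> a u v; rewrite mulmxDl scalemxAl.
- by move=> a u v; rewrite mulmxDl scalemxAl.
- move=> w i ki; rewrite rY summxE big1 // => j _.
  rewrite mxE (tangent_slice_vec _ ki) ?mulr0 //; by have [] := bP j.
- move=> w; have cl := clin_comp (orb_clin act_smooth y) dcmap_clin.
  have e0 : mderiv (cmap c) y (orb act y (\sum_i w ord0 i *: (b i).1)) =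
      \sum_i w ord0 i *: mderiv (cmap c) y (orb act y (b i).1).
    apply: etrans (clin_sum _ cl) _; apply: eq_bigr => i _; exact: (clinZ _ _ cl).
  rewrite rX rY e0 -big_split /= [RHS](row_sum_delta w).
  apply: eq_bigr => i _; rewrite -scalerDr; congr (_ *: _).
  have [_ _ e] := bP i; rewrite -(clinD _ _ dcmap_clin) e.
  exact: dcmapK.
Qed.

Lemma subm_split w : exists xi u, tangent_to S y u /\ orb act y xi + u = w.
Proof.
have e : act 1%g y = y by exact: act1.
have [v [tv vw]] := ps_subm PS 1%g w Sy.
exists v.1, v.2; split.
  have := tangent_image (B := S) (msm_snd (1%g, y)) _ tv.
  rewrite mderiv_snd; apply.
  by apply: near_all => -[a z] [].
rewrite -vw; case: v {tv vw} => v1 v2; exact: esym (orb_partial_diff act_smooth _ _ _).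
Qed.

(** [W] inverts w |-> exp(J1 w) . s(w), where s(w) is the point of [S] displaced by [J2 w] in the
    chart; by the choice of [J1] and [J2] this map has derivative the identity at 0. *)
Lemma local_coords (J1 : 'rV[R]_n -> 'rV[R]_d) (J2 : 'rV[R]_n -> 'rV[R]_n) :
  split_coords J1 J2 ->
  exists W : M -> 'rV[R]_n, [/\ msm W y, W y = 0,
   (\forall z \near y, S (act (Lie_exp G (J1 (W z)))^-1%g z)) &
   \forall w \near (0 : 'rV[R]_n),
     W (act (Lie_exp G (J1 w)) (cinv c (cmap c y + J2 w))) = w].
Proof.
move=> [lJ1 lJ2 vJ2 JE].
have c1 : clin J1 by exact: lin_clin.
have c2 : clin J2 by exact: lin_clin.
pose s w := cinv c (cmap c y + J2 w).
pose f w := act (Lie_exp G (J1 w)) (s w).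
have s0 : s 0 = y by rewrite /s (clin0 c2) addr0 cmapK.
have e0 : Lie_exp G (J1 0) = 1%g by rewrite (clin0 c1) exp0.
have f0 : f 0 = y by rewrite /f e0 s0 act1.
have sJ1 : msm J1 0 by apply: msm_rV; exact: sm_lin.
have sE : msm (fun w => Lie_exp G (J1 w)) 0.
  by apply: (msm_comp sJ1); rewrite (clin0 c1); exact: msm_exp0.
have sl : sm (fun w => cmap c y + J2 w) 0.
  by apply: sm_add; [exact: sm_cst|exact: sm_lin].
have l0 : cmap c y + J2 0 = cmap c y by rewrite (clin0 c2) addr0.
have sci : msm (cinv c) (cmap c y + J2 0) by rewrite l0; exact: msm_cinv.
have ss : msm s 0 by exact: (msm_comp (msm_rV sl) sci).
have sf : msm f 0 by exact: msm_act.
have dE w : mderiv (fun w => Lie_exp G (J1 w)) 0 w = J1 w.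
  have sE' : msm (Lie_exp G) (J1 0) by rewrite (clin0 c1); exact: msm_exp0.
  apply: etrans (mderiv_comp w sJ1 sE') _.
  apply: etrans (congr1 (fun u => mderiv (Lie_exp G) u (mderiv J1 0 w)) (clin0 c1)) _.
  apply: etrans (dexp G _) _.
  exact: (congr1 (fun g : 'rV[R]_n -> 'rV[R]_d => g w) (diff_clin 0 c1)).
have ds w : mderiv s 0 w = mderiv (cinv c) (cmap c y) (J2 w).
  apply: etrans (mderiv_comp w (msm_rV sl) sci) _.
  apply: etrans (congr1 (fun u => mderiv (cinv c) u _) l0) _.
  apply: (congr1 (mderiv (cinv c) (cmap c y))).
  have ed : (fun w => cmap c y + J2 w) = (fun w => J2 w + cmap c y).
    by apply/funext => u; rewrite addrC.
  apply: etrans (congr1 (fun h : 'rV[R]_n -> 'rV[R]_n => mderiv h 0 w) ed) _.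
  apply: etrans (diff_add_cst _ _ (sm_diff (sm_lin 0 c2))) _.
  exact: (congr1 (fun g : 'rV[R]_n -> 'rV[R]_n => g w) (diff_clin 0 c2)).
have df w : mderiv (cmap c) (f 0) (mderiv f 0 w) = w.
  have e1 : mderiv f 0 w = orb act y (J1 w) + mderiv (cinv c) (cmap c y) (J2 w).
    apply: etrans (mderiv_comp w (msm_pair sE ss) (msm_act0 act_smooth _)) _.
    have e2 : mderiv (fun w => (Lie_exp G (J1 w), s w)) 0 w =
        (J1 w, mderiv (cinv c) (cmap c y) (J2 w)).
      exact: etrans (mderiv_pair w sE ss) (congr2 pair (dE w) (ds w)).
    have e3 : (Lie_exp G (J1 0), s 0) = (1%g, y) by rewrite e0 s0.
    apply: etrans (congr2 (fun (b : G * M) v => mderiv (fun gp : G * M => act gp.1 gp.2) b v) e3 e2) _.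
    exact: orb_partial_diff.
  apply: etrans (congr2 (fun z v => mderiv (cmap c) z v) f0 e1) _.
  apply: etrans (clinD _ _ dcmap_clin) _; apply: etrans (JE w).
  by congr (_ + _); exact: dcmapK.
have cf0 : cdom c (f 0) by rewrite f0.
have [W [sW Wf0 Wf fW]] := inverse_function_mfd kc cf0 sf df.
rewrite f0 in sW Wf0 fW; exists W; split=> //.
have n1 : \forall w \near (0 : 'rV[R]_n), S (s w).
  have n2 : \forall w \near (0 : 'rV[R]_n),
      cmap c (s w) = cmap c y + J2 w /\ cdom c (s w).
    have n3 : \forall v \near cmap c y + J2 0, cmap c (cinv c v) = v /\ cdom c (cinv c v).
      by rewrite l0; exact: cinvK_near.
    exact: (near_comp (sm_cts sl) n3).
  apply: filterS n2 => w [e cs]; have [_ _ cS] := cy.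
  apply/(cS _ cs) => i ki; rewrite e !mxE vJ2 // addr0.
  exact: ((cS _ cdy).1 Sy i ki).
have n4 : \forall w \near W y, S (s w) by rewrite Wf0.
have n5 := near_comp (msm_cts sW) n4.
apply: filterS2 fW n5 => z e Sz.
have -> // : act (Lie_exp G (J1 (W z)))^-1%g z = s (W z).
by rewrite -{2}e /f actK.
Qed.

Lemma local_section : exists g : M -> G, [/\ msm g y, g y = 1%g &
  \forall z \near y, S (act (g z)^-1%g z)].
Proof.
have sub w : exists xi u, [/\ True, tangent_to S y u & orb act y xi + u = w].
  by have [xi [u [h1 h2]]] := subm_split w; exists xi, u.
have [X [J2 [_ sc]]] := split_basis sub.
have [W [sW W0 SW _]] := local_coords sc.
have e0 : W y *m X = 0 by rewrite W0 mul0mx.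
exists (fun z => Lie_exp G (W z *m X)); split=> //.
  have sX : msm (fun z => W z *m X) y.
    by apply: (msm_linf (L := fun w => w *m X)) => // a u v; rewrite mulmxDl scalemxAl.
  by apply: (msm_comp sX); rewrite e0; exact: msm_exp0.
by rewrite e0 exp0.
Qed.

(** The projection of the tube onto the orbit is locally constant on [S], so it kills [v1] and [v2],
    while it sends xi_M(y) to xi_M(x). The conclusion therefore holds at the base point [x],
    although [y] is any point of [S]. *)
Lemma slice_transversal xi v1 v2 : tangent_to S y v1 -> tangent_to S y v2 ->
  orb act y xi = v1 - v2 -> orb act x xi = 0.
Proof.
move=> t1 t2 e; have [g [sg gy gS]] := local_section.
(* [al] sends [a . s] to [a . x] for [s] in the slice. *)
pose al z := act (g z) x.
have sal : msm al y by apply: (msm_act act_smooth) => //; exact: msm_cst.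
have alS : \forall z \near y, S z -> al z = x.
  apply: filterS gS => z h Sz; have := slice_stab Sz h => hx.
  by have := stabV act_smooth hx; rewrite invgK.
have dal v : tangent_to S y v -> mderiv al y v = 0.
  move=> tv; apply: etrans (mderiv_tangent_eq sal (msm_cst x y) alS tv) _.
  exact: mderiv_cst.
have sr : msm (fun a => act a y) 1%g by exact: msm_actr.
have e1 : act 1%g y = y by exact: act1.
have ala : \forall a \near (1%g : G), al (act a y) = act a x.
  have n1 : \forall z \near act 1%g y, S (act (g z)^-1%g z) by rewrite e1.
  have n2 := near_comp (msm_cts sr) n1.
  apply: filterS n2 => a; rewrite -actM // => h.
  have hx := slice_stab Sy h.
  by rewrite /al -{1}hx -(actM act_smooth) mulVKg.
have d1 : mderiv al y (orb act y xi) = orb act x xi.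
  have sal' : msm al (act 1%g y) by rewrite e1.
  have h : mderiv (fun a => al (act a y)) 1%g xi =
      mderiv al (act 1%g y) (orb act y xi) by exact: (mderiv_comp xi sr sal').
  have h2 : mderiv (fun a => al (act a y)) 1%g xi = orb act x xi.
    by apply: mderiv_eq ala _; exact: (msm_comp sr sal').
  rewrite -h2 h; exact: (congr1 (fun z => mderiv al z (orb act y xi)) (esym e1)).
apply: etrans (esym d1) _; apply: etrans (congr1 (mderiv al y) e) _.
apply: etrans (clinB _ _ (clin_mderiv sal)) _.
exact: etrans (f_equal2 (fun u v => u - v) (dal _ t1) (dal _ t2)) (subrr 0).
Qed.

End Coordinates.
End SliceFacts.

(** * Equivariant decomposition near the base point, smoothness of components *)

Section Decomposition.
Variables (R : realType) (d n : nat).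
Variables (G : lieGroupType 'rV[R]_d) (M : manifoldType 'rV[R]_n).
Variable act : G -> M -> M.
Hypothesis act_smooth : smooth_action act.
Hypothesis act_proper : proper_action act.
Implicit Types (g h a : G) (p q x y z : M) (xi : 'rV[R]_d).

Lemma msm_orb_chart (E : normedModType R) (P : smoothSpaceType E) {fE : findim E}
    (z : P -> M) (xi : P -> 'rV[R]_d) s (c : chart 'rV[R]_n M) :
  compat c -> cdom c (z s) -> msm z s -> msm xi s ->
  msm (fun t => mderiv (cmap c) (z t) (orb act (z t) (xi t))) s.
Proof.
move=> kc cz sz sxi.
pose f (b : G * M) : 'rV[R]_n := cmap c (act b.1 b.2).
have e1 : act 1%g (z s) = z s by exact: act1.
have sf : msm f (1%g, z s).
  have sk : msm (cmap c) (act 1%g (z s)) by rewrite e1; exact: msm_cmap.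
  exact: (msm_comp (msm_act0 act_smooth (1%g, z s)) sk).
have sV : msm (fun t => mderiv (cmap (chart_at (1%g : G))) 1%g (xi t)) s.
  by apply: (msm_ext _ sxi) => t; rewrite dcmap_at.
have h : msm (fun t => mderiv (fun b => f (b, z t)) 1%g (xi t)) s.
  exact: (msm_mderiv (y := fun _ : P => 1%g) sf (msm_cst _ _) sz sV).
apply: msm_eq h; have nz := near_comp (msm_cts sz) (near_cdom cz).
apply: filterS nz => t ct.
have e2 : act 1%g (z t) = z t by exact: act1.
have sk : msm (cmap c) (act 1%g (z t)) by rewrite e2; exact: msm_cmap.
have sr : msm (fun b => act b (z t)) 1%g by exact: msm_actr.
have H : mderiv (fun b => f (b, z t)) 1%g (xi t) =
    mderiv (cmap c) (act 1%g (z t)) (orb act (z t) (xi t)).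
  exact: (mderiv_comp (xi t) sr sk).
rewrite H; exact: (congr1 (fun b => mderiv (cmap c) b (orb act (z t) (xi t))) e2).
Qed.

(** Smoothness of a vector field at a point, seen in the single chart at [x]. *)
Definition vsm (X : M -> 'rV[R]_n) x : Prop :=
  msm (fun z => mderiv (cmap (chart_at x)) z (X z)) x.

Lemma smooth_field_vsm X x : smooth_field X -> vsm X x.
Proof.
move=> sX; apply: msm_flat.
have sC := sX (chart_at x) (chart_at_atlas x).
apply: (@sm_open _ _ _ _ (cmap (chart_at x) @` cdom (chart_at x))).
- exact: crange_open.
- by exists x => //; exact: chart_at_dom.
- exact: sC.
Qed.

Lemma vsm_deriv (E : normedModType R) (P : smoothSpaceType E) {fE : findim E} k
    (X : M -> 'rV[R]_n) x (f : M * P -> 'rV[R]_k) (z : M -> P) :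
  vsm X x -> msm z x -> msm f (x, z x) ->
  msm (fun y => mderiv (fun y' => f (y', z y)) y (X y)) x.
Proof.
by move=> vX sz sf; exact: (msm_mderiv (y := fun y => y) sf (msm_id x) sz vX).
Qed.

Lemma vsm_chart X x (c : chart 'rV[R]_n M) : compat c -> cdom c x -> vsm X x ->
  msm (fun z => mderiv (cmap c) z (X z)) x.
Proof.
move=> kc cx vX; pose f (b : M * M) : 'rV[R]_n := cmap c b.1.
have sf : msm f (x, x) by apply: (msm_comp (msm_fst (x, x))); exact: msm_cmap.
exact: (vsm_deriv vX (msm_id x) sf).
Qed.

Variables (x : M) (S : set M) (k : nat).
Hypothesis PS : pre_slice act x S k.
Variable m : {vspace 'rV[R]_d}.
Hypothesis Spl : equivariant_splitting (stabilizer act x) m.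

Section AtBase.
Variable c : chart 'rV[R]_n M.
Hypothesis cx : slice_chart k S c x.

Let kc : compat c. Proof. by case: cx. Qed.
Let cdx : cdom c x. Proof. by case: cx. Qed.
Let Sx : S x. Proof. exact: ps_mem PS. Qed.

(** At [x] the Lie algebra of the stabilizer acts by zero, so group parts may be taken in [m].
    Transversality and the triviality of the intersection of [m] with that algebra then make the
    splitting unique, so that the section is a two-sided inverse. *)
Lemma split_at_base : exists (X : 'M[R]_(n, d)) (J2 : 'rV[R]_n -> 'rV[R]_n),
  [/\ forall w, w *m X \in m, split_coords act k x c (fun w => w *m X) J2 &
    forall xi u, xi \in m -> slice_vec k u ->
      (mderiv (cmap c) x (orb act x xi) + u) *m X = xi /\
      J2 (mderiv (cmap c) x (orb act x xi) + u) = u].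
Proof.
have sub w : exists xi u, [/\ xi \in m, tangent_to S x u & orb act x xi + u = w].
  have [xi [u [tu e]]] := subm_split act_smooth PS Sx w.
  have [Sp _ _] := Spl; have [eta [mu [he mm exi]]] := Sp xi.
  exists mu, u; split=> //; rewrite -e exi (clinD _ _ (orb_clin act_smooth x)).
  by rewrite ((Lie_algebra_stab act_smooth x eta).1 he) add0r.
have [X [J2 [mX sc]]] := split_basis act_smooth cx sub.
have mJ w : w *m X \in m.
  by rewrite mulmx_sum_row; apply: rpred_sum => i _; apply: rpredZ; exact: mX.
have [lJ1 lJ2 vJ2 JE] := sc.
exists X, J2; split=> // xi u mxi su.
set w := _ + u.
have cl := dcmap_clin cx.
have e1 : mderiv (cmap c) x (orb act x (w *m X - xi)) = u - J2 w.
  rewrite (clinB _ _ (orb_clin act_smooth x)) (clinB _ _ cl).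
  have -> : mderiv (cmap c) x (orb act x (w *m X)) = w - J2 w.
    by apply: (canRL (addrK _)); exact: JE.
  have -> : u = w - mderiv (cmap c) x (orb act x xi) by rewrite /w addrC addKr.
  by rewrite addrAC.
have e2 : orb act x (w *m X - xi) = mderiv (cinv c) (cmap c x) (u - J2 w) - 0.
  by rewrite subr0 -e1 dcinvK.
have t1 := slice_vec_tangent Sx cx (slice_vecB su (vJ2 w)).
have o := slice_transversal act_smooth PS Sx cx t1 (tangent_zero Sx) e2.
have [_ U _] := Spl.
have z0 : w *m X - xi = 0.
  by apply: U; [exact/(Lie_algebra_stab act_smooth)|exact: rpredB].
have e3 : w *m X = xi by exact: subr0_eq.
split=> //; have := JE w; rewrite e3 {2}/w => /addrI.
by [].
Qed.

End AtBase.

Lemma decomposition : exists Xi : M -> 'rV[R]_d,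
  [/\ msm Xi x /\ Xi x = 0, forall z, Xi z \in m,
      (\forall z \near x, S (act (Lie_exp G (Xi z))^-1%g z)),
      (\forall b \near ((0 : 'rV[R]_d), x), b.1 \in m -> S b.2 ->
         Xi (act (Lie_exp G b.1) b.2) = b.1) &
      (\forall z \near x, forall h, stabilizer act x h -> Xi (act h z) = Ad h (Xi z))].
Proof.
have Sx := ps_mem PS.
have [c cx] := ps_chart PS Sx.
have kc : compat c by case: cx.
have cdx : cdom c x by case: cx.
have [X [J2 [mX sc inv]]] := split_at_base cx.
have [W [sW W0 SW Wf]] := local_coords act_smooth Sx cx sc.
have [lJ1 lJ2 vJ2 JE] := sc.
pose Xi z := W z *m X.
have sXi : msm Xi x by exact: (msm_linf lJ1 sW).
have Xi0 : Xi x = 0 by rewrite /Xi W0 mul0mx.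
have cl := clin_comp (orb_clin act_smooth x) (dcmap_clin cx).
(* The coordinate vector whose group part is xi and whose slice part is the displacement of s. The
   inverse function relation evaluated there says that exp(xi) . s has group coordinate xi. *)
pose wf (b : 'rV[R]_d * M) := mderiv (cmap c) x (orb act x b.1) + (cmap c b.2 - cmap c x).
have swf : msm wf (0, x).
  apply: msm_addf.
    by apply: (msm_linf cl.1); exact: msm_fst.
  apply: msm_subf; last exact: msm_cst.
  exact: (msm_comp (msm_snd ((0 : 'rV[R]_d), x)) (msm_cmap kc cdx)).
have wf0 : wf (0, x) = 0.
  by rewrite /wf /= subrr addr0; exact: (clin0 cl).
have U : \forall b \near ((0 : 'rV[R]_d), x), b.1 \in m -> S b.2 ->
         Xi (act (Lie_exp G b.1) b.2) = b.1.
  have n1 : \forall w \near wf (0, x),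
      W (act (Lie_exp G (w *m X)) (cinv c (cmap c x + J2 w))) = w.
    by rewrite wf0.
  have n2 := near_comp (msm_cts swf) n1.
  have n3 : \forall b \near ((0 : 'rV[R]_d), x), cdom c b.2.
    exact: (near_comp (msm_cts (msm_snd ((0 : 'rV[R]_d), x))) (near_cdom cdx)).
  apply: filterS2 n2 n3 => -[xi s] /= e cs mxi Ss.
  have su : slice_vec k (cmap c s - cmap c x).
    have [_ _ cS] := cx.
    by apply: slice_vecB; [exact: (cS _ cs).1|exact: (cS _ cdx).1].
  have [i1 i2] := inv xi _ mxi su.
  move: e; rewrite /wf /= i1 i2 [cmap c x + _]addrC subrK cmapK // /Xi => ->.
  exact: i1.
exists Xi; split=> //; first by move=> z; exact: mX.
(* As h z = exp(Ad h (Xi z)) . (h s) with h s in [S] and Ad h (Xi z) in [m], uniqueness of the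
   decomposition gives equivariance. Membership in the stabilizer is repeated in the conclusion
   because group elements near [h] may leave it. *)
have stube h : stabilizer act x h -> \forall b \near (h, x),
    stabilizer act x b.1 -> Xi (act b.1 b.2) = Ad b.1 (Xi b.2).
  move=> hx.
  pose s z := act (Lie_exp G (Xi z))^-1%g z.
  have ss : msm s x.
    apply: (msm_act act_smooth); last exact: msm_id.
    by apply: msm_invg; apply: (msm_comp sXi); rewrite Xi0; exact: msm_exp0.
  have s0 : s x = x by rewrite /s Xi0 exp0 invg1 act1.
  pose F (b : G * M) : 'rV[R]_d * M := (Ad b.1 (Xi b.2), act b.1 (s b.2)).
  have sn (E : normedModType R) (N : smoothSpaceType E) (f : M -> N) :
      msm f x -> msm (fun b : G * M => f b.2) (h, x).
    by move=> sf; exact: (msm_comp (msm_snd (h, x)) sf).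
  have sF : msm F (h, x).
    apply: msm_pair; first by apply: msm_Ad; [exact: msm_fst|exact: sn].
    by apply: (msm_act act_smooth); [exact: msm_fst|exact: sn].
  have F0 : F (h, x) = (0, x).
    by rewrite /F /= Xi0 s0 hx (clin0 (Ad_clin h)).
  have n1 : \forall b \near F (h, x), b.1 \in m -> S b.2 ->
         Xi (act (Lie_exp G b.1) b.2) = b.1 by rewrite F0.
  have n2 := near_comp (msm_cts sF) n1.
  have n3 : \forall b \near (h, x), S (s b.2).
    exact: (near_comp (msm_cts (msm_snd (h, x))) SW).
  apply: filterS2 n2 n3 => -[h' z] /= e Ssz h'x.
  have [_ _ AdH] := Spl.
  have := e (AdH _ _ h'x (mX _)) (ps_inv PS h'x Ssz).
  by rewrite -exp_conj -(actM act_smooth) mulgVK (actM act_smooth) /s (actVK act_smooth).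
have T : \forall z \near x, forall h, stabilizer act x h ->
    stabilizer act x h -> Xi (act h z) = Ad h (Xi z).
  exact: (tube act_proper (P := fun h z => stabilizer act x h -> Xi (act h z) = Ad h (Xi z)) stube).
by apply: filterS T => z hz h hx; exact: (hz h hx hx).
Qed.

(** The group part is found by inverting a matrix [D z], whose rows are the orbit directions at [z]
    plus slice directions kept constant in the chart; [D x] is the identity. The conclusion also
    contains the uniqueness of the group part at points of [S] near [x], from which the equivariance
    of zeta is deduced later. *)
Lemma component_smooth (X : M -> 'rV[R]_n) : vsm X x ->
  exists zeta : M -> 'rV[R]_d, msm zeta x /\
   \forall y \near x, S y -> forall Z xi, tangent_to S y Z -> xi \in m ->
     X y = Z + orb act y xi -> zeta y = xi.
Proof.
move=> vX; have Sx := ps_mem PS.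
have [c cx] := ps_chart PS Sx.
have [kc cdx cS] := cx.
have [A [J2 [mA sc inv]]] := split_at_base cx.
have [lJ1 lJ2 vJ2 JE] := sc.
pose Xc z := mderiv (cmap c) z (X z).
have sXc : msm Xc x by exact: vsm_chart.
pose r (i : 'I_n) z := mderiv (cmap c) z (orb act z (row i A)) + J2 (delta_mx 0 i).
have sr i : msm (r i) x.
  apply: msm_addf; last exact: msm_cst.
  exact: (msm_orb_chart kc cdx (msm_id x) (msm_cst _ _)).
pose D z : 'M[R]_n := \matrix_(i < n) r i z.
have DE z w : cdom c z -> w *m D z = mderiv (cmap c) z (orb act z (w *m A)) + J2 w.
  move=> cz; have clz : clin (fun xi => mderiv (cmap c) z (orb act z xi)).
    exact: (clin_comp (orb_clin act_smooth z) (clin_mderiv (msm_cmap kc cz))).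
  have clJ : clin J2 by exact: lin_clin.
  have e1 : mderiv (cmap c) z (orb act z (w *m A)) =
      \sum_i w ord0 i *: mderiv (cmap c) z (orb act z (row i A)).
    rewrite mulmx_sum_row; apply: etrans (clin_sum _ clz) _.
    by apply: eq_bigr => i _; exact: (clinZ _ _ clz).
  have e2 : J2 w = \sum_i w ord0 i *: J2 (delta_mx 0 i).
    rewrite {1}(row_sum_delta w); apply: etrans (clin_sum _ clJ) _.
    by apply: eq_bigr => i _; exact: (clinZ _ _ clJ).
  rewrite e1 e2 -big_split mulmx_sum_row; apply: eq_bigr => i _.
  by rewrite /= rowK /r scalerDr.
have Dx : D x = 1%:M.
  apply/row_matrixP => i; rewrite row1 rowK /r rowE; exact: JE.
have uD : D x \in unitmx by rewrite Dx unitmx1.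
pose ch := chart_at x.
have sD i j : sm (fun v => D (cinv ch v) i j : R^o) (cmap ch x).
  apply: (@sm_ext _ _ _ (fun v => r i (cinv ch v) ord0 j : R^o)).
    by move=> v; rewrite /D [RHS]mxE.
  apply: (@sm_coord _ _ _ _ (fun v => r i (cinv ch v))).
  exact: (msm_flat_sm (sr i)).
pose zeta z := (Xc z *m invmx (D z)) *m A.
have szeta : msm zeta x.
  apply: (msm_linf lJ1); apply: msm_flat.
  apply: (@sm_mul_invmx _ _ _ (fun v => D (cinv ch v)) (fun v => Xc (cinv ch v))).
  - exact: sD.
  - exact: msm_flat_sm sXc.
  - by rewrite cmapK //; exact: chart_at_dom.
exists zeta; split=> //.
have nu : \forall z \near x, D z \in unitmx.
  have s1 := sm_det sD.
  have dn : \det (D (cinv ch (cmap ch x))) != 0.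
    have ex : D (cinv ch (cmap ch x)) = 1%:M by rewrite cmapK //; exact: chart_at_dom.
    by rewrite ex det1 oner_neq0.
  have n1 : \forall v \near cmap ch x, \det (D (cinv ch v)) != 0.
    exact: (@cvgr_neq0 R R^o 'rV[R]_n (nbhs (cmap ch x)) _ _ _ (sm_cts s1) dn).
  have n2 := near_cmap (chart_at_dom x) n1.
  apply: filterS2 n2 (near_cdom (chart_at_dom x)) => z h cz.
  by rewrite unitmxE unitfE -[z](cmapK cz).
apply: filterS2 nu (near_cdom cdx) => y uy cy Sy Z xi tZ mxi eX.
have cyc : slice_chart k S c y by [].
have su := tangent_slice_vec cyc tZ.
have [i1 i2] := inv xi _ mxi su.
set w := _ + mderiv (cmap c) y Z in i1 i2.
have ew : w *m D y = Xc y.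
  rewrite DE // i1 i2 /Xc eX addrC; apply/esym.
  exact: (clinD _ _ (clin_mderiv (msm_cmap kc cy))).
by rewrite /zeta -ew mulmxK.
Qed.

End Decomposition.

(** * Shrinking a slice *)

Section RestrictChart.
Variables (R : realType) (E : normedModType R) (M : smoothSpaceType E).
Variables (c : chart E M) (U : set M) (oU : open U).

Let rdom := cdom c `&` U.

Let rdom_open : open rdom.
Proof. by apply: openI => //; exact: cdom_open. Qed.

Let rrange_open : open (cmap c @` rdom).
Proof. exact: chart_image_open. Qed.

Let rmapK p : rdom p -> cinv c (cmap c p) = p.
Proof. by move=> [cp _]; exact: cmapK. Qed.

Let rmap_cts p : rdom p -> {for p, continuous (cmap c)}.
Proof. by move=> [cp _]; exact: cmap_cts. Qed.

Let rinv_cts v : (cmap c @` rdom) v -> {for v, continuous (cinv c)}.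
Proof. by move=> [p [cp _] <-]; apply: cinv_cts; exists p. Qed.

Definition restrict_chart : chart E M :=
  Chart rdom_open rrange_open rmapK rmap_cts rinv_cts.

Lemma compat_restrict : compat c -> compat restrict_chart.
Proof.
move=> kc a aa; have [h1 h2] := kc a aa; split=> k.
  apply: Ck_sub (h1 k); move=> _ [p [[cp _] ap] <-]; by exists p.
by apply: Ck_sub (h2 k); move=> _ [p [ap [cp _]] <-]; exists p.
Qed.

End RestrictChart.

Lemma slice_chart_restrict (R : realType) n (M : smoothSpaceType 'rV[R]_n) k
    (S U : set M) (oU : open U) c p :
  slice_chart k S c p -> U p -> slice_chart k (S `&` U) (restrict_chart c oU) p.
Proof.
move=> [kc cp cS] Up; split; first exact: compat_restrict.
  by split.
move=> q [cq Uq]; split=> [[Sq _]|h]; first exact: (cS q cq).1.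
by split=> //; exact: (cS q cq).2.
Qed.

(** * Open subsets of a manifold as manifolds *)

Definition open_sub (T : topologicalType) (O : set T) (oO : open O) : Type :=
  set_type O.

Section OpenSub.
Variables (T : topologicalType) (O : set T) (oO : open O).

HB.instance Definition _ := SubChoice.copy (open_sub oO) (set_type O).
HB.instance Definition _ :=
  Topological.copy (open_sub oO) (initial_topology (\val : open_sub oO -> T)).

Lemma open_sub_mem (z : open_sub oO) : O (\val z).
Proof. exact: set_mem (valP z). Qed.

Lemma open_sub_insubK (z0 : open_sub oO) q : O q -> \val (insubd z0 q) = q.
Proof. by move=> Oq; apply: insubdK; exact: mem_set. Qed.

Lemma val_cts : continuous (\val : open_sub oO -> T).
Proof. exact: initial_continuous. Qed.

Lemma nbhs_open_sub (z : open_sub oO) (A : set (open_sub oO)) :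
  nbhs z A -> exists W : set T, [/\ open W, W (\val z) & \val @^-1` W `<=` A].
Proof. by move=> [_ [[W oW <-] Wz] WA]; exists W. Qed.

Lemma insub_cts (z0 : open_sub oO) q : O q ->
  {for q, continuous (insubd z0 : T -> open_sub oO)}.
Proof.
move=> Oq A /nbhs_open_sub [W [oW Wq WA]]; rewrite open_sub_insubK // in Wq.
have nO : nbhs q O by exact: open_nbhs_nbhs.
have nW : nbhs q W by exact: open_nbhs_nbhs.
rewrite nbhs_simpl /=; apply: filterS2 nO nW => r Or Wr.
by apply: WA; rewrite /= open_sub_insubK.
Qed.

End OpenSub.

Section OpenSubChart.
Variables (R : realType) (E : normedModType R).
Variables (T : topologicalType) (O : set T) (oO : open O).
Variables (c : chart E T) (z0 : open_sub oO).

Let odom : set (open_sub oO) := \val @^-1` cdom c.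
Let omap (z : open_sub oO) : E := cmap c (\val z).
Let oinv v : open_sub oO := insubd z0 (cinv c v).

Let odom_open : open odom.
Proof.
rewrite /odom; apply: open_comp; last exact: cdom_open.
by move=> z _; exact: val_cts.
Qed.

Let orangeE : omap @` odom = cmap c @` (cdom c `&` O).
Proof.
apply/seteqP; split=> [_ [z cz <-]|_ [q [cq Oq] <-]].
  by exists (\val z) => //; split=> //; exact: open_sub_mem.
by exists (insubd z0 q); rewrite /odom /omap /= open_sub_insubK.
Qed.

Let orange_open : open (omap @` odom).
Proof. by rewrite orangeE; exact: chart_image_open. Qed.

Let omapK z : odom z -> oinv (omap z) = z.
Proof. by move=> cz; rewrite /oinv /omap cmapK // valKd. Qed.

Let omap_cts z : odom z -> {for z, continuous omap}.
Proof.
move=> cz; apply: (@continuous_comp _ _ _ (\val : open_sub oO -> T) (cmap c)).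
  exact: val_cts.
exact: cmap_cts.
Qed.

Let oinv_cts v : (omap @` odom) v -> {for v, continuous oinv}.
Proof.
rewrite orangeE => -[q [cq Oq] <-].
apply: (@continuous_comp _ _ _ (cinv c) (insubd z0 : T -> open_sub oO)).
  by apply: cinv_cts; exists q.
by rewrite cmapK //; exact: insub_cts.
Qed.

Definition open_sub_chart : chart E (open_sub oO) :=
  Chart odom_open orange_open omapK omap_cts oinv_cts.

End OpenSubChart.

Section OpenSubmanifold.
Variables (R : realType) (E : normedModType R).

Section Smooth.
Variables (M : smoothSpaceType E) (O : set M) (oO : open O).

(** The point [z] only supplies the value of the inverse chart outside the open set. *)
Definition open_sub_atlas : set (chart E (open_sub oO)) :=
  [set a | exists c z, atlas c /\ a = open_sub_chart c z].

Definition open_sub_chart_at (z : open_sub oO) := open_sub_chart (chart_at (\val z)) z.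

Fact open_sub_chart_at_atlas z : open_sub_atlas (open_sub_chart_at z).
Proof. by exists (chart_at (\val z)), z; split=> //; exact: chart_at_atlas. Qed.

Fact open_sub_chart_at_dom z : cdom (open_sub_chart_at z) z.
Proof. exact: chart_at_dom. Qed.

Fact open_sub_atlas_smooth a a' :
  open_sub_atlas a -> open_sub_atlas a' -> transition_smooth a a'.
Proof.
move=> [c [z [Ac ->]]] [c' [z' [Ac' ->]]] k.
pose V := cmap c @` ((cdom c `&` cdom c') `&` O).
have VE : cmap (open_sub_chart c z) @` (cdom (open_sub_chart c z) `&`
    cdom (open_sub_chart c' z')) `<=` V.
  move=> _ [q [cq c'q] <-]; exists (\val q) => //; split; first by split.
  exact: open_sub_mem.
apply: (Ck_sub VE).
have oV : open V.
  by rewrite /V -setIA; apply: chart_image_open; apply: openI => //; exact: cdom_open.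
apply: (@Ck_eq _ _ _ k V (cmap c' \o cinv c)) => //.
  by move=> _ [q [[cq _] Oq] <-]; rewrite /= cmapK // open_sub_insubK.
have VW : V `<=` cmap c @` (cdom c `&` cdom c').
  by move=> _ [q [cq _] <-]; exists q.
exact: (Ck_sub VW (@atlas_smooth _ _ _ c c' Ac Ac' k)).
Qed.

HB.instance Definition _ := hasSmoothAtlas.Build R E (open_sub oO)
  open_sub_chart_at_atlas open_sub_chart_at_dom open_sub_atlas_smooth.

Lemma msm_val {fE : findim E} (z : open_sub oO) : msm (\val : open_sub oO -> M) z.
Proof.
split; first exact: val_cts.
apply: (@sm_eq _ _ _ (fun v => v)); last exact: sm_id.
have cz := chart_at_dom (\val z).
have nO : \forall q \near \val z, O q.
  by apply: open_nbhs_nbhs; split => //; exact: open_sub_mem.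
have n1 := cinvK_near cz; have n2 := near_cinv cz nO.
apply: filterS2 n1 n2 => v [e _] Ov.
by rewrite /= open_sub_insubK.
Qed.

Lemma insub_near (z0 : open_sub oO) q : O q ->
  \forall v \near cmap (chart_at q) q,
    (cmap (chart_at (insubd z0 q)) \o insubd z0 \o cinv (chart_at q)) v = v.
Proof.
move=> Oq; have cq := chart_at_dom q.
have nO : \forall r \near q, O r by exact: open_nbhs_nbhs.
have n1 := cinvK_near cq; have n2 := near_cinv cq nO.
apply: filterS2 n1 n2 => v [e _] Ov.
by rewrite /= !open_sub_insubK.
Qed.

Lemma msm_insub (z0 : open_sub oO) q : O q ->
  msm (insubd z0 : M -> open_sub oO) q.
Proof.
move=> Oq; split; first exact: insub_cts.
apply: (@sm_eq _ _ _ (fun v => v)); last exact: sm_id.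
by apply: filterS (insub_near z0 Oq) => v ->.
Qed.

(** The preferred charts of the open submanifold are restrictions of those of [M], so the tangent
    spaces are literally the same. *)
Lemma mderiv_insub (z0 : open_sub oO) q w : O q ->
  mderiv (insubd z0 : M -> open_sub oO) q w = w.
Proof.
move=> Oq.
have e : 'd (fun v : E => v) (cmap (chart_at q) q) w = w by exact: diff_idE.
rewrite -[RHS]e; apply/esym; apply: diff_eq.
  by apply: filterS (insub_near z0 Oq) => v ->.
exact: (sm_diff (sm_id _)).
Qed.

End Smooth.

Variables (M : manifoldType E) (O : set M) (oO : open O).

Fact open_sub_hausdorff : hausdorff_space (open_sub oO).
Proof.
move=> p q pq; apply: val_inj; apply: mfd_hausdorff => A B nA nB.
have [] := pq (\val @^-1` A) (\val @^-1` B).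
- exact: val_cts.
- exact: val_cts.
- by move=> z [Az Bz]; exists (\val z).
Qed.

Fact open_sub_second_countable : @second_countable (open_sub oO).
Proof.
have [B cB [oB bB]] := @mfd_second_countable _ _ M.
exists ((fun V : set M => \val @^-1` V) @` B); first exact: sub_countable (card_image_le _ _) cB.
split=> [_ [V BV <-]|z A /nbhs_open_sub [W [oW Wz WA]]].
  apply: open_comp; last exact: oB.
  by move=> ? _; exact: val_cts.
have nW : nbhs (\val z) W by exact: open_nbhs_nbhs.
have [V [BV Vz] VW] := bB _ _ nW.
exists (\val @^-1` V); first by split=> //; exists V.
by move=> r Vr; apply: WA; exact: VW.
Qed.

HB.instance Definition _ := isSeparatedSecondCountable.Build (open_sub oO)
  open_sub_hausdorff open_sub_second_countable.

End OpenSubmanifold.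

(** * Restriction of a slice to an invariant open set *)

Section SmallerSlice.
Variables (R : realType) (d n : nat).
Variables (G : lieGroupType 'rV[R]_d) (M : manifoldType 'rV[R]_n).
Variable act : G -> M -> M.
Hypothesis act_smooth : smooth_action act.
Implicit Types (g h a : G) (p q x y z : M) (xi : 'rV[R]_d).

Variables (x : M) (S U : set M) (k : nat).
Hypotheses (PS : pre_slice act x S k) (oU : open U) (Ux : U x).
Hypothesis Uinv : forall h z, stabilizer act x h -> U z -> U (act h z).

Let T := S `&` U.

Lemma tangent_restrict (E : normedModType R) (P : smoothSpaceType E) {fE : findim E}
    (A B : set P) (s : P) v : (\forall t \near s, A t -> B t) ->
  tangent_to A s v -> tangent_to B s v.
Proof.
move=> AB tv; have e : mderiv (fun t : P => t) s v = v by exact: mderiv_id.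
have t : tangent_to B s (mderiv (fun t : P => t) s v).
  exact: (tangent_image (msm_id s) AB tv).
by rewrite e in t.
Qed.

Let Tinv h s : stabilizer act x h -> T s -> T (act h s).
Proof. by move=> hx [Ss Us]; split; [exact: (ps_inv PS hx Ss)|exact: Uinv]. Qed.

(** A local section moves every point near [y] into [S], and by continuity into [U]; translation by
    [g] handles the points near [act g y]. *)
Let saturation_open : open (saturation act T).
Proof.
rewrite openE => z [g [y [[Sy Uy] ->]]].
have [c cy] := ps_chart PS Sy.
have [gm [sg g1 Sg]] := local_section act_smooth PS Sy cy.
pose r q := act (gm q)^-1%g q.
have sr : msm r y by apply: (msm_act act_smooth); [exact: msm_invg|exact: msm_id].
have r0 : r y = y by rewrite /r g1 invg1 act1.
have nU : \forall q \near r y, U q by rewrite r0; exact: open_nbhs_nbhs.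
have nr := near_comp (msm_cts sr) nU.
have nT : \forall q \near y, saturation act T q.
  apply: filterS2 Sg nr => q Sq Uq; exists (gm q), (r q); split=> //.
  by rewrite /r actVK.
have sg' : msm (act g^-1%g) (act g y) by exact: msm_actl.
have nT' : \forall q \near act g^-1%g (act g y), saturation act T q by rewrite actK.
have := near_comp (msm_cts sg') nT'.
apply: filterS => q [a [s [Ts e]]]; exists (g * a)%g, s; split=> //.
by rewrite actM // -e actVK.
Qed.

(* G x^H T is realized as the open submanifold G T of M. *)
Lemma slice_restrict : slice act x T.
Proof.
have Tx : T x by split=> //; exact: ps_mem PS.
have satx : saturation act T x by exists 1%g, x; rewrite act1.
split=> //.
  exists k => p [Sp Up]; have [c cp] := ps_chart PS Sp.
  by exists (restrict_chart c oU); exact: slice_chart_restrict.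
pose q0 : open_sub saturation_open := exist _ x (mem_set satx).
pose pi (b : G * M) := insubd q0 (act b.1 b.2) : open_sub saturation_open.
have sat g s : T s -> saturation act T (act g s) by exists g, s.
have piE g s : T s -> \val (pi (g, s)) = act g s.
  by move=> Ts; rewrite /pi open_sub_insubK //; exact: sat.
have spi (b : G * M) : T b.2 -> msm pi b.
  move=> Tb; apply: (msm_comp (msm_act0 act_smooth b)).
  by apply: msm_insub; exact: sat.
exists n, (open_sub saturation_open), pi, \val, (insubd q0); split.
- split.
  + by apply: msm_smooth_on => b [_ Tb]; exact: spi.
  + move=> z; have [g [s [Ts e]]] := open_sub_mem z.
    exists (g, s) => //; apply: val_inj; rewrite /= piE //.
  + move=> [g s] [g' s'] [_ /= Ts] [_ /= Ts'].
    have [f1 f2] := ps_fib PS g g' Ts.1 Ts'.1.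
    split=> [e|[h hx [e1 e2]]].
      have e' : act g s = act g' s' by rewrite -piE // e piE.
      by have [h hx [-> ->]] := f1 e'; exists h.
    apply: val_inj; rewrite /= !piE //; apply: f2; by exists h.
  + move=> [g y] [_ Ty] w; have [v [tv vw]] := ps_subm PS g w Ty.1.
    have tT : tangent_to ([set: G] `*` T) (g, y) v.
      apply: tangent_restrict tv.
      have nU : \forall z \near (g, y).2, U z by apply: open_nbhs_nbhs; split=> //; exact: Ty.2.
      have nb : \forall b \near (g, y), U b.2 by exact: (near_comp (msm_cts (msm_snd (g, y))) nU).
      by apply: filterS nb => -[a z] /= Uz [_ Sz].
    exists v; first exact: tT.
    have nid : \forall b \near (g, y), ([set: G] `*` T) b -> pi b = pi b by exact: near_all.
    apply: etrans (mderiv_onE (spi (g, y) Ty) nid tT) _.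
    have e1 : mderiv pi (g, y) v = mderiv (insubd q0 : M -> open_sub saturation_open)
        (act g y) (mderiv (fun b : G * M => act b.1 b.2) (g, y) v).
      exact: (mderiv_comp v (msm_act0 act_smooth (g, y)) (msm_insub q0 (sat g y Ty))).
    apply: etrans e1 _.
    apply: etrans (mderiv_insub q0 _ (sat g y Ty)) _.
    exact: vw.
- by move=> g s Ts; exact: piE.
- split.
  + move=> p _; split; first exact: open_sub_mem.
    by rewrite valKd.
  + by move=> q sq; split=> //; rewrite open_sub_insubK.
  + by apply: msm_smooth_on => b _; exact: msm_val.
  + by apply: msm_smooth_on => b sb; exact: msm_insub.
Qed.

Lemma smaller_slice_restrict : smaller_slice act x S T.
Proof. by split; [exact: slice_restrict|exists U]. Qed.

End SmallerSlice.

(** * Transition between two slices *)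

Section Straightening.
Variables (R : realType) (d n : nat).
Variables (G : lieGroupType 'rV[R]_d) (M : manifoldType 'rV[R]_n).
Variable act : G -> M -> M.
Hypothesis act_smooth : smooth_action act.
Implicit Types (g h a : G) (p q x y z : M) (xi : 'rV[R]_d).

Lemma orb_conj g x xi : orb act x xi = 0 -> orb act (act g x) (Ad g xi) = 0.
Proof.
move=> o0; rewrite -orb_equiv // o0.
exact: (clin0 (clin_mderiv (msm_actl act_smooth g x))).
Qed.

(** The new complement is the preimage of [m] under the matrix of [Ad g], so that membership in it
    is the condition on [Ad g xi] itself. *)
Lemma splitting_conj g x x' (m : {vspace 'rV[R]_d}) : act g x = x' ->
  equivariant_splitting (stabilizer act x') m ->
  exists m' : {vspace 'rV[R]_d}, (forall xi, (xi \in m') = (Ad g xi \in m)) /\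
    equivariant_splitting (stabilizer act x) m'.
Proof.
move=> gx [Hs Hu Ha].
have cg := Ad_clin g.
have gx' : act g^-1%g x' = x by rewrite -gx actK.
pose A : 'M[R]_d := \matrix_(i < d) Ad g (delta_mx 0 i).
have AE xi : xi *m A = Ad g xi.
  rewrite [in RHS](row_sum_delta xi) mulmx_sum_row (clin_sum _ cg).
  by apply: eq_bigr => i _; rewrite rowK (clinZ _ _ cg).
have [m' mE] : exists m' : {vspace 'rV[R]_d}, forall xi, (xi \in m') = (Ad g xi \in m).
  exists (linfun (mulmxr A) @^-1: m)%VS => xi.
  by rewrite -memv_preim lfunE /= AE.
exists m'; split=> //; split.
- move=> xi; have [eta [mu [he hm e]]] := Hs (Ad g xi).
  exists (Ad g^-1%g eta), (Ad g^-1%g mu); split.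
  + apply/(Lie_algebra_stab act_smooth); rewrite -gx'; apply: orb_conj.
    exact/(Lie_algebra_stab act_smooth).
  + by rewrite mE AdVK.
  + by rewrite -(clinD _ _ (Ad_clin g^-1%g)) -e AdK.
- move=> xi hx; rewrite mE => mx.
  have e0 : Ad g xi = 0.
    apply: Hu => //; apply/(Lie_algebra_stab act_smooth); rewrite -gx; apply: orb_conj.
    exact/(Lie_algebra_stab act_smooth).
  by rewrite -[xi](AdK g) e0; exact: (clin0 (Ad_clin g^-1%g)).
- move=> h mu hx; rewrite !mE => mm.
  have -> : Ad g (Ad h mu) = Ad (g * h * g^-1)%g (Ad g mu).
    by rewrite -!AdM mulgVK.
  by apply: Ha => //; exact: (stabJ act_smooth gx hx).
Qed.

(* [z = exp (Xi z) . s] with [Xi z] in [m] and [s] in [S], near [x]. *)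
Definition adapted x (S : set M) (m : {vspace 'rV[R]_d}) (Xi : M -> 'rV[R]_d) :=
  [/\ msm Xi x /\ Xi x = 0, forall z, Xi z \in m,
      (\forall z \near x, S (act (Lie_exp G (Xi z))^-1%g z)),
      (\forall b \near ((0 : 'rV[R]_d), x), b.1 \in m -> S b.2 ->
         Xi (act (Lie_exp G b.1) b.2) = b.1) &
      (\forall z \near x, forall h, stabilizer act x h -> Xi (act h z) = Ad h (Xi z))].

Definition slide (g : G) (Xi : M -> 'rV[R]_d) y : G :=
  ((Lie_exp G (Xi (act g y)))^-1 * g)%g.

Definition straighten g Xi y : M := act (slide g Xi y) y.

Section OneSide.
Variables (g : G) (x x' : M) (S : set M) (m : {vspace 'rV[R]_d}) (Xi : M -> 'rV[R]_d).
Hypotheses (gx : act g x = x') (aXi : adapted x' S m Xi).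

Let sXi : msm (fun y => Xi (act g y)) x.
Proof.
have [[s _] _ _ _ _] := aXi.
by apply: (msm_comp (msm_actl act_smooth g x)); rewrite gx.
Qed.

Let Xi0 : Xi (act g x) = 0.
Proof. by have [[_ e] _ _ _ _] := aXi; rewrite gx. Qed.

Lemma msm_slide : msm (slide g Xi) x.
Proof.
apply: msm_mulg; last exact: msm_cst.
by apply: msm_invg; apply: (msm_comp sXi); rewrite Xi0; exact: msm_exp0.
Qed.

Lemma straighten0 : straighten g Xi x = x'.
Proof. by rewrite /straighten /slide Xi0 exp0 invg1 mul1g gx. Qed.

Lemma straighten_mem : \forall y \near x, S (straighten g Xi y).
Proof.
have [_ _ nS _ _] := aXi.
have nS' : \forall z \near act g x, S (act (Lie_exp G (Xi z))^-1%g z) by rewrite gx.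
have := near_comp (msm_cts (msm_actl act_smooth g x)) nS'.
by apply: filterS => y; rewrite /straighten /slide actM.
Qed.

(** With k = g h g^-1, equivariance of [Xi] turns the exponential at k g y into the conjugate by k
    of the one at g y. *)
Lemma slide_equiv : \forall y \near x, forall h, stabilizer act x h ->
  slide g Xi (act h y) = (g * h * g^-1 * slide g Xi y * h^-1)%g.
Proof.
have [_ _ _ _ nE] := aXi.
have nE' : \forall z \near act g x, forall h, stabilizer act x' h ->
  Xi (act h z) = Ad h (Xi z) by rewrite gx.
have nE2 := near_comp (msm_cts (msm_actl act_smooth g x)) nE'.
apply: filterS nE2 => y H h hx.
have kx := stabJ act_smooth gx hx; rewrite /slide.
have -> : act g (act h y) = act (g * h * g^-1)%g (act g y).
  by rewrite -!(actM act_smooth) mulgVK.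
rewrite H // -exp_conj; set E := Lie_exp G _.
by rewrite !invgM !invgK !mulgA mulgVK.
Qed.

(** Moving the exponential across [g] shows that g^-1 applied to the straightened point is exp(b) .
    y with b in [m2] and y in [S2]. By uniqueness [Xi2] returns b there, and the second map undoes
    exp(b). *)
Lemma straightenK m2 S2 Xi2 : adapted x S2 m2 Xi2 ->
  (forall xi, xi \in m -> Ad g^-1%g xi \in m2) ->
  \forall y \near x, S2 y -> straighten g^-1%g Xi2 (straighten g Xi y) = y.
Proof.
move=> [[sXi2 _] _ _ nU _] mm; have [_ Xim _ _ _] := aXi.
pose f y : 'rV[R]_d * M := (- Ad g^-1%g (Xi (act g y)), y).
have sf : msm f x.
  apply: msm_pair; last exact: msm_id.
  by apply: msm_oppf; apply: msm_Ad => //; exact: msm_cst.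
have f0 : f x = (0, x).
  by rewrite /f Xi0 (clin0 (Ad_clin g^-1%g)) oppr0.
have nU' : \forall b \near f x, b.1 \in m2 -> S2 b.2 ->
         Xi2 (act (Lie_exp G b.1) b.2) = b.1 by rewrite f0.
have nU2 := near_comp (msm_cts sf) nU'.
apply: filterS nU2 => y /= H Sy.
have m2f : - Ad g^-1%g (Xi (act g y)) \in m2 by rewrite rpredN; exact/mm/Xim.
have {}H := H m2f Sy.
have e : act g^-1%g (straighten g Xi y) = act (Lie_exp G (f y).1) y.
  rewrite /straighten /slide -(actM act_smooth) /= expN -exp_conj; congr act.
  by rewrite !invgM !invgK !mulgA.
rewrite /straighten /slide actM // -/(straighten g Xi y) e H.
by rewrite actK.
Qed.

End OneSide.
End Straightening.

(** * Derivative of a map moved by a variable group element *)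

Section Connection.
Variables (R : realType) (d n : nat).
Variables (G : lieGroupType 'rV[R]_d) (M : manifoldType 'rV[R]_n).
Variable act : G -> M -> M.
Hypothesis act_smooth : smooth_action act.
Implicit Types (g h k : G) (p q x y z : M) (xi : 'rV[R]_d).

(* (da) a^-1 *)
Definition rlog_deriv (a : M -> G) y (v : 'rV[R]_n) : 'rV[R]_d :=
  mderiv (fun y' => (a y' * (a y)^-1)%g) y v.

Lemma msm_rtrans (a : M -> G) (b : G) y : msm a y -> msm (fun y' => (a y' * b)%g) y.
Proof. by move=> sa; apply: msm_mulg => //; exact: msm_cst. Qed.

Lemma msm_rlog_deriv (a : M -> G) (X : M -> 'rV[R]_n) x : msm a x -> vsm X x ->
  msm (fun y => rlog_deriv a y (X y)) x.
Proof.
move=> sa vX; pose c := chart_at (1%g : G).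
have kc : compat c by exact: chart_at_compat.
have c1 : cdom c 1%g by exact: chart_at_dom.
pose f (b : M * M) : 'rV[R]_d := cmap c (a b.1 * (a b.2)^-1)%g.
have sf : msm f (x, x).
  have e1 : (a x * (a x)^-1)%g = 1%g by rewrite mulgV.
  have sk : msm (cmap c) (a x * (a x)^-1)%g by rewrite e1; exact: msm_cmap.
  have s1 : msm (fun b : M * M => a b.1) (x, x) by exact: (msm_comp (msm_fst (x, x)) sa).
  have s2 : msm (fun b : M * M => a b.2) (x, x) by exact: (msm_comp (msm_snd (x, x)) sa).
  exact: (msm_comp (msm_mulg s1 (msm_invg s2)) sk).
have sm1 : msm (fun y => mderiv (fun y' => f (y', y)) y (X y)) x.
  exact: (vsm_deriv vX (msm_id x) sf).
have na : \forall y \near x, msm a y by exact: msm_near.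
apply: msm_eq sm1; apply: filterS na => y say.
have e1 : (a y * (a y)^-1)%g = 1%g by rewrite mulgV.
have sk : msm (cmap c) (a y * (a y)^-1)%g by rewrite e1; exact: msm_cmap.
have H : mderiv (fun y' => f (y', y)) y (X y) =
    mderiv (cmap c) (a y * (a y)^-1)%g (rlog_deriv a y (X y)).
  exact: (mderiv_comp (X y) (msm_rtrans (a y)^-1%g say) sk).
rewrite H.
apply: etrans (congr1 (fun b => mderiv (cmap c) b (rlog_deriv a y (X y))) e1) _.
exact: dcmap_at.
Qed.

(** Write a(y') . y' = (a(y') a(y)^-1) . (a(y) . y'): the first factor is 1 at y, so the two partial
    derivatives are an orbit vector and the derivative of a fixed translation. *)
Lemma mderiv_act_moving (a : M -> G) y v : msm a y ->
  mderiv (fun y' => act (a y') y') y v =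
    orb act (act (a y) y) (rlog_deriv a y v) + mderiv (act (a y)) y v.
Proof.
move=> sa; pose A y' := (a y' * (a y)^-1)%g; pose z y' := act (a y) y'.
have A1 : A y = 1%g by rewrite /A mulgV.
have sA : msm A y by exact: msm_rtrans.
have sz : msm z y by exact: msm_actl.
have e : (fun y' => act (a y') y') = (fun y' => act (A y') (z y')).
  by apply/funext => y'; rewrite -actM // /A mulgVK.
have E0 : mderiv (fun y' => act (a y') y') y v = mderiv (fun y' => act (A y') (z y')) y v.
  by rewrite e.
have E1 : mderiv (fun b => act b (z y)) (A y) (mderiv A y v) =
    orb act (z y) (rlog_deriv a y v).
  exact: (congr1 (fun b => mderiv (fun b' => act b' (z y)) b (mderiv A y v)) A1).
have E2 : mderiv (fun q => act (A y) q) (z y) (mderiv z y v) = mderiv z y v.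
  have e2 : (fun q => act (A y) q) = (fun q => q).
    by apply/funext => q; rewrite A1 act1.
  apply: etrans (congr1 (fun f => mderiv f (z y) (mderiv z y v)) e2) _.
  exact: mderiv_id.
have H : mderiv (fun y' => act (A y') (z y')) y v =
    mderiv (fun b => act b (z y)) (A y) (mderiv A y v) +
    mderiv (fun q => act (A y) q) (z y) (mderiv z y v).
  exact: (@mderiv_comp2 _ _ _ _ _ _ _ _ _ (fun b : G * M => act b.1 b.2) A z y v
    (msm_act0 act_smooth _) sA sz).
exact: (etrans (etrans E0 H) (f_equal2 (fun u w => u + w) E1 E2)).
Qed.

(** In the quotient a(k y') a(k y)^-1 the right factors k^-1 cancel, and what remains is a conjugate
    by h. *)
Lemma rlog_deriv_equiv (a : M -> G) h k y v : msm a y -> msm a (act k y) ->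
  (\forall y' \near y, a (act k y') = (h * a y' * k^-1)%g) ->
  rlog_deriv a (act k y) (mderiv (act k) y v) = Ad h (rlog_deriv a y v).
Proof.
move=> sa sak nE.
have ey : a (act k y) = (h * a y * k^-1)%g by exact: (nbhs_singleton nE).
have sA := msm_rtrans (a (act k y))^-1%g sak.
have sB := msm_rtrans (a y)^-1%g sa.
apply: etrans (esym (mderiv_comp v (msm_actl act_smooth k y) sA)) _.
have nE2 : \forall y' \near y, (a (act k y') * (a (act k y))^-1)%g =
    (h * (a y' * (a y)^-1) * h^-1)%g.
  apply: filterS nE => y' e; rewrite e ey !invgM invgK !mulgA mulgVK.
  by [].
have s1 : msm (fun y' => (a (act k y') * (a (act k y))^-1)%g) y.
  exact: (msm_comp (msm_actl act_smooth k y) sA).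
have E1 : mderiv (fun y' => (a (act k y') * (a (act k y))^-1)%g) y v =
    mderiv (fun y' => (h * (a y' * (a y)^-1) * h^-1)%g) y v by exact: mderiv_eq.
apply: etrans E1 _.
have sc (b : G) : msm (fun b : G => (h * b * h^-1)%g) b by apply: msm_conjg; exact: msm_id.
have e1 : (a y * (a y)^-1)%g = 1%g by rewrite mulgV.
have H : mderiv (fun y' => (h * (a y' * (a y)^-1) * h^-1)%g) y v =
   mderiv (fun b : G => (h * b * h^-1)%g) (a y * (a y)^-1)%g (rlog_deriv a y v).
  exact: (mderiv_comp v sB (sc _)).
apply: etrans H _.
exact: (congr1 (fun b => mderiv (fun b : G => (h * b * h^-1)%g) b (rlog_deriv a y v)) e1).
Qed.

Lemma vsm_sub_orb (X : M -> 'rV[R]_n) (zeta : M -> 'rV[R]_d) x :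
  vsm X x -> msm zeta x -> vsm (fun z => X z - orb act z (zeta z)) x.
Proof.
move=> vX sz; pose c := chart_at x.
have kc : compat c by exact: chart_at_compat.
have cx : cdom c x by exact: chart_at_dom.
have s1 : msm (fun z => mderiv (cmap c) z (X z)) x by exact: vX.
have s2 : msm (fun z => mderiv (cmap c) z (orb act z (zeta z))) x.
  exact: (msm_orb_chart act_smooth kc cx (msm_id x) sz).
have s3 : msm (fun z => mderiv (cmap c) z (X z) - mderiv (cmap c) z (orb act z (zeta z))) x.
  exact: msm_subf s1 s2.
have n3 : \forall z \near x, mderiv (cmap c) z (X z) - mderiv (cmap c) z (orb act z (zeta z)) =
    mderiv (cmap c) z (X z - orb act z (zeta z)).
  apply: filterS (near_cdom cx) => z cz.
  exact: esym (clinB _ _ (clin_mderiv (msm_cmap kc cz))).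
exact: (msm_eq n3 s3).
Qed.

End Connection.

(** * Transport of the components, and comparison of the two slices *)

Section Final.
Variables (R : realType) (d n : nat).
Variables (G : lieGroupType 'rV[R]_d) (M : manifoldType 'rV[R]_n).
Variable act : G -> M -> M.
Hypothesis act_smooth : smooth_action act.
Implicit Types (g h k : G) (p q x y z : M) (xi : 'rV[R]_d).

Lemma component_equiv (X : M -> 'rV[R]_n) g y Z xi : invariant_field act X ->
  X y = Z + orb act y xi ->
  X (act g y) = mderiv (act g) y Z + orb act (act g y) (Ad g xi).
Proof.
move=> iX e; rewrite -(iX g y) e -orb_equiv //.
exact: (clinD _ _ (clin_mderiv (msm_actl act_smooth g y))).
Qed.

Lemma tangent_act (S : set M) g y Z : (forall s, S s -> S (act g s)) ->
  tangent_to S y Z -> tangent_to S (act g y) (mderiv (act g) y Z).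
Proof.
move=> Sg tZ; apply: tangent_image tZ; first exact: msm_actl.
exact: near_all.
Qed.

End Final.

Theorem theorem1p7 (R : realType) (d n : nat)
    (G : lieGroupType 'rV[R]_d) (M : manifoldType 'rV[R]_n)
    (act : G -> M -> M) (X : M -> 'rV[R]_n) (x1 x2 : M) (S1 S2 : set M)
    (m1 m2 : {vspace 'rV[R]_d}) (X1 X2 : M -> 'rV[R]_n) :
  smooth_action act -> proper_action act ->
  smooth_field X -> invariant_field act X ->
  (exists g : G, act g x1 = x2) ->
  slice act x1 S1 -> slice act x2 S2 ->
  equivariant_splitting (stabilizer act x1) m1 ->
  equivariant_splitting (stabilizer act x2) m2 ->
  slice_component act X S1 m1 X1 ->
  slice_component act X S2 m2 X2 ->
  exists T1 T2 : set M,
    [/\ smaller_slice act x1 S1 T1, smaller_slice act x2 S2 T2 &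
        exists phi phi' : M -> M,
          [/\ diffeo_on T1 T2 phi phi',
              equivariant_map act x1 x2 T1 phi &
              isomorphic_fields act (stabilizer act x2) T2
                (pushforward T1 phi phi' X1) X2]].
Proof.
move=> sa pa sX iX [g0 g0x] /slice_pre H1 /slice_pre H2 Spl1 Spl2 C1 C2.
have [k1 PS1] := H1 sa; have [k2 PS2] := H2 sa.
have vX x : vsm X x by exact: smooth_field_vsm.
have g0x' : act g0^-1%g x2 = x1 by rewrite -g0x actK.
(* The decomposition at [x1] is taken along the conjugate of [m2]; the given [m1] serves only to
   define [zeta1]. *)
have [m1' [m1E Spl1']] := splitting_conj sa g0x Spl2.
have [Xi2 A2] := decomposition sa pa PS2 Spl2.
have [Xi1 A1] := decomposition sa pa PS1 Spl1'.
have [zeta1 [sz1 cz1]] := component_smooth sa PS1 Spl1 (vX x1).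
have [zeta2 [sz2 cz2]] := component_smooth sa PS2 Spl2 (vX x2).
pose a := slide act g0 Xi2; pose phi := straighten act g0 Xi2.
pose a' := slide act g0^-1%g Xi1; pose phi' := straighten act g0^-1%g Xi1.
have sa1 : msm a x1 by exact: (msm_slide sa g0x A2).
have sb2 : msm a' x2 by exact: (msm_slide sa g0x' A1).
have sphi1 : msm phi x1 by apply: (msm_act sa sa1); exact: msm_id.
have sphi2 : msm phi' x2 by apply: (msm_act sa sb2); exact: msm_id.
have phi0 : phi x1 = x2 by exact: (straighten0 g0x A2).
have phi'0 : phi' x2 = x1 by exact: (straighten0 g0x' A1).
have m12 xi : xi \in m2 -> Ad g0^-1%g xi \in m1' by rewrite m1E AdVK.
have m21 xi : xi \in m1' -> Ad (g0^-1)^-1%g xi \in m2 by rewrite m1E invgK.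
(* A field smooth near [x1] in [M], which stands in for [X1] in the formula for psi. *)
pose Xh y := X y - orb act y (zeta1 y).
have vXh : vsm Xh x1 by exact: vsm_sub_orb.
pose om y := rlog_deriv a y (Xh y).
have som : msm om x1 by exact: msm_rlog_deriv.
(* All that was obtained as germs at the base points is collected in one property on each side, to
   be imposed on an invariant neighbourhood. *)
pose P1 y := [/\ [/\ msm a y, msm zeta1 y & msm om y],
  S2 (phi y), S1 y -> phi' (phi y) = y,
  (forall h, stabilizer act x1 h -> a (act h y) = (g0 * h * g0^-1 * a y * h^-1)%g) &
  (S1 y -> forall Z xi, tangent_to S1 y Z -> xi \in m1 ->
     X y = Z + orb act y xi -> zeta1 y = xi)].
pose P2 s := [/\ [/\ msm phi' s & msm zeta2 s], S1 (phi' s), S2 s -> phi (phi' s) = s,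
  (forall h, stabilizer act x2 h -> a' (act h s) = (g0^-1 * h * g0^-1^-1 * a' s * h^-1)%g) &
  (S2 s -> forall Z xi, tangent_to S2 s Z -> xi \in m2 ->
     X s = Z + orb act s xi -> zeta2 s = xi)].
have nP1 : \forall y \near x1, P1 y.
  have n1 : \forall y \near x1, [/\ msm a y, msm zeta1 y & msm om y].
    exact: (filterS3 _ (fun y h1 h2 h3 => And3 h1 h2 h3)
      (msm_near sa1) (msm_near sz1) (msm_near som)).
  have n2 : \forall y \near x1, S2 (phi y) by exact: (straighten_mem sa g0x A2).
  have n3 : \forall y \near x1, S1 y -> phi' (phi y) = y.
    exact: (straightenK sa g0x A2 A1 m12).
  have n4 : \forall y \near x1, forall h, stabilizer act x1 h ->
      a (act h y) = (g0 * h * g0^-1 * a y * h^-1)%g by exact: (slide_equiv sa g0x A2).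
  have n5 : \forall y \near x1, (S2 (phi y) /\ (S1 y -> phi' (phi y) = y)).
    by apply: filterS2 n2 n3 => y h1 h2.
  have n6 : \forall y \near x1, [/\ msm a y, msm zeta1 y & msm om y] /\
      (S2 (phi y) /\ (S1 y -> phi' (phi y) = y)).
    by apply: filterS2 n1 n5 => y h1 h2.
  by apply: filterS3 n6 n4 cz1 => y [h1 [h2 h3]] h4 h5; split.
have nP2 : \forall s \near x2, P2 s.
  have n1 : \forall s \near x2, [/\ msm phi' s & msm zeta2 s].
    by apply: filterS2 (msm_near sphi2) (msm_near sz2) => s h1 h2.
  have n2 : \forall s \near x2, S1 (phi' s) by exact: (straighten_mem sa g0x' A1).
  have n3 : \forall s \near x2, S2 s -> phi (phi' s) = s.
    have := straightenK sa g0x' A1 A2 m21.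
    by rewrite invgK.
  have n4 : \forall s \near x2, forall h, stabilizer act x2 h ->
      a' (act h s) = (g0^-1 * h * g0^-1^-1 * a' s * h^-1)%g by exact: (slide_equiv sa g0x' A1).
  have n5 : \forall s \near x2, [/\ msm phi' s & msm zeta2 s] /\ S1 (phi' s).
    by apply: filterS2 n1 n2 => s h1 h2.
  have n6 : \forall s \near x2, ([/\ msm phi' s & msm zeta2 s] /\ S1 (phi' s)) /\
      (S2 s -> phi (phi' s) = s) by apply: filterS2 n5 n3 => s h1 h2.
  by apply: filterS3 n6 n4 cz2 => s [[h1 h2] h3] h4 h5; split.
have [U1 [oU1 U1x U1P U1h]] := invariant_nbhs sa pa nP1.
have [U2 [oU2 U2x U2P U2h]] := invariant_nbhs sa pa nP2.
have sphi y : U1 y -> msm phi y.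
  by move=> /U1P [[say _ _] _ _ _ _]; apply: (msm_act sa say); exact: msm_id.
have sphi' s : U2 s -> msm phi' s by move=> /U2P [[]].
(* Each slice is cut down also by the preimage of the other neighbourhood; only then do the two maps
   exchange the smaller slices. *)
pose V1 := [set y | U1 y /\ U2 (phi y)].
pose V2 := [set s | U2 s /\ U1 (phi' s)].
have oV1 : open V1.
  rewrite openE => y [U1y U2y].
  have n1 : \forall z \near y, U1 z by exact: open_nbhs_nbhs.
  have n2 : \forall z \near phi y, U2 z by exact: open_nbhs_nbhs.
  by apply: filterS2 n1 (near_comp (msm_cts (sphi y U1y)) n2) => z.
have oV2 : open V2.
  rewrite openE => y [U2y U1y].
  have n1 : \forall z \near y, U2 z by exact: open_nbhs_nbhs.
  have n2 : \forall z \near phi' y, U1 z by exact: open_nbhs_nbhs.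
  by apply: filterS2 n1 (near_comp (msm_cts (sphi' y U2y)) n2) => z.
have V1x : V1 x1 by split=> //; rewrite phi0.
have V2x : V2 x2 by split=> //; rewrite phi'0.
have phih h y : stabilizer act x1 h -> U1 y ->
    phi (act h y) = act (g0 * h * g0^-1)%g (phi y).
  move=> hx /U1P [_ _ _ /(_ h hx) e _].
  by rewrite /phi /straighten -/a e -!(actM sa) mulgVK.
have V1h h y : stabilizer act x1 h -> V1 y -> V1 (act h y).
  move=> hx [U1y U2y]; split; first exact: U1h.
  by rewrite phih //; apply: U2h => //; exact: (stabJ sa g0x hx).
pose T1 := S1 `&` V1; pose T2 := S2 `&` V2.
have T12 y : T1 y -> T2 (phi y) /\ phi' (phi y) = y.
  move=> [S1y [U1y U2y]]; have [_ S2y K _ _] := U1P y U1y.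
  by split; [split=> //; split=> //; rewrite K|exact: K].
have T21 s : T2 s -> T1 (phi' s) /\ phi (phi' s) = s.
  move=> [S2s [U2s U1s]]; have [_ S1s K _] := U2P s U2s.
  by split; [split=> //; split=> //; rewrite K|exact: K].
have V2h h s : stabilizer act x2 h -> V2 s -> V2 (act h s).
  move=> hx [U2s U1s]; split; first exact: U2h.
  have [_ _ _ /(_ h hx) e _] := U2P s U2s.
  have -> : phi' (act h s) = act (g0^-1 * h * g0^-1^-1)%g (phi' s).
    by rewrite /phi' /straighten -/a' e -!(actM sa) mulgVK.
  by apply: U1h => //; exact: (stabJ sa g0x' hx).
exists T1, T2; split.
- exact: (smaller_slice_restrict sa PS1 oV1 V1x V1h).
- exact: (smaller_slice_restrict sa PS2 oV2 V2x V2h).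
exists phi, phi'; split.
- split=> //.
  + by apply: msm_smooth_on => y [_ [U1y _]]; exact: sphi.
  + by apply: msm_smooth_on => s [_ [U2s _]]; exact: sphi'.
- by exists g0 => // h y hx [_ [U1y _]]; exact: phih.
(* Along y = phi' s the derivative of [phi] on X1 is om_M plus the translate of X1 by a(y). By
   invariance of X this translate is X2 + (zeta2)_M - (Ad a zeta1)_M at s, and psi collects the
   three fundamental fields. *)
pose psi s := om (phi' s) + zeta2 s - Ad (a (phi' s)) (zeta1 (phi' s)).
(* On the slice, [Xh] is the component of [X] along [S1]. *)
have C1' y : T1 y -> [/\ tangent_to S1 y (X1 y), zeta1 y \in m1,
    X y = X1 y + orb act y (zeta1 y) & X1 y = Xh y].
  move=> [S1y [U1y _]]; have [_ _ _ _ Z1] := U1P y U1y.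
  have [tX [xi mxi e]] := C1 y S1y; rewrite fundE // in e.
  have ez : zeta1 y = xi by exact: (Z1 S1y _ _ tX mxi e).
  by rewrite /Xh ez e; split=> //; rewrite addrK.
have C2' s : T2 s -> [/\ tangent_to S2 s (X2 s), zeta2 s \in m2 &
    X s = X2 s + orb act s (zeta2 s)].
  move=> [S2s [U2s _]]; have [_ _ _ _ Z2] := U2P s U2s.
  have [tX [xi mxi e]] := C2 s S2s; rewrite fundE // in e.
  have ez : zeta2 s = xi by exact: (Z2 S2s _ _ tX mxi e).
  by rewrite ez; split.
have key s : T2 s -> tangent_to S2 s (pushforward T1 phi phi' X1 s) /\
    pushforward T1 phi phi' X1 s = X2 s + orb act s (psi s).
  move=> T2s; have [T1y e] := T21 s T2s; rewrite /pushforward.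
  set y := phi' s in T1y e *.
  have [tX1 mz1 eX1 eXh] := C1' y T1y; have [_ _ eX2] := C2' s T2s.
  have [S1y [U1y U2y]] := T1y.
  have [[say _ _] _ _ _ _] := U1P y U1y.
  have tT1 : tangent_to T1 y (X1 y).
    apply: tangent_restrict tX1.
    have nV : \forall z \near y, V1 z by exact: open_nbhs_nbhs.
    by apply: filterS nV => z V1z S1z.
  have nid : \forall z \near y, T1 z -> phi z = phi z by exact: near_all.
  have -> : mderiv_on T1 phi y (X1 y) = mderiv phi y (X1 y).
    exact: (mderiv_onE (sphi y U1y) nid tT1).
  split.
    rewrite -e; apply: tangent_image tX1; first exact: sphi.
    have nU : \forall z \near y, U1 z by exact: open_nbhs_nbhs.
    by apply: filterS nU => z /U1P [].
  have ea : act (a y) y = s by [].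
  have E1 : mderiv phi y (X1 y) = orb act s (om y) + mderiv (act (a y)) y (X1 y).
    rewrite /om -eXh -[in RHS]ea; exact: (mderiv_act_moving sa _ say).
  have E2 := component_equiv sa (a y) iX eX1.
  rewrite ea eX2 in E2.
  have E3 : mderiv (act (a y)) y (X1 y) =
      X2 s + orb act s (zeta2 s) - orb act s (Ad (a y) (zeta1 y)) by rewrite E2 addrK.
  have E4 : orb act s (psi s) = orb act s (om y) + orb act s (zeta2 s) - orb act s (Ad (a y) (zeta1 y)).
    exact: etrans (clinB _ _ (orb_clin sa s)) (f_equal2 (fun u v => u - v) (clinD _ _ (orb_clin sa s)) erefl).
  by rewrite E1 E3 E4 -!addrA [LHS]addrCA.
exists psi; split.
- apply: msm_smooth_on => s [S2s [U2s U1s]].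
  have [[say szy soy] _ _ _ _] := U1P _ U1s; have [[_ sz] _ _ _ _] := U2P _ U2s.
  have sp := sphi' s U2s.
  apply: msm_subf.
    by apply: msm_addf => //; exact: (msm_comp sp soy).
  by apply: msm_Ad; [exact: (msm_comp sp say)|exact: (msm_comp sp szy)].
- move=> s T2s; apply/(Lie_algebra_stab sa).
  have [t1 e1] := key s T2s; have [t2 _ _] := C2' s T2s.
  have [c cs] := ps_chart PS2 T2s.1.
  (* Transversality is used at [s] but concludes at [x2]: the values of psi lie in the algebra of
     the stabilizer of the base point, as required. *)
  apply: (slice_transversal sa PS2 T2s.1 cs t1 t2).
  by rewrite e1 addrC addKr.
- move=> h s hx T2s; have [T1y e] := T21 s T2s.
  (* [phi'] intertwines [h] with [k]. Each term of psi then transforms by [Ad h]: the zetas by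
     uniqueness of components, [om] by [rlog_deriv_equiv], and Ad a zeta1 because a(k y) k = h
     a(y). *)
  pose k := (g0^-1 * h * g0)%g.
  have hk : h = (g0 * k * g0^-1)%g by rewrite /k !mulgA mulgV mul1g mulgK.
  have kx : stabilizer act x1 k.
    by have := stabJ sa g0x' hx; rewrite invgK.
  set y := phi' s in T1y e.
  have T1ky : T1 (act k y).
    by case: T1y => S1y V1y; split; [exact: (ps_inv PS1 kx S1y)|exact: V1h].
  have T2hs : T2 (act h s).
    by case: T2s => S2s V2s; split; [exact: (ps_inv PS2 hx S2s)|exact: V2h].
  have ey : phi' (act h s) = act k y.
    by rewrite -(T12 _ T1ky).2 phih ?e -?hk //; case: T1y => _ [].
  have [tX1 mz1 eX1 eXh] := C1' y T1y; have [tX2 mz2 eX2] := C2' s T2s.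
  have [_ _ Ad1' ] := Spl1; have [_ _ Ad2'] := Spl2.
  have U1ky : U1 (act k y) by case: T1ky => _ [].
  have U1y : U1 y by case: T1y => _ [].
  have U2hs : U2 (act h s) by case: T2hs => _ [].
  have [[saky _ _] _ _ _ Z1] := U1P _ U1ky.
  have [[say _ _] _ _ aE _] := U1P _ U1y.
  have [_ _ _ _ Z2] := U2P _ U2hs.
  (* The translate by [k] of the decomposition of X at y is a decomposition at k y, since the
     tangent spaces of [S1] and [m1] are preserved; uniqueness identifies its group part. *)
  have z1E : zeta1 (act k y) = Ad k (zeta1 y).
    apply: (Z1 T1ky.1 (mderiv (act k) y (X1 y))).
    - by apply: tangent_act tX1 => // b; exact: (ps_inv PS1 kx).
    - exact: Ad1'.
    - exact: component_equiv.
  have z2E : zeta2 (act h s) = Ad h (zeta2 s).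
    apply: (Z2 T2hs.1 (mderiv (act h) s (X2 s))).
    - by apply: tangent_act tX2 => // b; exact: (ps_inv PS2 hx).
    - exact: Ad2'.
    - exact: component_equiv.
  have XhE : Xh (act k y) = mderiv (act k) y (Xh y).
    by rewrite -eXh /Xh z1E (component_equiv sa k iX eX1) addrK.
  have omE : om (act k y) = Ad h (om y).
    rewrite /om XhE; apply: rlog_deriv_equiv => //.
    have nU : \forall z \near y, U1 z by exact: open_nbhs_nbhs.
    by apply: filterS nU => z /U1P [_ _ _ /(_ k kx) -> _]; rewrite -hk.
  have cA := Ad_clin h.
  have E : Ad h (psi s) = Ad h (om y) + Ad h (zeta2 s) - Ad h (Ad (a y) (zeta1 y)).
    exact: etrans (clinB _ _ cA) (f_equal2 (fun u v => u - v) (clinD _ _ cA) erefl).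
  have eA : Ad (a (act k y)) (Ad k (zeta1 y)) = Ad h (Ad (a y) (zeta1 y)).
    rewrite -(AdM (a (act k y)) k) -(AdM h (a y)); congr (Ad _ (zeta1 y)).
    by rewrite aE // -hk mulgVK.
  have E' : psi (act h s) = om (act k y) + zeta2 (act h s) -
      Ad (a (act k y)) (zeta1 (act k y)) by rewrite /psi ey.
  by rewrite E' E omE z1E z2E eA.
- by move=> s T2s; rewrite fundE //; have [] := key s T2s.
Qed.
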